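(* Let $(M,L)$ be a Finsler manifold with $\dim M\geq3$. Suppose that the $h$-curvature tensor $R$ of the Cartan connection satisfies, for all $\pi$-vector fields $\overline{X},\overline{Y},\overline{Z}$, $$R(\overline{X},\overline{Y})\overline{Z}=k\big\{g(\overline{X},\overline{Z})\overline{Y}-g(\overline{Y},\overline{Z})\overline{X}+\omega(\overline{X},\overline{Y})\overline{Z}\big\},$$ where $k(x,y)$ is a smooth function on $\mathcal{T}M$ homogeneous of degree $0$ in $y$, $k\neq0$, and $$\omega(\overline{X},\overline{Y})\overline{Z}=\mathfrak{A}_{\overline{X},\overline{Y}}\big\{H(\overline{X},\overline{Z})\phi(\overline{Y})+\hbar(\overline{X},\overline{Z})H_{o}(\overline{Y})\big\},$$ with $H$ a symmetric indicatory scalar $\pi$-form of order $2$ (a $\pi$-tensor field of type $(0,2)$), homogeneous of degree $0$ in $y$, and $H_o$ defined by $g(H_o(\overline{X}),\overline{Y})=H(\overline{X},\overline{Y})$. Then $(M,L)$ is $S_4$-like, that is, $$S(\overline{X},\overline{Y})\overline{Z}=\frac{1}{L^{2}}\mathfrak{A}_{\overline{X},\overline{Y}}\big\{\mu(\overline{X},\overline{Z})\phi(\overline{Y})+\hbar(\overline{X},\overline{Z})\mu_{o}(\overline{Y})\big\}$$ for all $\pi$-vector fields $\overline{X},\overline{Y},\overline{Z}$, where $$\mu(\overline{X},\overline{Y})=H(\overline{X},\overline{Y})+\frac{(\stackrel{1}{\nabla}\stackrel{1}{\nabla}H)(\overline{\eta},\overline{\eta},\overline{X},\overline{Y})}{2kL^{2}}$$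 and $\mu_o$ is defined by $g(\mu_o(\overline{X}),\overline{Y})=\mu(\overline{X},\overline{Y})$.
   Context: $M$ is a connected smooth manifold, $\mathcal{T}M=TM\setminus 0$ is the bundle of nonzero tangent vectors, $\pi:\mathcal{T}M\to M$ the projection, and $\pi^{-1}(TM)\to\mathcal{T}M$ the pullback bundle. Sections of $\pi^{-1}(TM)$ are called $\pi$-vector fields (written $\overline{X},\overline{Y},\dots$); tensor fields on $\pi^{-1}(TM)$ are called $\pi$-tensor fields. The fundamental $\pi$-vector field is $\overline{\eta}(u)=(u,u)$. There is an exact sequence $0\to\pi^{-1}(TM)\xrightarrow{\gamma}T(\mathcal{T}M)\xrightarrow{\rho}\pi^{-1}(TM)\to0$, where $\gamma(u,v)=\frac{d}{dt}|_{t=0}(u+tv)$ and $\rho(X)=(u,d\pi(X))$ for $X\in T_u(\mathcal{T}M)$. $L$ is the Finsler function and $g$ the Finsler metric on $\pi^{-1}(TM)$ defined by $L$ (in coordinates $g_{ij}=\frac12\partial^2L^2/\partial y^i\partial y^j$), so $g(\overline{\eta},\overline{\eta})=L^2$; $\ell:=L^{-1}g(\overline{\eta},\cdot)$; the angular metric tensor is $\hbar:=g-\ell\otimes\ell$; $\phi$ is the vector $\pi$-form defined by $g(\phi(\overline{X}),\overline{Y})=\hbar(\overline{X},\overline{Y})$. A connection $\nabla$ on $\pi^{-1}(TM)$ has connection map $K(X)=\nabla_X\overline{\eta}$, $X\in T(\mathcal{T}M)$; it is regular if $T(\mathcal{T}M)=\ker d\pi\oplus\ker K$, and then its horizontal map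 is $\beta:=(\rho|_{\ker K})^{-1}$. Its torsion is $\mathbf{T}(X,Y)=\nabla_X\rho Y-\nabla_Y\rho X-\rho[X,Y]$ and its curvature is, with the sign convention $\mathbf{K}(X,Y)\overline{Z}=-\nabla_X\nabla_Y\overline{Z}+\nabla_Y\nabla_X\overline{Z}+\nabla_{[X,Y]}\overline{Z}$. Put $Q(\overline{X},\overline{Y})=\mathbf{T}(\beta\overline{X},\beta\overline{Y})$ and $T(\overline{X},\overline{Y})=\mathbf{T}(\gamma\overline{X},\beta\overline{Y})$. The Cartan connection of $(M,L)$ is the unique regular connection $\nabla$ on $\pi^{-1}(TM)$ with $\nabla g=0$, $Q=0$ and $g(T(\overline{X},\overline{Y}),\overline{Z})=g(T(\overline{X},\overline{Z}),\overline{Y})$. All objects refer to it. The $h$- and $v$-curvature tensors are $R(\overline{X},\overline{Y})\overline{Z}=\mathbf{K}(\beta\overline{X},\beta\overline{Y})\overline{Z}$ and $S(\overline{X},\overline{Y})\overline{Z}=\mathbf{K}(\gamma\overline{X},\gamma\overline{Y})\overline{Z}$. A $\pi$-tensor field (or function) $A$ is homogeneous of degree $0$ in $y$ (written $h(0)$) if $\nabla_{\gamma\overline{\eta}}A=0$. A $\pi$-tensor field is indicatory if it vanishes whenever one of its arguments is $\overline{\eta}$. $\stackrel{1}{\nabla}$ is the $h$-covariant derivative, $(\stackrel{1}{\nabla}A)(\overline{W},\dots)=(\nabla_{\beta\overline{W}}A)(\dots)$; since $\nabla_{\beta\overline{\eta}}\overline{\eta}=0$, $(\stackrel{1}{\nabla}\stackrel{1}{\nabla}H)(\overline{\eta},\overline{\eta},\overline{X},\overline{Y})=(\nabla_{\beta\overline{\eta}}\nabla_{\beta\overline{\eta}}H)(\overline{X},\overline{Y})$.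 $\mathfrak{A}_{\overline{X},\overline{Y}}\{F(\overline{X},\overline{Y})\}:=F(\overline{X},\overline{Y})-F(\overline{Y},\overline{X})$. *)

(* Defs.v *)
(* Finsler geometry in the pullback formalism, over MathComp-Analysis. *)
From HB Require Import structures.
From mathcomp Require Import all_boot all_order all_algebra.
From mathcomp Require Import all_classical all_reals all_analysis.

Set Implicit Arguments.
Unset Strict Implicit.
Unset Printing Implicit Defensive.

Import Order.TTheory GRing.Theory Num.Theory.
Import numFieldNormedType.Exports.

Local Open Scope classical_set_scope.
Local Open Scope ring_scope.

(* Charts "coord i : dom i -> R^m" with inverses "param i"; both maps are total
   and meaningful on dom i and on its image only. "chart_at x" is a preferred
   chart around x: the tangent space at x is 'rV_m, a tangent vector being
   identified with its components in that preferred chart. *)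
Record atlas (R : realType) (m : nat) (X : Type) := Atlas {
  chart : Type;
  dom : chart -> set X;
  coord : chart -> X -> 'rV[R]_m;
  param : chart -> 'rV[R]_m -> X;
  chart_at : X -> chart
}.
Arguments chart {R m X} a.
Arguments dom {R m X} a i.
Arguments coord {R m X} a i.
Arguments param {R m X} a i.
Arguments chart_at {R m X} a x.

Section Charts.
Context (R : realType).

(* f is C^k on the open set U: all iterated directional derivatives of order at
   most k exist and are continuous on U. *)
Fixpoint Ck (m : nat) (W : normedModType R) (k : nat) (U : set 'rV[R]_m)
    (f : 'rV[R]_m -> W) : Prop :=
  (forall x, U x -> {for x, continuous f}) /\
  match k with
  | 0 => True
  | k'.+1 => forall v : 'rV[R]_m,
      (forall x, U x -> derivable f x v) /\ Ck k' U ('D_v f)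
  end.

Definition smooth_on (m : nat) (W : normedModType R) (U : set 'rV[R]_m)
    (f : 'rV[R]_m -> W) : Prop :=
  forall k, Ck k U f.

Section Calculus.
Context (m : nat) (X : Type) (A : atlas R m X).

(* The differential at x of f : X -> W (with W a normed space), applied to the
   tangent vector v; for W = R this is the derivative v(f). *)
Definition dact (W : normedModType R) (x : X) (v : 'rV[R]_m) (f : X -> W) : W :=
  'D_v (f \o param A (chart_at A x)) (coord A (chart_at A x) x).

(* Components in the chart i of a tangent vector v at x. *)
Definition chart_comp (i : chart A) (x : X) (v : 'rV[R]_m) : 'rV[R]_m :=
  dact x v (coord A i).

Definition smooth_at (W : normedModType R) (f : X -> W) (x : X) : Prop :=
  exists U : set 'rV[R]_m, [/\ open U, U (coord A (chart_at A x) x)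
    & smooth_on U (f \o param A (chart_at A x))].

Definition smooth_vector_at (V : X -> 'rV[R]_m) (x : X) : Prop :=
  smooth_at (fun y => chart_comp (chart_at A x) y (V y)) x.

(* Lie bracket: [V, W]^j = V(W^j) - W(V^j) in the preferred chart at x. *)
Definition bracket (V W : X -> 'rV[R]_m) (x : X) : 'rV[R]_m :=
  dact x (V x) (fun y => chart_comp (chart_at A x) y (W y)) -
  dact x (W x) (fun y => chart_comp (chart_at A x) y (V y)).

End Calculus.

Definition smooth_manifold (n : nat) (M : topologicalType) (A : atlas R n M) :
    Prop :=
  [/\ [/\ hausdorff_space M, second_countable (T := M) & connected [set: M]],
      forall x, dom A (chart_at A x) x,
      forall i, [/\ open (dom A i),
        open (coord A i @` dom A i),
        forall x, dom A i x -> param A i (coord A i x) = x,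
        {within dom A i, continuous (coord A i)}
      & {within coord A i @` dom A i, continuous (param A i)}]
    & forall i j, smooth_on (coord A i @` (dom A i `&` dom A j))
        (coord A j \o param A i)].

End Charts.

(* A tangent vector (x, y), y being the components in the preferred chart. *)
Definition TM (R : realType) (n : nat) (M : topologicalType) : Type :=
  (M * 'rV[R]_n)%type.

Section Finsler.
Context (R : realType) (n : nat) (M : topologicalType) (A : atlas R n M).
Local Notation TM := (TM R n M).

Definition slit : set TM := [set u | u.2 != 0].

(* The induced charts (x^i, y^i) on the slit bundle. *)
Definition slit_atlas : atlas R (n + n) TM :=
  @Atlas R (n + n) TM (chart A)
    (fun i => [set u | dom A i u.1 /\ u.2 != 0])
    (fun i u => row_mx (coord A i u.1) (chart_comp i u.1 u.2))
    (fun i z => (param A i (lsubmx z),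
       'D_(rsubmx z) (coord A (chart_at A (param A i (lsubmx z))) \o param A i)
          (lsubmx z)))
    (fun u => chart_at A u.1).

(* Functions, pi-vector fields (sections of pi^{-1}(TM)) and vector fields on
   the slit bundle are total functions on TM, meaningful on slit only. *)
Notation fn := (TM -> R).
Notation pfield := (TM -> 'rV[R]_n).
Notation vfield := (TM -> 'rV[R]_(n + n)).

Definition smooth_fn (f : fn) : Prop :=
  forall u, slit u -> smooth_at slit_atlas f u.

Definition smooth_pfield (X : pfield) : Prop :=
  forall u, slit u ->
    smooth_at slit_atlas (fun v => chart_comp (chart_at A u.1) v.1 (X v)) u.

Definition smooth_vfield (V : vfield) : Prop :=
  forall u, slit u -> smooth_vector_at slit_atlas V u.

(* Derivative of the function f along the vector w tangent to slit at u. *)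
Definition vact (u : TM) (w : 'rV[R]_(n + n)) (f : fn) : R :=
  dact slit_atlas u w f.

Definition eta : pfield := fun u => u.2.

(* The velocity at t = 0 of the curve u + t v. *)
Definition gamma (u : TM) (v : 'rV[R]_n) : 'rV[R]_(n + n) :=
  derive1 (fun t : R =>
    coord slit_atlas (chart_at slit_atlas u) (u.1, u.2 + t *: v)) 0.

(* The differential of pi. *)
Definition rho (u : TM) (w : 'rV[R]_(n + n)) : 'rV[R]_n :=
  dact slit_atlas u w (fun v => coord A (chart_at A u.1) v.1).

Definition gammaf (X : pfield) : vfield := fun u => gamma u (X u).
Definition rhof (V : vfield) : pfield := fun u => rho u (V u).

(* Scalar pi-forms of order 2: pointwise, as bilinear forms on the fibres, and
   as operators on pi-vector fields. *)
Notation ptensor := (TM -> 'rV[R]_n -> 'rV[R]_n -> R).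
Notation pform2 := (pfield -> pfield -> fn).

Definition pform_of (B : ptensor) : pform2 := fun X Y u => B u (X u) (Y u).

Definition smooth_tensor (B : ptensor) : Prop :=
  [/\ forall u, slit u -> forall (a : R) x x' y,
        B u (a *: x + x') y = a * B u x y + B u x' y,
      forall u, slit u -> forall (a : R) x y y',
        B u x (a *: y + y') = a * B u x y + B u x y'
    & forall X Y, smooth_pfield X -> smooth_pfield Y ->
        smooth_fn (pform_of B X Y)].

Definition symmetric_tensor (B : ptensor) : Prop :=
  forall u, slit u -> forall x y, B u x y = B u y x.

Definition indicatory (B : ptensor) : Prop :=
  forall u, slit u -> forall x, B u (eta u) x = 0 /\ B u x (eta u) = 0.

Section Metric.
Context (L : TM -> R).

(* g_ij = (1/2) d^2 L^2 / dy^i dy^j, contracted with v^i and w^j. *)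
Definition metric : ptensor := fun u v w =>
  2^-1 * 'D_v (fun y => 'D_w (fun z => L (u.1, z) ^+ 2) y) u.2.

(* L is only prescribed on nonzero vectors: its (continuous) extension by 0 to
   the zero section is forced by homogeneity. *)
Definition finsler_function : Prop :=
  [/\ smooth_fn L,
      forall u, slit u -> 0 < L u,
      forall x y (a : R), 0 < a -> y != 0 -> L (x, a *: y) = a * L (x, y)
    & forall u, slit u -> forall v, v != 0 -> 0 < metric u v v].

Definition ell (u : TM) (v : 'rV[R]_n) : R := (L u)^-1 * metric u (eta u) v.

Definition hbar : ptensor := fun u v w => metric u v w - ell u v * ell u w.

(* The pi-vector field B_o(X) defined by g(B_o(X), Y) = B(X, Y) for all Y. *)
Definition sharp (B : pform2) (X : pfield) : pfield := fun u =>
  xget 0 [set v | forall Y, smooth_pfield Y -> metric u v (Y u) = B X Y u].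

Definition phi (X : pfield) : pfield := sharp (pform_of hbar) X.

Definition alt (F : pfield -> pfield -> pfield) (X Y : pfield) : pfield :=
  fun u => F X Y u - F Y X u.

(* A_{X,Y} {B(X, Z) phi(Y) + hbar(X, Z) B_o(Y)}. *)
Definition omega (B : pform2) (X Y Z : pfield) : pfield :=
  alt (fun X Y u =>
    B X Z u *: phi Y u + pform_of hbar X Z u *: sharp B Y u) X Y.

End Metric.

(* A connection on pi^{-1}(TM): "nabla u w Y" is the covariant derivative at u
   of the pi-vector field Y along the tangent vector w. *)
Notation conn := (TM -> 'rV[R]_(n + n) -> pfield -> 'rV[R]_n).

Definition cov (nabla : conn) (V : vfield) (Y : pfield) : pfield :=
  fun u => nabla u (V u) Y.

Definition connection (nabla : conn) : Prop :=
  [/\ forall u Y, slit u -> smooth_pfield Y -> forall (a : R) w w',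
        nabla u (a *: w + w') Y = a *: nabla u w Y + nabla u w' Y,
      forall u Y Z w, slit u -> smooth_pfield Y -> smooth_pfield Z ->
        nabla u w (fun v => Y v + Z v) = nabla u w Y + nabla u w Z,
      forall u f Y w, slit u -> smooth_fn f -> smooth_pfield Y ->
        nabla u w (fun v => f v *: Y v) =
        vact u w f *: Y u + f u *: nabla u w Y
    & forall V Y, smooth_vfield V -> smooth_pfield Y ->
        smooth_pfield (cov nabla V Y)].

Section Connection.
Context (nabla : conn).

Definition Kmap (u : TM) (w : 'rV[R]_(n + n)) : 'rV[R]_n := nabla u w eta.

(* T(slit) is the direct sum of ker dpi and ker K. *)
Definition regular : Prop :=
  forall u, slit u ->
    (forall w, exists a b, [/\ w = a + b, rho u a = 0 & Kmap u b = 0]) /\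
    (forall w, rho u w = 0 -> Kmap u w = 0 -> w = 0).

Definition beta (u : TM) (v : 'rV[R]_n) : 'rV[R]_(n + n) :=
  xget 0 [set w | Kmap u w = 0 /\ rho u w = v].

Definition betaf (X : pfield) : vfield := fun u => beta u (X u).

Definition torsion (V W : vfield) : pfield := fun u =>
  cov nabla V (rhof W) u - cov nabla W (rhof V) u -
  rho u (bracket slit_atlas V W u).

Definition curvature (V W : vfield) (Z : pfield) : pfield := fun u =>
  - cov nabla V (cov nabla W Z) u + cov nabla W (cov nabla V Z) u +
  cov nabla (bracket slit_atlas V W) Z u.

Definition Qtorsion (X Y : pfield) : pfield := torsion (betaf X) (betaf Y).
Definition Ttorsion (X Y : pfield) : pfield := torsion (gammaf X) (betaf Y).

Definition hcurvature (X Y Z : pfield) : pfield :=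
  curvature (betaf X) (betaf Y) Z.
Definition vcurvature (X Y Z : pfield) : pfield :=
  curvature (gammaf X) (gammaf Y) Z.

Definition cov2 (V : vfield) (B : pform2) : pform2 := fun X Y u =>
  vact u (V u) (B X Y) - B (cov nabla V X) Y u - B X (cov nabla V Y) u.

Definition cov3 (V : vfield) (C : pfield -> pform2) : pfield -> pform2 :=
  fun W X Y u =>
  vact u (V u) (C W X Y) - C (cov nabla V W) X Y u - C W (cov nabla V X) Y u -
  C W X (cov nabla V Y) u.

Definition hcov (B : pform2) : pfield -> pform2 := fun W => cov2 (betaf W) B.
Definition hcov2 (B : pform2) : pfield -> pfield -> pform2 :=
  fun V => cov3 (betaf V) (hcov B).

(* Homogeneity of degree 0 in y, i.e. nabla_{gamma eta} A = 0. *)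
Definition homogeneous0_fn (f : fn) : Prop :=
  forall u, slit u -> vact u (gammaf eta u) f = 0.

Definition homogeneous0 (B : pform2) : Prop :=
  forall X Y, smooth_pfield X -> smooth_pfield Y ->
  forall u, slit u -> cov2 (gammaf eta) B X Y u = 0.

Definition cartan_connection (L : TM -> R) : Prop :=
  [/\ connection nabla,
      regular,
      forall V X Y, smooth_vfield V -> smooth_pfield X -> smooth_pfield Y ->
        forall u, slit u -> cov2 V (pform_of (metric L)) X Y u = 0,
      forall X Y, smooth_pfield X -> smooth_pfield Y ->
        forall u, slit u -> Qtorsion X Y u = 0
    & forall X Y Z, smooth_pfield X -> smooth_pfield Y -> smooth_pfield Z ->
        forall u, slit u ->
          metric L u (Ttorsion X Y u) (Z u) =
          metric L u (Ttorsion X Z u) (Y u)].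

(* mu = H + (hcov2 H)(eta, eta, ., .) / (2 k L^2). *)
Definition mu_form (L k : fn) (H : ptensor) : pform2 := fun X Y u =>
  pform_of H X Y u + hcov2 (pform_of H) eta eta X Y u / (2 * k u * L u ^+ 2).

End Connection.

End Finsler.

(* Main.v *)
(* Write nabla = D + A, where D is the Berwald connection, A = T on vertical and A = - P
   on horizontal vectors; T is the Cartan tensor, P = nabla_{beta eta} T, and both are
   totally symmetric and annihilate eta.  Since nabla g = 0, the curvature of nabla is
   skew with respect to g, whereas A is symmetric.  So the curvature of nabla is the skew
   part of the curvature of D plus a quadratic term in A, and the symmetric part of the
   curvature of D is the D-derivative of A.

   D is flat on vertical vectors, so S is quadratic in T.  On horizontal vectors the
   curvature of D is the vertical derivative of R(X, Y) eta = k (g(X, eta) Y - g(Y, eta) X).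
   The Bianchi and Jacobi identities, with dim M >= 3, give Schur's lemma: k is constant
   along the fibres and along beta eta.  Now the skew part of the hypothesis on R says
   that k KN(H) = L^2 [P, P], where KN(H) is the Kulkarni-Nomizu product of H with the
   angular metric times L^2, and the symmetric part says that
   nabla_{beta eta} P = - k L^2 T.  Differentiating k KN(H) = L^2 [P, P] twice along
   beta eta therefore expresses the term [T, T], which is S, through H and its second
   derivative. *)
From HB Require Import structures.
From mathcomp Require Import all_boot all_order all_algebra.
From mathcomp Require Import all_classical all_reals all_analysis.
From mathcomp Require Import ring.
Require Import Defs.
Set Implicit Arguments.
Unset Strict Implicit.
Unset Printing Implicit Defensive.
Import Order.TTheory GRing.Theory Num.Theory.
Import numFieldNormedType.Exports.
Local Open Scope classical_set_scope.
Local Open Scope ring_scope.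

(** * Differentiation on row vectors *)

(** The constant in mu: let S be the spray beta eta, e = L^2, and let a prime denote covariant
    differentiation along S, for which k and e are constants. The pair (T, P) then behaves like an
    oscillator, T' = P and P' = - k e T, so [P, P]'' = - 2 k e [P, P] + 2 k^2 e^2 [T, T]. With k
    KN(H) = e [P, P] this becomes 2 k e^3 [T, T] = 2 k e KN(H) + KN(H''), whence H + H'' / (2 k e).
    The geometry is done without indices, by identities between fields over the ring of functions;
    denominators are cleared by powers of e. The work lies in obtaining this ring and its modules
    from the definitions. Smoothness speaks of iterated directional derivatives in charts, so
    differentiability, the chain rule and the symmetry of second derivatives must be derived. The
    horizontal map is a pointwise choice, whose smoothness needs proof. Fields are total functions
    meaningful on nonzero vectors only, so a connection must be shown to ignore the other values.
    Bump functions supply enough global fields to pass between identities of fields and identities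
    at a point. *)

Section DirectionalDerivative.
Context (R : realType) (V W : normedModType R).
Implicit Types (f : V -> W) (p v x : V).

Lemma is_derive_line f p v (t : R) : derivable f (t *: v + p) v ->
  is_derive t (1:R) (fun s : R => f (s *: v + p)) ('D_v f (t *: v + p)).
Proof.
move=> df.
have E : (fun h : R => h^-1 *: (((fun s : R => f (s *: v + p)) \o shift t) (h *: (1:R))
      - f (t *: v + p))) =
    (fun h : R => h^-1 *: ((f \o shift (t *: v + p)) (h *: v) - f (t *: v + p))).
  apply/funext => h /=; congr (_ *: (f _ - _)).
  by rewrite [h *: (1:R)]mulr1 scalerDl addrA.
by apply: DeriveDef; rewrite /derivable /derive /= E.
Qed.

Lemma is_derive_line0 f x v d :
  is_derive x v f d <-> is_derive (0:R) (1:R) (fun h : R => f (h *: v + x)) d.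
Proof.
have E : (fun h : R => h^-1 *: (((fun s : R => f (s *: v + x)) \o shift (0:R)) (h *: (1:R))
      - f (0 *: v + x))) =
    (fun h : R => h^-1 *: ((f \o shift x) (h *: v) - f x)).
  apply/funext => h /=; congr (_ *: (f _ - f _)).
    by rewrite [h *: (1:R)]mulr1 addr0.
  by rewrite scale0r add0r.
by split=> -[d1 d2]; apply: DeriveDef; move: d1 d2; rewrite /derivable /derive /= E.
Qed.

Lemma is_deriveZv f x v (c : R) : derivable f x v ->
  is_derive x (c *: v) f (c *: 'D_v f x).
Proof.
move=> /derivableP /is_derive_line0 [d1 d2]; apply/is_derive_line0.
move: d1 d2; set phi := fun h => _ => d1 d2.
have -> : (fun h : R => f (h *: (c *: v) + x)) = phi \o ( *:%R c).
  by apply/funext => h; rewrite /phi /= scalerA mulrC.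
have dphi : differentiable phi (c *: 0) by rewrite scaler0; apply/derivable1_diffP.
apply: DeriveDef.
  by apply/derivable1_diffP; apply: differentiable_comp.
rewrite deriveE; last exact: differentiable_comp.
rewrite diff_comp //= diff_val -d2 deriveE; last by apply/derivable1_diffP.
by rewrite scaler0 linearZ.
Qed.

End DirectionalDerivative.

Lemma mvt_dir (R : realType) (V : normedModType R) (f : V -> R) (p v : V) :
  (forall t : R, 0 <= t <= 1 -> derivable f (t *: v + p) v) ->
  exists2 t : R, 0 <= t <= 1 & f (v + p) - f p = 'D_v f (t *: v + p).
Proof.
move=> df.
have [||c c01] := @MVT R (fun s => f (s *: v + p))
    (fun s => 'D_v f (s *: v + p)) 0 1 ltr01.
- move=> s; rewrite in_itv/= => /andP[s0 s1].
  by apply: is_derive_line; apply: df; rewrite !ltW.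
- apply: derivable_within_continuous => s; rewrite in_itv/= => s01.
  by have [] := is_derive_line (df s s01).
rewrite scale0r add0r scale1r subr0 mulr1 => E; exists c => //.
by move: c01; rewrite in_itv/= => /andP[/ltW-> /ltW->].
Qed.

Section MatrixValued.
Context (R : realType).

Lemma continuous_mxP (T : topologicalType) m n (F : T -> 'M[R]_(m, n)) x :
  {for x, continuous F} <-> forall i j, {for x, continuous (fun y => F y i j)}.
Proof.
split=> [Fc i j|Fc].
  apply: (@continuous_comp _ _ _ F (fun M : 'M[R]_(m, n) => M i j)) => //.
  exact: coord_continuous.
apply/cvgrPdist_le => e e0; near=> y.
rewrite /Num.Def.normr/= mx_normrE (bigmax_le _ (ltW e0))//= => i _.
rewrite !mxE/=; move: i; near: y; apply: filter_forall => /= i.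
exact: (cvgrPdist_le _ _).1 (Fc i.1 i.2) _ e0.
Unshelve. all: by end_near. Qed.

Lemma norm_coord_le n (h : 'rV[R]_n) j : `|h ord0 j| <= `|h|.
Proof.
rewrite [leRHS]/Num.Def.normr/= mx_normrE.
exact: (le_bigmax _ (fun ij : 'I_1 * 'I_n => `|h ij.1 ij.2|) (ord0, j)).
Qed.

Lemma rV_norm_le n (h : 'rV[R]_n) e : 0 <= e ->
  (forall j, `|h ord0 j| <= e) -> `|h| <= e.
Proof.
move=> e0 he; rewrite [leLHS]/Num.Def.normr/= mx_normrE.
by apply: bigmax_le => // -[i j] _ /=; rewrite ord1.
Qed.

End MatrixValued.

(** * Continuous directional derivatives imply differentiability *)

Section ContinuouslyDifferentiable.
Context (R : realType) (m : nat).
Implicit Types (f : 'rV[R]_m -> R) (x h v : 'rV[R]_m).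

Definition total_derivative f x h : R :=
  \sum_(j < m) h ord0 j * 'D_(delta_mx ord0 j) f x.

Fact total_derivative_linear f x : linear (total_derivative f x).
Proof.
move=> c u v; rewrite /total_derivative scaler_sumr -big_split /=.
by apply: eq_bigr => j _; rewrite !mxE mulrDl -mulrA.
Qed.

HB.instance Definition _ f x := @GRing.isLinear.Build R 'rV[R]_m R _
  (total_derivative f x) (total_derivative_linear f x).

Lemma total_derivative_continuous f x : continuous (total_derivative f x).
Proof.
move=> y; rewrite /total_derivative.
have -> : (fun h : 'rV[R]_m => \sum_(j < m) h ord0 j * 'D_(delta_mx ord0 j) f x) =
    \sum_(j < m) (fun h : 'rV[R]_m => h ord0 j * 'D_(delta_mx ord0 j) f x).
  by apply/funext => h; rewrite fct_sumE.
apply: (big_ind (fun F : 'rV[R]_m -> R => {for y, continuous F})).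
- exact: cst_continuous.
- by move=> F G Fc Gc; exact: continuousD.
move=> j _; apply: continuousM; [exact: coord_continuous|exact: cst_continuous].
Qed.

Let trunc (k : nat) h : 'rV[R]_m := \row_j (if (j < k)%N then h ord0 j else 0).

Let truncS (k : 'I_m) h :
  trunc k.+1 h = h ord0 k *: delta_mx ord0 k + trunc k h.
Proof.
apply/rowP => j; rewrite !mxE eqxx /= ltnS leq_eqVlt.
have [->|jk] := eqVneq j k; first by rewrite eqxx ltnn /= mulr1 addr0.
by rewrite mulr0 add0r (_ : (_ == _ :> nat) = false) //; apply/negbTE.
Qed.

(* The increment of f along h is telescoped over a path parallel to the axes;
   the mean value theorem is applied to each of its sides. *)
Lemma increment_bound f x (e r : R) (h : 'rV[R]_m) : 0 <= e ->
  (forall v y, `|y| < r -> derivable f (y + x) v) ->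
  (forall j y, `|y| < r ->
     `|'D_(delta_mx ord0 j) f (y + x) - 'D_(delta_mx ord0 j) f x| <= e) ->
  `|h| < r ->
  `|f (h + x) - f x - total_derivative f x h| <= m%:R * e * `|h|.
Proof.
move=> e0 df cf hr.
have trle k : `|trunc k h| <= `|h|.
  apply: rV_norm_le => // j; rewrite !mxE.
  by case: ifP => _; rewrite ?normr0 // norm_coord_le.
have tele : f (h + x) - f x =
    \sum_(k < m) (f (trunc k.+1 h + x) - f (trunc k h + x)).
  rewrite -(big_mkord xpredT (fun k => f (trunc k.+1 h + x) - f (trunc k h + x))).
  rewrite telescope_sumr //; congr (f (_ + _) - f _).
    by apply/rowP => j; rewrite !mxE ltn_ord.
  by rewrite (_ : trunc 0 h = 0) ?add0r //; apply/rowP => j; rewrite !mxE.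
rewrite tele -sumrB (le_trans (ler_norm_sum _ _ _))//.
rewrite -mulrA -[m in m%:R](card_ord m) mulr_natl -sumr_const ler_sum// => k _.
have pr (t : R) : 0 <= t <= 1 ->
    `|t *: (h ord0 k *: delta_mx ord0 k) + trunc k h| < r.
  move=> /andP[t0 t1]; apply: le_lt_trans hr; apply: rV_norm_le => // j.
  rewrite !mxE eqxx /=; have [->|jk] := eqVneq j k.
    rewrite ltnn mulr1 addr0 normrM ger0_norm //.
    by rewrite (le_trans _ (norm_coord_le h k)) // ler_piMl.
  by rewrite !mulr0 add0r; case: ifP => _; rewrite ?normr0 // norm_coord_le.
rewrite truncS -(addrA _ (trunc k h) x).
have [|t t01 ->] := @mvt_dir R _ f (trunc k h + x) (h ord0 k *: delta_mx ord0 k).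
  by move=> t t01; rewrite addrA; apply: df; exact: pr.
rewrite addrA.
have /(is_deriveZv (h ord0 k)) [_ ->] := df (delta_mx ord0 k) _ (pr t t01).
rewrite -mulrBr normrM mulrC ler_pM //; first exact: cf (pr t t01).
exact: norm_coord_le.
Qed.

Lemma C1_differentiable f x :
  (\forall y \near x, forall v, derivable f y v) ->
  (forall v, {for x, continuous ('D_v f)}) ->
  differentiable f x.
Proof.
move=> df cf.
have H e : 0 < e ->
    \forall h \near (0 : 'rV[R]_m), `|f (h + x) - f x - total_derivative f x h| <= e * `|h|.
  (* This absorbs the factor [m] of [increment_bound]; [m.+1] avoids dividing by 0 in dimension
     0. *)
  move=> e0; pose e1 := e / m.+1%:R.
  have e10 : 0 < e1 by rewrite divr_gt0.
  have : \forall y \near x, (forall v, derivable f y v) /\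
      (forall j : 'I_m, `|'D_(delta_mx ord0 j) f y - 'D_(delta_mx ord0 j) f x| <= e1).
    near=> y; split; first by near: y.
    near: y; apply: filter_forall => j.
    have /cvgrPdist_le /(_ _ e10) := cf (delta_mx ord0 j).
    by apply: filterS => y; rewrite distrC.
  move=> /nbhs_ballP[r /= r0 rb].
  have rb' y : `|y| < r -> ball x r (y + x).
    by rewrite -ball_normE /= opprD addrCA subrr addr0 normrN.
  near=> h.
  apply: (@le_trans _ _ (m%:R * e1 * `|h|)).
    have hr : `|h| < r.
      near: h; apply/nbhs_ballP; exists r => //= z.
      by rewrite -ball_normE /= sub0r normrN.
    apply: (increment_bound (ltW e10) _ _ hr).
      by move=> v y /rb' /rb [].
    by move=> j y /rb' /rb [_]; apply.
  rewrite ler_wpM2r // /e1 mulrCA ler_piMr ?(ltW e0) //.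
  by rewrite ler_pdivrMr // mul1r ler_nat.
have E : f \o shift x = cst (f x) + total_derivative f x +o_ (0 : 'rV[R]_m) id.
  apply: (@eqaddoP _ _ R _ _ _ _ _).2 => e e0; near=> h => /=.
  rewrite -[(_ - _) h]/(f (h + x) - (f x + total_derivative f x h)) opprD addrA.
  by near: h; exact: H.
have dE := diff_unique (@total_derivative_continuous f x) E.
by apply/diff_locallyP; rewrite dE; split => //; exact: total_derivative_continuous.
Unshelve. all: by end_near. Qed.

End ContinuouslyDifferentiable.

Lemma derive_total (R : realType) (m : nat) (W : normedModType R)
    (f : 'rV[R]_m -> W) (x v : 'rV[R]_m) : differentiable f x ->
  'D_v f x = \sum_(j < m) v ord0 j *: 'D_(delta_mx ord0 j) f x.
Proof.
move=> df; rewrite deriveE // {1}[v]row_sum_delta linear_sum /=.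
by apply: eq_bigr => j _; rewrite linearZ /= deriveE.
Qed.

Lemma derive_comp (R : numFieldType) (U V W : normedModType R) (f : U -> V)
    (g : V -> W) (x v : U) :
  differentiable f x -> differentiable g (f x) ->
  'D_v (g \o f) x = 'D_('D_v f x) g (f x).
Proof.
move=> df dg; rewrite deriveE; last exact: differentiable_comp.
by rewrite (diff_comp df dg) /= -deriveE // -deriveE.
Qed.

Lemma near_eq_continuous (T U : topologicalType) (f g : T -> U) (x : T) :
  (\forall y \near x, f y = g y) -> {for x, continuous f} ->
  {for x, continuous g}.
Proof.
move=> fg fc; rewrite /prop_for /continuous_at -(nbhs_singleton fg).
by apply: cvg_trans fc; apply: near_eq_cvg.
Qed.

(** * Stability of the classes C^k under the usual operations *)

Section Ck.
Context (R : realType) (m : nat).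
Notation E := 'rV[R]_m.
Implicit Types (U V : set E).

Section General.
Context (W : normedModType R).
Implicit Types (f g : E -> W).

Lemma Ck_ext k U f g : open U -> (forall x, U x -> f x = g x) ->
  Ck k U f -> Ck k U g.
Proof.
move=> oU; elim: k f g => [|k IH] f g fg /= [fc fd].
  split=> // x Ux; apply: near_eq_continuous (fc x Ux).
  by apply: filterS fg _; exact: open_nbhs_nbhs.
have near_fg x : U x -> \forall y \near x, f y = g y.
  by move=> Ux; apply: filterS fg _; exact: open_nbhs_nbhs.
split=> [x Ux|v]; first by apply: near_eq_continuous (fc x Ux); exact: near_fg.
have [fdv fk] := fd v; split=> [x Ux|].
  by apply: near_eq_derivable (fdv x Ux); exact: near_fg.
by apply: IH fk => x Ux; apply: near_eq_derive; exact: near_fg.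
Qed.

Lemma Ck_pred k U f : Ck k.+1 U f -> Ck k U f.
Proof.
elim: k f => [|k IH] f /= [fc fd]; first by [].
by split=> // v; have [? /IH] := fd v.
Qed.

Lemma Ck_sub k U V f : V `<=` U -> Ck k U f -> Ck k V f.
Proof.
move=> VU; elim: k f => [|k IH] f /= [fc fd]; split=> //.
- by move=> x /VU /fc.
- by move=> x /VU /fc.
by move=> v; have [fdv /IH fk] := fd v; split=> // x /VU /fdv.
Qed.

(** [V] need not be open: [Ck] on a set only constrains the total function [f] and its derivatives
    at the points of that set, so even singletons can serve as [V]. *)
Lemma Ck_loc k U f : (forall x, U x -> exists V, V x /\ Ck k V f) -> Ck k U f.
Proof.
elim: k f => [|k IH] f H /=.
  by split=> // x /H[V [Vx [fc _]]]; exact: fc.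
split=> [x /H[V [Vx [fc _]]]|v]; first exact: fc.
split=> [x /H[V [Vx [fc /(_ v) [fdv _]]]]|]; first exact: fdv.
by apply: IH => x /H[V [Vx [fc /(_ v) [_ fk]]]]; exists V.
Qed.

Lemma Ck_cst k U (c : W) : Ck k U (cst c).
Proof.
elim: k c => [|k IH] c /=; first by split=> // x _; exact: cst_continuous.
split=> [x _|v]; first exact: cst_continuous.
split=> [x _|]; first exact: derivable_cst.
have -> : 'D_v (cst c) = cst (0 : W) by apply/funext => x; exact: derive_cst.
exact: IH.
Qed.

Lemma CkD k U f g : open U -> Ck k U f -> Ck k U g -> Ck k U (f \+ g).
Proof.
move=> oU; elim: k f g => [|k IH] f g /= [fc fd] [gc gd].
  by split=> // x Ux; apply: continuousD; [exact: fc|exact: gc].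
split=> [x Ux|v]; first by apply: continuousD; [exact: fc|exact: gc].
have [fdv fk] := fd v; have [gdv gk] := gd v; split=> [x Ux|].
  by apply: derivableD; [exact: fdv|exact: gdv].
apply: (@Ck_ext _ _ ('D_v f \+ 'D_v g)) => //; last exact: IH.
by move=> x Ux; rewrite deriveD //; [exact: fdv|exact: gdv].
Qed.

Lemma CkZ k U (c : R) f : open U -> Ck k U f -> Ck k U (fun x => c *: f x).
Proof.
move=> oU; elim: k f => [|k IH] f /= [fc fd].
  by split=> // x Ux; apply: continuousZr; exact: fc.
split=> [x Ux|v]; first by apply: continuousZr; exact: fc.
have [fdv fk] := fd v; split=> [x Ux|].
  by apply: derivableZ; exact: fdv.
apply: (@Ck_ext _ _ (fun x => c *: 'D_v f x)) => //; last exact: IH.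
by move=> x Ux; rewrite deriveZ //; exact: fdv.
Qed.

Lemma CkN k U f : open U -> Ck k U f -> Ck k U (fun x => - f x).
Proof.
by move=> oU /(CkZ (-1) oU); apply: Ck_ext => // x _; rewrite scaleN1r.
Qed.

End General.

Lemma CkM k U (f g : E -> R) : open U -> Ck k U f -> Ck k U g ->
  Ck k U (fun x => f x * g x).
Proof.
move=> oU; elim: k f g => [|k IH] f g fC gC.
  case: fC gC => [fc _] [gc _].
  by split=> // x Ux; apply: continuousM; [exact: fc|exact: gc].
have [fC' gC'] := (Ck_pred fC, Ck_pred gC); case: fC gC => [fc fd] [gc gd].
split=> [x Ux|v]; first by apply: continuousM; [exact: fc|exact: gc].
have [fdv fk] := fd v; have [gdv gk] := gd v; split=> [x Ux|].
  by apply: derivableM; [exact: fdv|exact: gdv].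
apply: (@Ck_ext _ _ _ ((fun x => f x * 'D_v g x) \+ (fun x => g x * 'D_v f x))) => //.
  by move=> x Ux; rewrite [RHS](@deriveM _ _ f g) //; [exact: fdv|exact: gdv].
by apply: CkD => //; exact: IH.
Qed.

Lemma Ck_sum (W : normedModType R) k U (I : Type) (r : seq I) (P : pred I)
    (F : I -> E -> W) : open U ->
  (forall i, P i -> Ck k U (F i)) -> Ck k U (fun x => \sum_(i <- r | P i) F i x).
Proof.
move=> oU FC; elim: r => [|i r IH].
  by apply: Ck_ext (Ck_cst k U (0 : W)) => // x _; rewrite big_nil.
case: (boolP (P i)) => Pi; last first.
  by apply: Ck_ext IH => // x _; rewrite big_cons (negbTE Pi).
by apply: Ck_ext (CkD oU (FC i Pi) IH) => // x _; rewrite big_cons Pi.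
Qed.

Lemma Ck_mxP p q k U (F : E -> 'M[R]_(p, q)) : open U ->
  Ck k U F <-> forall i j, Ck k U (fun x => F x i j).
Proof.
move=> oU; elim: k F => [|k IH] F /=.
  split=> [[Fc _] i j|H].
    by split=> // x /Fc /continuous_mxP; apply.
  by split=> // x Ux; apply/continuous_mxP => i j; have [+ _] := H i j; apply.
split=> [[Fc Fd] i j|H].
  split=> [x /Fc /continuous_mxP|v]; first by apply.
  have [Fdv Fk] := Fd v; split=> [x /Fdv /derivable_mxP|]; first by apply.
  apply: Ck_ext ((IH _).1 Fk i j) => // x Ux.
  by rewrite derive_mx ?mxE //; exact: Fdv.
split=> [x Ux|v].
  by apply/continuous_mxP => i j; have [+ _] := H i j; apply.
have Fdv x : U x -> derivable F x v.
  move=> Ux; apply/derivable_mxP => i j.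
  by have [_ /(_ v) [+ _]] := H i j; apply.
split=> //; apply/IH => i j; have [_ /(_ v) [_ Hk]] := H i j.
by apply: Ck_ext Hk => // x Ux; rewrite derive_mx ?mxE //; exact: Fdv.
Qed.

Lemma Ck_differentiable k U (f : E -> R) x : open U -> Ck k.+1 U f -> U x ->
  differentiable f x.
Proof.
move=> oU fC Ux; have [fc fd] : Ck 1 U f.
  by elim: k fC => // k IH /Ck_pred.
apply: C1_differentiable => [|v]; last by have [_ [+ _]] := fd v; apply.
have : \forall y \near x, U y by exact: open_nbhs_nbhs.
by apply: filterS => y Uy v; have [+ _] := fd v; apply.
Qed.

Lemma differentiable_mxP p (F : E -> 'rV[R]_p) x :
  (forall j, differentiable (fun y => F y ord0 j) x) -> differentiable F x.
Proof.
move=> FD.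
have -> : F = \sum_(j < p) (fun y => F y ord0 j *: (delta_mx ord0 j : 'rV[R]_p)).
  by apply/funext => y; rewrite fct_sumE [LHS]row_sum_delta.
by apply: differentiable_sum => j; apply: differentiableZl; exact: FD.
Qed.

Lemma Ck_differentiable_rV p k U (F : E -> 'rV[R]_p) x : open U ->
  Ck k.+1 U F -> U x -> differentiable F x.
Proof.
move=> oU /(Ck_mxP _ _ oU) FC Ux; apply: differentiable_mxP => j.
exact: (Ck_differentiable oU (FC ord0 j)).
Qed.

End Ck.

Lemma linear_rV_continuous (R : realType) m (W : normedModType R)
    (f : {linear 'rV[R]_m -> W}) : continuous f.
Proof.
move=> y.
have -> : (f : 'rV[R]_m -> W) =
    \sum_(j < m) (fun x : 'rV[R]_m => x ord0 j *: f (delta_mx ord0 j)).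
  apply/funext => x; rewrite fct_sumE {1}[x]row_sum_delta linear_sum /=.
  by apply: eq_bigr => j _; rewrite linearZ.
apply: (big_ind (fun F : 'rV[R]_m -> W => {for y, continuous F})).
- exact: cst_continuous.
- by move=> F G Fc Gc; exact: continuousD.
by move=> j _; apply: continuousZr_tmp; exact: coord_continuous.
Qed.

Lemma Ck_linear (R : realType) m p k (U : set 'rV[R]_m)
    (f : {linear 'rV[R]_m -> 'rV[R]_p}) : Ck k U f.
Proof.
have fd x : differentiable f x.
  by apply: linear_differentiable; exact: linear_rV_continuous.
have fc x : {for x, continuous f} by exact: differentiable_continuous (fd x).
case: k => [|k]; split=> [x _|].
- exact: fc.
- by [].
- exact: fc.
move=> v; split=> [x _|]; first exact: diff_derivable (fd x).
have -> : 'D_v f = cst (f v).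
  apply/funext => x; rewrite (deriveE v (fd x)).
  by rewrite (diff_lin x (linear_rV_continuous (f := f))).
exact: Ck_cst.
Qed.

(** The chain rule writes a derivative of [g \o f] as a sum of products of derivatives of [f] with
    partial derivatives of [g] composed with [f]; induction on [k] applies to the latter. *)
Lemma Ck_comp (R : realType) m p k (U : set 'rV[R]_m) (V : set 'rV[R]_p)
    (f : 'rV[R]_m -> 'rV[R]_p) (g : 'rV[R]_p -> R) : open U -> open V ->
  (forall x, U x -> V (f x)) -> Ck k U f -> Ck k V g -> Ck k U (g \o f).
Proof.
move=> oU oV UV; elim: k g => [|k IH] g fC gC.
  case: fC gC => [fc _] [gc _]; split; last by [].
  move=> x Ux; apply: continuous_comp; [exact: fc|exact/gc/UV].
have fD x : U x -> differentiable f x.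
  by move=> Ux; exact: (Ck_differentiable_rV oU fC).
have gD y : V y -> differentiable g y.
  by move=> Vy; exact: (Ck_differentiable oV gC).
have fC' := Ck_pred fC.
case: fC gC => [fc fd] [gc gd]; split=> [x Ux|v].
  by apply: continuous_comp; [exact: fc|exact/gc/UV].
have gfD x : U x -> differentiable (g \o f) x.
  by move=> Ux; apply: differentiable_comp; [exact: fD|exact/gD/UV].
split=> [x Ux|]; first exact/diff_derivable/gfD.
have [fdv fk] := fd v.
apply: (@Ck_ext _ _ _ _ _ (fun x => \sum_(j < p)
    'D_v f x ord0 j * 'D_(delta_mx ord0 j) g (f x))) => //; last first.
  apply: Ck_sum => // j _; apply: CkM => //; first exact: ((Ck_mxP _ _ oU).1 fk).
  have [_ gk] := gd (delta_mx ord0 j).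
  exact: (IH ('D_(delta_mx ord0 j) g)).
move=> x Ux; rewrite [RHS](derive_comp v (fD x Ux) (gD _ (UV x Ux))).
by rewrite [RHS]derive_total //; exact/gD/UV.
Qed.

(* Post-composition by a function of one variable belonging to a family h that is
   closed under differentiation, up to linear combinations. *)
Lemma Ck_post (R : realType) m k (U : set 'rV[R]_m) (f : 'rV[R]_m -> R)
    (I : Type) (D : set R) (h : I -> R -> R) (d : I -> seq (R * I)) : open U ->
  (forall i s, D s ->
    is_derive s (1:R) (h i) (\sum_(l <- d i) l.1 * h l.2 s)) ->
  (forall x, U x -> D (f x)) -> Ck k U f -> forall i, Ck k U (h i \o f).
Proof.
move=> oU hd UD; elim: k => [|k IH] fC i.
  case: fC => [fc _]; split; last by [].
  move=> x Ux; apply: continuous_comp; first exact: fc.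
  apply: differentiable_continuous; apply/derivable1_diffP.
  by have [] := hd i _ (UD x Ux).
have fD x : U x -> differentiable f x.
  by move=> Ux; exact: (Ck_differentiable oU fC).
have hD j x : U x -> differentiable (h j) (f x).
  by move=> Ux; apply/derivable1_diffP; have [] := hd j _ (UD x Ux).
have hfD j x : U x -> differentiable (h j \o f) x.
  by move=> Ux; apply: differentiable_comp; [exact: fD|exact: hD].
have fC' := Ck_pred fC; case: fC => [fc fd].
split=> [x Ux|v]; first exact/differentiable_continuous/hfD.
split=> [x Ux|]; first exact/diff_derivable/hfD.
have [fdv fk] := fd v.
apply: (@Ck_ext _ _ _ _ _
    (fun x => 'D_v f x * \sum_(l <- d i) l.1 * (h l.2 \o f) x)) => //; last first.
  apply: CkM => //; apply: Ck_sum => // l _; apply: CkM => //; first exact: Ck_cst.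
  exact: IH.
move=> x Ux; rewrite [RHS](derive_comp v (fD x Ux) (hD i x Ux)).
rewrite [RHS]deriveE; last exact: hD.
have [/derivable1_diffP hd1 hd2] := hd i _ (UD x Ux).
rewrite -[X in 'd _ _ X]mulr1 [X in 'd _ _ X]/(_ *: _) linearZ /= -deriveE //.
by rewrite hd2.
Qed.

(** The second difference quotient [Q v w s] is symmetric in [v] and [w], and two applications of
    the mean value theorem show that it tends to ['D_v ('D_w f) x] as [s] tends to 0. *)
Lemma schwarz (R : realType) (m : nat) (U : set 'rV[R]_m) (f : 'rV[R]_m -> R)
    (x v w : 'rV[R]_m) : open U -> U x -> Ck 2 U f ->
  'D_v ('D_w f) x = 'D_w ('D_v f) x.
Proof.
move=> oU Ux fC.
pose Q a b (s : R) := s^-1 ^+ 2 * (f (s *: a + (s *: b + x)) - f (s *: b + x)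
        - (f (s *: a + x) - f x)).
have QC a b s : Q a b s = Q b a s.
  have sw (c1 c2 c3 c4 : R) : c1 - c2 - (c3 - c4) = c1 - c3 - (c2 - c4) by ring.
  by rewrite /Q sw (addrCA (s *: a)).
suff half a b e : 0 < e -> \forall s \near (0:R)^',
    `|Q a b s - 'D_a ('D_b f) x| <= e.
  apply/eqP; rewrite -subr_eq0 -normr_le0; apply/ler_addgt0Pr => e e0.
  have e20 : 0 < e / 2 by rewrite divr_gt0.
  have h1 := half v w _ e20.
  have h2 : \forall s \near (0:R)^', `|Q v w s - 'D_w ('D_v f) x| <= e / 2.
    by apply: filterS (half w v _ e20) => s; rewrite (QC w v).
  have [s [q1 q2]] :=
    @filter_ex _ _ (Proper_dnbhs_numFieldType (0:R)) _ (filterI h1 h2).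
  rewrite add0r.
  rewrite -(subrKA (Q v w s)) (splitr e) (le_trans (ler_normD _ _))//.
  by apply: lerD; [rewrite distrC; exact: q1|exact: q2].
clear v w QC.
move=> e0; have [_ fd] := fC; have [_ [_ fdd]] := fd b.
have [fdba [fdbac _]] := fdd a.
have /cvgrPdist_le /(_ _ e0) := fdbac x Ux.
have nU : \forall y \near x, U y by exact: open_nbhs_nbhs.
move=> /(filterI nU) /nbhs_ballP [r /= r0 rb].
have small t1 t2 : 0 <= t1 <= 1 -> 0 <= t2 <= 1 -> forall s,
   `|s| * (`|a| + `|b|) < r -> ball x r (t1 *: (s *: a) + (t2 *: (s *: b) + x)).
  move=> /andP[t10 t11] /andP[t20 t21] s sr.
  rewrite -ball_normE /= addrA opprD addrCA subrr addr0 normrN.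
  apply: le_lt_trans sr; rewrite (le_trans (ler_normD _ _)) // mulrDr !normrZ.
  by rewrite (ger0_norm t10) (ger0_norm t20) lerD // ler_piMl // mulr_ge0.
have ab0 : 0 < `|a| + `|b| + 1 by rewrite ltr_wpDl // addr_ge0.
have rab0 : 0 < r / (`|a| + `|b| + 1) by rewrite divr_gt0.
near=> s.
have s0 : s != 0 by near: s; exact: nbhs_dnbhs_neq.
have sr : `|s| * (`|a| + `|b|) < r.
  apply: (@le_lt_trans _ _ (`|s| * (`|a| + `|b| + 1))).
    by rewrite ler_wpM2l // lerDl.
  by rewrite -ltr_pdivlMr //; near: s; exact: dnbhs0_lt.
have inU t1 t2 : 0 <= t1 <= 1 -> 0 <= t2 <= 1 ->
    U (t1 *: (s *: a) + (t2 *: (s *: b) + x)).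
  by move=> h1 h2; have [] := rb _ (small _ _ h1 h2 _ sr).
have h01 : 0 <= (0:R) <= 1 by rewrite lexx ler01.
have h11 : 0 <= (1:R) <= 1 by rewrite lexx ler01.
(* [F] is the increment in direction [a]. The mean value theorem is used for [F] along [s *: b],
   then for ['D_b f] along [s *: a]. *)
pose F := (fun y => f (s *: a + y) - f y).
have -> : Q a b s = s^-1 ^+ 2 * (F (s *: b + x) - F x) by [].
have fdiff y : U y -> differentiable f y by exact: (Ck_differentiable oU fC).
have shiftF y c : U (c + y) ->
    is_derive y (s *: b) (fun z => f (c + z)) (s *: 'D_b f (c + y)).
  move=> Uc; have [d1 d2] : is_derive (c + y) (s *: b) f (s *: 'D_b f (c + y)).
    by apply: is_deriveZv; exact/diff_derivable/fdiff.
  have E : (fun h : R => h^-1 *: (((fun z => f (c + z)) \o shift y) (h *: (s *: b)) -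
      f (c + y))) =
    (fun h : R => h^-1 *: ((f \o shift (c + y)) (h *: (s *: b)) - f (c + y))).
    by apply/funext => h /=; rewrite addrCA.
  by apply: DeriveDef; rewrite -?d2 /derivable /derive E.
have DF y : U (s *: a + y) -> U y -> is_derive y (s *: b) F
    (s *: 'D_b f (s *: a + y) - s *: 'D_b f y).
  move=> Ua U0; apply: is_deriveB; first exact: shiftF.
  have := @shiftF y 0; rewrite add0r => /(_ U0).
  have -> : (fun z => f (0 + z)) = f by apply/funext => z; rewrite add0r.
  by [].
have U1 t : 0 <= t <= 1 -> U (t *: (s *: b) + x).
  by move=> t01; have := inU 0 t h01 t01; rewrite scale0r add0r.
have U2 t : 0 <= t <= 1 -> U (s *: a + (t *: (s *: b) + x)).
  by move=> t01; have := inU 1 t h11 t01; rewrite scale1r.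
have [|t t01 ->] := @mvt_dir R _ F x (s *: b).
  by move=> t t01; have [] := DF _ (U2 t t01) (U1 t t01).
have [_ ->] := DF _ (U2 t t01) (U1 t t01).
have [|t' t01' E] := @mvt_dir R _ ('D_b f) (t *: (s *: b) + x) (s *: a).
  by move=> t' t01'; have [] := is_deriveZv s (fdba _ (inU _ _ t01' t01)).
rewrite -scalerBr E; have [_ ->] := is_deriveZv s (fdba _ (inU _ _ t01' t01)).
have -> (c : R) : s^-1 ^+ 2 * (s *: (s *: c)) = c.
  by rewrite /GRing.scale /= expr2 mulrA mulrA mulrCA; field.
have [_ dle] := rb _ (small _ _ t01' t01 _ sr).
rewrite distrC; exact: dle.
Unshelve. all: by end_near. Qed.

Section Near.
Context (T : topologicalType) (x : T) (P Q : T -> Prop).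

Lemma near_mono : (forall y, P y -> Q y) ->
  (\forall y \near x, P y) -> \forall y \near x, Q y.
Proof. by move=> PQ; exact: filterS. Qed.

Lemma near_and : (\forall y \near x, P y) -> (\forall y \near x, Q y) ->
  \forall y \near x, P y /\ Q y.
Proof. by move=> Px Qx; exact: filterI. Qed.

End Near.

(** * Smooth germs *)

Definition smooth_germ (R : realType) (m : nat) (W : normedModType R)
    (f : 'rV[R]_m -> W) (x : 'rV[R]_m) : Prop :=
  exists U : set 'rV[R]_m, [/\ open U, U x & smooth_on U f].

Section SmoothGerm.
Context (R : realType) (m : nat).
Notation E := 'rV[R]_m.
Implicit Types (x v w : E).

Section General.
Context (W : normedModType R).
Implicit Types (f g : E -> W).

(** Smoothness on [[set y]] constrains the derivatives of [f] at [y] only. In this form a germ is a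
    [near] statement, and finitely many germs can be intersected by [filter_forall]. *)
Lemma smooth_germP f x :
  smooth_germ f x <-> \forall y \near x, smooth_on [set y] f.
Proof.
split=> [[U [oU Ux fU]]|].
  have : \forall y \near x, U y by exact: open_nbhs_nbhs.
  by apply: filterS => y Uy k; apply: Ck_sub (fU k) => z /= ->.
rewrite -nbhs_nearE nbhsE => -[U [oU Ux] sub].
by exists U; split=> // k; apply: Ck_loc => y Uy; exists [set y]; split=> //; exact: sub.
Qed.

Lemma smooth_germ_near f x : smooth_germ f x ->
  \forall y \near x, smooth_germ f y.
Proof.
move=> [U [oU Ux fU]]; have : \forall y \near x, U y by exact: open_nbhs_nbhs.
by apply: filterS => y Uy; exists U.
Qed.

Lemma smooth_germ_ext f g x : (\forall y \near x, f y = g y) ->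
  smooth_germ f x -> smooth_germ g x.
Proof.
rewrite -nbhs_nearE nbhsE => -[V [oV Vx] fg] [U [oU Ux fU]].
exists (U `&` V); split=> // [|k]; first exact: openI.
apply: (Ck_ext (f := f)); [exact: openI|by move=> y [_ /fg]|].
by apply: Ck_sub (fU k) => y [].
Qed.

Lemma eq_smooth_germ f g x : f =1 g -> smooth_germ f x -> smooth_germ g x.
Proof. by move=> /funext ->. Qed.

Lemma smooth_germ_ind (f g h : E -> W) x :
  (forall k (U : set E), open U -> Ck k U f -> Ck k U g -> Ck k U h) ->
  smooth_germ f x -> smooth_germ g x -> smooth_germ h x.
Proof.
move=> H [U [oU Ux fU]] [V [oV Vx gV]]; exists (U `&` V); split=> //.
  exact: openI.
move=> k; apply: H; first exact: openI.
  by apply: Ck_sub (fU k) => y [].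
by apply: Ck_sub (gV k) => y [].
Qed.

Lemma smooth_germ_cst (c : W) x : smooth_germ (fun=> c) x.
Proof. by exists setT; split=> //; [exact: openT|move=> k; exact: Ck_cst]. Qed.

Lemma smooth_germD f g x : smooth_germ f x -> smooth_germ g x ->
  smooth_germ (fun y => f y + g y) x.
Proof. by apply: smooth_germ_ind => k U; exact: CkD. Qed.

Lemma smooth_germN f x : smooth_germ f x -> smooth_germ (fun y => - f y) x.
Proof. by move=> [U [oU Ux fU]]; exists U; split=> // k; exact: CkN. Qed.

Lemma smooth_germB f g x : smooth_germ f x -> smooth_germ g x ->
  smooth_germ (fun y => f y - g y) x.
Proof. by move=> fx /smooth_germN; exact: smooth_germD. Qed.

Lemma smooth_germ_sum (I : Type) (r : seq I) (P : pred I) (F : I -> E -> W) x :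
  (forall i, P i -> smooth_germ (F i) x) ->
  smooth_germ (fun y => \sum_(i <- r | P i) F i y) x.
Proof.
move=> FC; elim: r => [|i r IH].
  by apply: eq_smooth_germ (smooth_germ_cst 0 x) => y; rewrite big_nil.
case: (boolP (P i)) => Pi.
  by apply: eq_smooth_germ (smooth_germD (FC i Pi) IH) => y; rewrite big_cons Pi.
by apply: eq_smooth_germ IH => y; rewrite big_cons (negbTE Pi).
Qed.

Lemma smooth_germ_derive f x v : smooth_germ f x -> smooth_germ ('D_v f) x.
Proof.
move=> [U [oU Ux fU]]; exists U; split=> // k.
by have [_ /(_ v) []] := fU k.+1.
Qed.

Lemma smooth_germ_continuous f x : smooth_germ f x -> {for x, continuous f}.
Proof. by move=> [U [oU Ux fU]]; have [+ _] := fU 0%N; apply. Qed.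

End General.

Lemma smooth_germM (f g : E -> R) x : smooth_germ f x -> smooth_germ g x ->
  smooth_germ (fun y => f y * g y) x.
Proof. by apply: smooth_germ_ind => k U; exact: CkM. Qed.

Lemma smooth_germ_prod (I : Type) (r : seq I) (P : pred I) (F : I -> E -> R) x :
  (forall i, P i -> smooth_germ (F i) x) ->
  smooth_germ (fun y => \prod_(i <- r | P i) F i y) x.
Proof.
move=> FC; elim: r => [|i r IH].
  by apply: eq_smooth_germ (smooth_germ_cst (1 : R) x) => y; rewrite big_nil.
case: (boolP (P i)) => Pi.
  by apply: eq_smooth_germ (smooth_germM (FC i Pi) IH) => y; rewrite big_cons Pi.
by apply: eq_smooth_germ IH => y; rewrite big_cons (negbTE Pi).
Qed.

Lemma smooth_germ_mxP p q (F : E -> 'M[R]_(p, q)) x :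
  smooth_germ F x <-> forall i j, smooth_germ (fun y => F y i j) x.
Proof.
split=> [[U [oU Ux FU]] i j|H].
  by exists U; split=> // k; exact: ((Ck_mxP _ _ oU).1 (FU k) i j).
pose G (ij : 'I_p * 'I_q) (y : E) : R := F y ij.1 ij.2.
have : \forall y \near x, forall ij, smooth_on [set y] (G ij).
  apply: (@filter_forall _ _ (fun ij y => smooth_on [set y] (G ij)) _
    (nbhs_filter x)) => -[i j].
  exact/smooth_germP/H.
rewrite -nbhs_nearE nbhsE => -[U [oU Ux] sub]; exists U; split=> // k.
apply/(Ck_mxP _ _ oU) => i j; apply: Ck_loc => y Uy; exists [set y].
by split=> //; exact: (sub y Uy (i, j)).
Qed.

Lemma smooth_germ_differentiable (f : E -> R) x : smooth_germ f x ->
  differentiable f x.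
Proof. by move=> [U [oU Ux fU]]; exact: (Ck_differentiable oU (fU 1%N)). Qed.

Lemma is_derive_invX n (s : R) : s != 0 ->
  is_derive s (1:R) (fun t : R => t^-1 ^+ n) (- (n%:R * s^-1 ^+ n.+1)).
Proof.
move=> s0; elim: n => [|n IH].
  rewrite mul0r oppr0.
  have -> : (fun t : R => t^-1 ^+ 0) = cst 1 by apply/funext => t; rewrite expr0.
  exact: is_derive_cst.
have dV : is_derive s (1:R) (fun t : R => t^-1) (- s^-1 ^+ 2).
  apply: DeriveDef; first exact: derivableV.
  by rewrite (@deriveV _ _ id) // derive_id /GRing.scale /= mulr1 exprVn.
have -> : (fun t : R => t^-1 ^+ n.+1) = (fun t => t^-1) * (fun t => t^-1 ^+ n).
  by apply/funext => t; rewrite exprS.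
apply: (is_derive_eq (is_deriveM dV IH)).
by rewrite /GRing.scale /= !exprS -natr1; ring.
Qed.

Lemma smooth_germ_inv (f : E -> R) x : f x != 0 -> smooth_germ f x ->
  smooth_germ (fun y => (f y)^-1) x.
Proof.
move=> fx0 fx; have fc := smooth_germ_continuous fx.
have : \forall y \near x, f y != 0.
  exact: (@cvgr_neq0 _ _ _ _ (nbhs_filter x) f (f x)).
rewrite -nbhs_nearE nbhsE => -[V [oV Vx] f0]; have [U [oU Ux fU]] := fx.
have oUV : open (U `&` V) by exact: openI.
exists (U `&` V); split=> // k.
(* Negative powers are closed under differentiation up to constants, as [Ck_post] requires; the
   inverse is the member of exponent 1. *)
pose h (n : nat) (s : R) := s^-1 ^+ n.
pose d (n : nat) := [:: (- n%:R : R, n.+1)].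
have hd n (s : R) : s != 0 ->
    is_derive s (1:R) (h n) (\sum_(l <- d n) l.1 * h l.2 s).
  move=> s0; apply: (is_derive_eq (is_derive_invX n s0)).
  by rewrite /d big_seq1 /= mulNr.
have fC : Ck k (U `&` V) f by apply: Ck_sub (fU k) => y [].
have UV0 y : (U `&` V) y -> f y != 0 by case=> _ /f0.
by apply: Ck_ext (Ck_post oUV hd UV0 fC 1%N).
Qed.

End SmoothGerm.

Section Composition.
Context (R : realType).

(* What the geometry below needs to know of a space of values W. *)
Record tame (W : normedModType R) : Prop := Tame {
  tame_differentiable : forall m (f : 'rV[R]_m -> W) x,
    smooth_germ f x -> differentiable f x;
  tame_comp : forall m p (f : 'rV[R]_m -> 'rV[R]_p) (g : 'rV[R]_p -> W) x,
    smooth_germ f x -> smooth_germ g (f x) -> smooth_germ (g \o f) x;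
  tame_derive : forall m (f : 'rV[R]_m -> W) (V : 'rV[R]_m -> 'rV[R]_m) x,
    smooth_germ f x -> smooth_germ V x -> smooth_germ (fun y => 'D_(V y) f y) x;
  tame_bracket : forall m (f : 'rV[R]_m -> W) (V V' : 'rV[R]_m -> 'rV[R]_m) x,
    smooth_germ f x -> smooth_germ V x -> smooth_germ V' x ->
    'D_(V x) (fun y => 'D_(V' y) f y) x - 'D_(V' x) (fun y => 'D_(V y) f y) x =
    'D_('D_(V x) V' x - 'D_(V' x) V x) f x }.

Lemma smooth_germ_near_preim m p (f : 'rV[R]_m -> 'rV[R]_p) (P : set 'rV[R]_p) x :
  smooth_germ f x -> (\forall z \near f x, P z) -> \forall y \near x, P (f y).
Proof. by move=> /smooth_germ_continuous fc Pf; exact: fc. Qed.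

Lemma smooth_germ_comp_real m p (f : 'rV[R]_m -> 'rV[R]_p)
    (g : 'rV[R]_p -> R) x :
  smooth_germ f x -> smooth_germ g (f x) -> smooth_germ (g \o f) x.
Proof.
move=> fx [V [oV Vfx gV]].
have : \forall y \near x, V (f y).
  by apply: (smooth_germ_near_preim fx); exact: open_nbhs_nbhs.
rewrite -nbhs_nearE nbhsE => -[V' [oV' V'x] fV'].
have [U [oU Ux fU]] := fx; exists (U `&` V'); split=> // [|k]; first exact: openI.
apply: (Ck_comp (V := V)) => //; first exact: openI.
  by move=> y [_ /fV'].
by apply: Ck_sub (fU k) => y [].
Qed.

Lemma derive_near m (f : 'rV[R]_m -> R) (V : 'rV[R]_m -> 'rV[R]_m) x :
  smooth_germ f x ->
  \forall y \near x, \sum_j V y ord0 j * 'D_(delta_mx ord0 j) f y = 'D_(V y) f y.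
Proof.
move=> /smooth_germ_near; apply: filterS => y /smooth_germ_differentiable fy.
by rewrite derive_total.
Qed.

Lemma smooth_germ_derive_real m (f : 'rV[R]_m -> R) (V : 'rV[R]_m -> 'rV[R]_m) x :
  smooth_germ f x -> smooth_germ V x -> smooth_germ (fun y => 'D_(V y) f y) x.
Proof.
move=> fx /smooth_germ_mxP Vx; apply: smooth_germ_ext (derive_near V fx) _.
apply: smooth_germ_sum => j _; apply: smooth_germM; first exact: Vx.
exact: smooth_germ_derive.
Qed.

Lemma smooth_germ_differentiable_rV m p (f : 'rV[R]_m -> 'rV[R]_p) x :
  smooth_germ f x -> differentiable f x.
Proof.
move=> /smooth_germ_mxP fx; apply: differentiable_mxP => j.
exact/smooth_germ_differentiable.
Qed.

Lemma derive_rV m p (f : 'rV[R]_m -> 'rV[R]_p) x v i j : smooth_germ f x ->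
  'D_v f x i j = 'D_v (fun y => f y i j) x.
Proof.
by move=> /smooth_germ_differentiable_rV fx;
  rewrite derive_mx ?mxE //; exact: diff_derivable.
Qed.

Lemma derive_derive m (f : 'rV[R]_m -> R) (V : 'rV[R]_m -> 'rV[R]_m) x v :
  smooth_germ f x -> smooth_germ V x ->
  'D_v (fun y => 'D_(V y) f y) x = 'D_('D_v V x) f x + 'D_(V x) ('D_v f) x.
Proof.
move=> fx Vx; rewrite -(near_eq_derive _ (derive_near V fx)).
have Vx' := (smooth_germ_mxP V x).1 Vx.
have dterm j : is_derive x v (fun y => V y ord0 j * 'D_(delta_mx ord0 j) f y)
    ('D_v V x ord0 j * 'D_(delta_mx ord0 j) f x
     + V x ord0 j * 'D_(delta_mx ord0 j) ('D_v f) x).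
  have h1 : is_derive x v (fun y => V y ord0 j) ('D_v V x ord0 j).
    rewrite derive_rV //; apply/derivableP/diff_derivable.
    exact/smooth_germ_differentiable.
  have h2 : is_derive x v ('D_(delta_mx ord0 j) f)
      ('D_(delta_mx ord0 j) ('D_v f) x).
    have [U [oU Ux fU]] := fx; rewrite -(schwarz v (delta_mx ord0 j) oU Ux (fU 2%N)).
    apply/derivableP/diff_derivable/smooth_germ_differentiable.
    exact: smooth_germ_derive.
  apply: (is_derive_eq (is_deriveM h1 h2)).
  by rewrite /GRing.scale /= addrC [in X in X + _]mulrC.
have -> : (fun y => \sum_j V y ord0 j * 'D_(delta_mx ord0 j) f y) =
    \sum_(j < m) (fun y => V y ord0 j * 'D_(delta_mx ord0 j) f y).
  by apply/funext => y; rewrite fct_sumE.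
have [_ ->] := is_derive_sum dterm.
rewrite big_split /= -!derive_total //.
  exact/smooth_germ_differentiable/smooth_germ_derive.
exact/smooth_germ_differentiable.
Qed.

Lemma tame_real : tame R.
Proof.
split.
- by move=> m f x; exact: smooth_germ_differentiable.
- by move=> m p f g x; exact: smooth_germ_comp_real.
- by move=> m f V x; exact: smooth_germ_derive_real.
move=> m f V V' x fx Vx V'x; have [U [oU Ux fU]] := fx.
have fd := smooth_germ_differentiable fx.
have cancel (a b p q r s : R) : a = p + q -> b = r + s -> q = s ->
    a - b = p - r by move=> -> -> ->; ring.
apply: etrans (cancel _ _ _ _ _ _ (derive_derive (V x) fx V'x)
  (derive_derive (V' x) fx Vx) (schwarz (V' x) (V x) oU Ux (fU 2%N))) _.
have dE v := deriveE v fd; apply: etrans (esym (dE _)).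
by rewrite linearB; congr (_ - _); exact: dE.
Qed.

Lemma tame_rV p : tame 'rV[R]_p.
Proof.
have nearD m (f : 'rV[R]_m -> 'rV[R]_p) (V : 'rV[R]_m -> 'rV[R]_m) x i j :
    smooth_germ f x -> \forall y \near x,
      'D_(V y) (fun z => f z i j) y = 'D_(V y) f y i j.
  by move=> /smooth_germ_near; apply: filterS => y fy; rewrite derive_rV.
have derS m (f : 'rV[R]_m -> 'rV[R]_p) (V : 'rV[R]_m -> 'rV[R]_m) x :
    smooth_germ f x -> smooth_germ V x -> smooth_germ (fun y => 'D_(V y) f y) x.
  move=> fx Vx; apply/smooth_germ_mxP => i j.
  apply: smooth_germ_ext (nearD _ f V x i j fx) _.
  by apply: smooth_germ_derive_real => //; have /smooth_germ_mxP := fx; apply.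
split=> //.
- by move=> m f x; exact: smooth_germ_differentiable_rV.
- move=> m q f g x fx /smooth_germ_mxP gfx; apply/smooth_germ_mxP => i j.
  exact: (smooth_germ_comp_real fx (gfx i j)).
move=> m f V V' x fx Vx V'x; apply/matrixP => i j.
have comp v (U : 'rV[R]_m -> 'rV[R]_m) : smooth_germ U x ->
    'D_v (fun y => 'D_(U y) f y) x i j =
    'D_v (fun y => 'D_(U y) (fun z => f z i j) y) x.
  move=> Ux; apply: etrans (derive_rV v i j (derS _ f U x fx Ux)) _.
  exact/esym/(near_eq_derive v (nearD _ f U x i j fx)).
have fij := (smooth_germ_mxP f x).1 fx i j.
rewrite [LHS]mxE [in LHS]mxE.
apply: etrans (etrans (tame_bracket tame_real fij Vx V'x) (esym (derive_rV _ i j fx))).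
by congr (_ - _); exact: comp.
Qed.

End Composition.

(** * Bump functions *)

Section FlatExponential.
Context (R : realType).

(* The derivatives of s |-> exp(- 1 / s), extended by 0 to s <= 0, are linear
   combinations of these functions. *)
Definition flat_exp (n : nat) (s : R) : R :=
  if 0 < s then s^-1 ^+ n * expR (- s^-1) else 0.

Lemma flat_exp_ge0 n s : 0 <= flat_exp n s.
Proof.
rewrite /flat_exp; case: ifP => // s0.
by rewrite mulr_ge0 ?expR_ge0 // exprn_ge0 // invr_ge0 ltW.
Qed.

Lemma flat_exp_gt0 s : 0 < s -> 0 < flat_exp 0 s.
Proof. by move=> s0; rewrite /flat_exp s0 expr0 mul1r expR_gt0. Qed.

(** For positive [s], the exponential of [s^-1] exceeds the term of degree [n + 2] of its series.
    The resulting bound is quadratic in [s], which makes the difference quotient at 0 tend to 0. *)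
Lemma flat_exp_le n s : flat_exp n s <= n.+2`!%:R * s ^+ 2.
Proof.
rewrite /flat_exp; case: ifP => s0; last by rewrite mulr_ge0 // sqr_ge0.
have si0 : 0 < s^-1 by rewrite invr_gt0.
have fact0 : 0 < n.+2`!%:R :> R by rewrite ltr0n fact_gt0.
have := expR_ge1Dxn n.+1 (ltW si0) => H.
have {}H : s^-1 ^+ n.+2 / n.+2`!%:R <= expR s^-1.
  by apply: le_trans H; rewrite lerDr.
rewrite expRN ler_pdivrMr ?expR_gt0 // -ler_pdivrMl ?mulr_gt0 ?exprn_gt0 //.
apply: le_trans H; rewrite le_eqVlt; apply/orP; left; apply/eqP.
have sn0 : s != 0 by rewrite gt_eqF.
by rewrite invfM -exprVn !exprS expr0 mulr1; ring.
Qed.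

Lemma is_derive_flat_exp n s : is_derive s (1:R) (flat_exp n)
  (\sum_(l <- [:: (1 : R, n.+2); (- n%:R, n.+1)]) l.1 * flat_exp l.2 s).
Proof.
rewrite big_cons big_seq1 /=.
have [s0|s0|->] := ltgtP s 0.
- have near0 : \forall t \near s, cst (0:R) t = flat_exp n t.
    have : \forall t \near s, t < 0.
      by apply: open_nbhs_nbhs; split => //; exact: open_lt.
    by apply: filterS => t t0; rewrite /flat_exp ltNge (ltW t0).
  apply: (near_eq_is_derive near0); apply: is_derive_eq.
  by rewrite /flat_exp ltNge (ltW s0) /= !mulr0 addr0.
- have near0 : \forall t \near s, t^-1 ^+ n * expR (- t^-1) = flat_exp n t.
    have : \forall t \near s, 0 < t.
      by apply: open_nbhs_nbhs; split => //; exact: open_gt.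
    by apply: filterS => t t0; rewrite /flat_exp t0.
  apply: (near_eq_is_derive near0).
  have sn0 : s != 0 by rewrite gt_eqF.
  have d1 := is_derive_invX n sn0.
  have d2 : is_derive s (1:R) (fun t => expR (- t^-1)) (s^-1 ^+ 2 * expR (- s^-1)).
    have d3 : is_derive s (1:R) (fun t : R => - t^-1) (s^-1 ^+ 2).
      have := is_deriveN (is_derive_invX 1 sn0).
      rewrite mul1r opprK; have -> // : - (fun t : R => t^-1 ^+ 1) = (fun t => - t^-1).
      by apply/funext.
    have d4 : is_derive (- s^-1) (1:R) expR (expR (- s^-1)) by exact: is_derive_expR.
    have d5 := @is_derive1_comp _ expR (fun t => - t^-1) s _ _ d4 d3.
    by apply: (is_derive_eq d5); rewrite mulrC.
  apply: (is_derive_eq (is_deriveM d1 d2)).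
  by rewrite /flat_exp s0 /GRing.scale /= !exprS; ring.
have -> : 1 * flat_exp n.+2 0 + - n%:R * flat_exp n.+1 0 = 0.
  by rewrite /flat_exp ltxx !mulr0 addr0.
have lim0 : (fun h : R => h^-1 *: ((flat_exp n \o shift 0) (h *: (1:R)) - flat_exp n 0))
    @ (0:R)^' --> (0:R).
  apply/cvgrPdist_le => e e0.
  pose c : R := n.+2`!%:R.
  have c0 : 0 < c by rewrite ltr0n fact_gt0.
  near=> h; have h0 : h != 0 by near: h; exact: nbhs_dnbhs_neq.
  rewrite sub0r normrN /= addr0 [h *: (1:R)]mulr1 {2}/flat_exp ltxx subr0.
  rewrite /GRing.scale /= normrM normfV (ger0_norm (flat_exp_ge0 _ _)).
  rewrite ler_pdivrMl ?normr_gt0 //.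
  apply: le_trans (flat_exp_le n h) _.
  rewrite -real_normK ?num_real // expr2 mulrCA ler_wpM2l // mulrC -ler_pdivlMr //.
  by near: h; apply: dnbhs0_le; rewrite divr_gt0.
apply: DeriveDef; first by apply/cvg_ex; exists 0.
exact: cvg_lim lim0.
Unshelve. all: by end_near. Qed.

End FlatExponential.

Section Bump.
Context (R : realType) (m : nat).

Definition bump (a : 'rV[R]_m) (r : R) (z : 'rV[R]_m) : R :=
  flat_exp 0 (r - \sum_j (z ord0 j - a ord0 j) ^+ 2).

Lemma bump_smooth a r z : smooth_germ (bump a r) z.
Proof.
have oT : open (setT : set 'rV[R]_m) by exact: openT.
exists setT; split=> // k; have Cc j : Ck k setT (fun z : 'rV[R]_m => z ord0 j).
  have CI : Ck k setT (id : 'rV[R]_m -> 'rV[R]_m) by exact: (Ck_linear _ _ idfun).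
  exact: (Ck_mxP _ _ oT).1 CI ord0 j.
have Cd j : Ck k setT (fun z : 'rV[R]_m => z ord0 j - a ord0 j).
  by apply: (CkD oT (Cc j)); exact: Ck_cst.
have Cs : Ck k setT (fun z : 'rV[R]_m => \sum_j (z ord0 j - a ord0 j) ^+ 2).
  apply: Ck_sum => // j _.
  by apply: Ck_ext (CkM oT (Cd j) (Cd j)) => // z' _; rewrite expr2.
have Cq := CkD oT (Ck_cst k setT r) (CkN oT Cs).
by have := Ck_post (D := setT) oT (fun n s _ => is_derive_flat_exp n s) _ Cq 0%N; apply.
Qed.

Lemma bump_gt0 a r : 0 < r -> 0 < bump a r a.
Proof.
move=> r0; apply: flat_exp_gt0; rewrite big1 ?subr0 // => j _.
by rewrite subrr expr0n.
Qed.

Lemma bump_neq0 a r z : 0 < r -> bump a (r ^+ 2) z != 0 -> `|z - a| < r.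
Proof.
move=> r0; rewrite /bump /flat_exp; case: ifPn; last by rewrite eqxx.
rewrite subr_gt0 => sr _; rewrite ltNge; apply/negP => rz.
(* The norm of a row vector is the largest absolute value of its entries, so its square is one of
   the summands on the right. *)
have : (`|z - a| ^+ 2) <= \sum_j (z ord0 j - a ord0 j) ^+ 2.
  have [->|za] := eqVneq `|z - a| 0.
    by rewrite expr0n /= sumr_ge0 // => j _; exact: sqr_ge0.
  have [[i j] zaE] := mx_norm_neq0 za; rewrite [`|z - a|]zaE.
  rewrite real_normK ?num_real //= ord1 !mxE (bigD1 j) //= lerDl.
  by rewrite sumr_ge0 // => j' _; exact: sqr_ge0.
move=> H; have := le_lt_trans H sr.
by rewrite ltNge lerXn2r ?nnegrE // ltW.
Qed.

End Bump.

(** * Calculus in an atlas *)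

Section SmoothAt.
Context (R : realType) (m : nat) (X : Type) (A : atlas R m X).
Implicit Types (x : X).

Lemma smooth_at_cst (W : normedModType R) (w : W) x : smooth_at A (fun=> w) x.
Proof. exact: smooth_germ_cst. Qed.

Lemma smooth_atD (W : normedModType R) (f g : X -> W) x : smooth_at A f x ->
  smooth_at A g x -> smooth_at A (fun y => f y + g y) x.
Proof. exact: smooth_germD. Qed.

Lemma smooth_atN (W : normedModType R) (f : X -> W) x : smooth_at A f x ->
  smooth_at A (fun y => - f y) x.
Proof. exact: smooth_germN. Qed.

Lemma smooth_atB (W : normedModType R) (f g : X -> W) x : smooth_at A f x ->
  smooth_at A g x -> smooth_at A (fun y => f y - g y) x.
Proof. exact: smooth_germB. Qed.

Lemma smooth_atM (f g : X -> R) x : smooth_at A f x ->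
  smooth_at A g x -> smooth_at A (fun y => f y * g y) x.
Proof. exact: smooth_germM. Qed.

Lemma smooth_at_inv (f : X -> R) x : dom A (chart_at A x) x ->
  param A (chart_at A x) (coord A (chart_at A x) x) = x -> f x != 0 ->
  smooth_at A f x -> smooth_at A (fun y => (f y)^-1) x.
Proof. by move=> cx xK fx; apply: smooth_germ_inv; rewrite /= xK. Qed.

Lemma smooth_at_sum (W : normedModType R) (I : Type) (r : seq I) (P : pred I)
    (F : I -> X -> W) x : (forall i, P i -> smooth_at A (F i) x) ->
  smooth_at A (fun y => \sum_(i <- r | P i) F i y) x.
Proof. exact: smooth_germ_sum. Qed.

Lemma smooth_at_prod (I : Type) (r : seq I) (P : pred I)
    (F : I -> X -> R) x : (forall i, P i -> smooth_at A (F i) x) ->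
  smooth_at A (fun y => \prod_(i <- r | P i) F i y) x.
Proof. exact: smooth_germ_prod. Qed.

Lemma smooth_at_mxP p q (F : X -> 'M[R]_(p, q)) x :
  smooth_at A F x <-> forall i j, smooth_at A (fun y => F y i j) x.
Proof. exact: smooth_germ_mxP. Qed.

Lemma smooth_atZ p q (f : X -> R) (F : X -> 'M[R]_(p, q)) x : smooth_at A f x ->
  smooth_at A F x -> smooth_at A (fun y => f y *: F y) x.
Proof.
move=> fx /smooth_at_mxP Fx; apply/smooth_at_mxP => i j.
have := smooth_atM fx (Fx i j).
by apply: eq_smooth_germ => y; rewrite /= mxE.
Qed.

End SmoothAt.

(** The properties that the manifold and its slit bundle share. No topology on [X] enters, limits
    being taken in chart images. The preferred chart is only required to contain points that lie in
    some chart, because zero vectors lie in no chart of [slit_atlas]. *)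
Record smooth_atlas (R : realType) (m : nat) (X : Type) (A : atlas R m X) :
    Prop := SmoothAtlas {
  atlas_chart_at : forall i x, dom A i x -> dom A (chart_at A x) x;
  atlas_open : forall i j, open (coord A i @` (dom A i `&` dom A j));
  atlas_coordK : forall i x, dom A i x -> param A i (coord A i x) = x;
  atlas_trans : forall i j, smooth_on (coord A i @` (dom A i `&` dom A j))
    (coord A j \o param A i) }.

Section SmoothAtlas.
Context (R : realType) (m : nat) (X : Type) (A : atlas R m X).
Hypothesis hA : smooth_atlas A.
Implicit Types (x y : X) (i j : chart A).
Let c x := chart_at A x.

Definition chart_rep (W : Type) i (f : X -> W) : 'rV[R]_m -> W := f \o param A i.

Definition vector_rep i (V : X -> 'rV[R]_m) : 'rV[R]_m -> 'rV[R]_m :=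
  chart_rep i (fun y => chart_comp i y (V y)).

Lemma near_dom i j x : dom A i x -> dom A j x ->
  \forall z \near coord A i x, [/\ dom A i (param A i z),
    coord A i (param A i z) = z & dom A j (param A i z)].
Proof.
move=> ix jx.
have : \forall z \near coord A i x, (coord A i @` (dom A i `&` dom A j)) z.
  by apply: open_nbhs_nbhs; split; [exact: (atlas_open hA)|exists x].
by apply: near_mono => z [y [iy jy] <-]; rewrite (atlas_coordK hA).
Qed.

Lemma smooth_trans i j x : dom A i x -> dom A j x ->
  smooth_germ (coord A j \o param A i) (coord A i x).
Proof.
move=> ix jx; exists (coord A i @` (dom A i `&` dom A j)); split.
- exact: (atlas_open hA).
- by exists x.
- exact: (atlas_trans hA).
Qed.

Lemma chart_rep_near (W : Type) i j x (f : X -> W) : dom A i x -> dom A j x ->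
  \forall z \near coord A i x,
    (chart_rep j f \o (coord A j \o param A i)) z = chart_rep i f z.
Proof.
move=> ix jx; apply: near_mono _ (near_dom ix jx) => z [_ _ jz].
by rewrite /chart_rep /= (atlas_coordK hA).
Qed.

Lemma chart_comp_self x v i : dom A i x -> chart_comp (c x) x v = v.
Proof.
move=> /(atlas_chart_at hA) cx; rewrite /chart_comp /dact -/(c x).
rewrite -[RHS](derive_id (coord A (c x) x) v); apply: near_eq_derive.
by apply: near_mono _ (near_dom cx cx) => z [].
Qed.

Lemma dact_chart (W : normedModType R) i x v (f : X -> W) : dom A i x ->
  differentiable (chart_rep i f) (coord A i x) ->
  dact A x v f = 'D_(chart_comp i x v) (chart_rep i f) (coord A i x).
Proof.
move=> ix fd; have cx := atlas_chart_at hA ix; rewrite /dact.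
rewrite -(near_eq_derive v (chart_rep_near f cx ix)).
have E : (coord A i \o param A (c x)) (coord A (c x) x) = coord A i x.
  by rewrite /= (atlas_coordK hA).
rewrite derive_comp ?E //.
exact/smooth_germ_differentiable_rV/smooth_trans.
Qed.

Section Tame.
Context (W : normedModType R).
Hypothesis tW : tame W.
Implicit Types f g : X -> W.

Lemma smooth_germ_chart i j x f : dom A i x -> dom A j x ->
  smooth_germ (chart_rep j f) (coord A j x) ->
  smooth_germ (chart_rep i f) (coord A i x).
Proof.
move=> ix jx fj; apply: smooth_germ_ext (chart_rep_near f ix jx) _.
apply: (tame_comp tW); first exact: smooth_trans.
by rewrite /= (atlas_coordK hA).
Qed.

Lemma smooth_atE i x f : dom A i x ->
  smooth_at A f x <-> smooth_germ (chart_rep i f) (coord A i x).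
Proof.
move=> ix; have cx := atlas_chart_at hA ix.
by split; exact: smooth_germ_chart.
Qed.

Lemma smooth_at_near i x f : dom A i x -> smooth_at A f x ->
  \forall z \near coord A i x, smooth_at A f (param A i z).
Proof.
move=> ix /(smooth_atE f ix) /smooth_germ_near fi.
apply: near_mono _ (near_and (near_dom ix ix) fi) => z [[iz zK _] fz].
by apply/(smooth_atE _ iz); rewrite zK.
Qed.

Lemma smooth_at_ext i x f g : dom A i x ->
  (\forall z \near coord A i x, f (param A i z) = g (param A i z)) ->
  smooth_at A f x -> smooth_at A g x.
Proof.
move=> ix fg /(smooth_atE f ix) fi; apply/(smooth_atE _ ix).
exact: smooth_germ_ext fi.
Qed.

Lemma dact_rep i x f (V : X -> 'rV[R]_m) : dom A i x -> smooth_at A f x ->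
  \forall z \near coord A i x, 'D_(vector_rep i V z) (chart_rep i f) z =
    dact A (param A i z) (V (param A i z)) f.
Proof.
move=> ix fx; apply: near_mono _ (near_and (near_dom ix ix) (smooth_at_near ix fx)).
move=> z [[iz zK _] fz]; rewrite (dact_chart _ iz) zK //.
by apply: (tame_differentiable tW); rewrite -zK; exact/smooth_atE.
Qed.

End Tame.

Lemma smooth_coord j x : dom A j x -> smooth_at A (coord A j) x.
Proof.
by move=> jx; apply: smooth_trans => //; exact: (atlas_chart_at hA) jx.
Qed.

Let tE := @tame_rV R m.

Lemma chart_comp_trans i j x v : dom A i x -> dom A j x ->
  chart_comp j x v =
  'D_(chart_comp i x v) (coord A j \o param A i) (coord A i x).
Proof.
move=> ix jx; apply: (dact_chart _ ix).
by apply: (tame_differentiable tE); exact: smooth_trans.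
Qed.

Lemma chart_comp_inv i x w : dom A i x ->
  chart_comp i x ('D_w (coord A (c x) \o param A i) (coord A i x)) = w.
Proof.
move=> ix; have cx := atlas_chart_at hA ix.
have dE := tame_differentiable tE.
have d1 := dE _ _ _ (smooth_trans ix cx).
have d2 := dE _ _ _ (smooth_trans cx ix).
have E : (coord A (c x) \o param A i) (coord A i x) = coord A (c x) x.
  by rewrite /= (atlas_coordK hA).
rewrite -E in d2.
apply: etrans (etrans _ (esym (derive_comp w d1 d2))) _; first by rewrite E.
rewrite -[RHS](derive_id (coord A i x) w); apply: near_eq_derive.
apply: near_mono (near_dom ix cx) => z [iz zK cz] /=.
by rewrite (atlas_coordK hA).
Qed.

Lemma chart_comp0 i x : chart_comp i x 0 = 0 :> 'rV[R]_m.
Proof. exact: derive0. Qed.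

Lemma chart_comp_eq0 i x v : dom A i x -> chart_comp i x v = 0 -> v = 0.
Proof.
move=> ix v0; rewrite -(chart_comp_self v ix).
rewrite (chart_comp_trans _ ix (atlas_chart_at hA ix)).
by rewrite v0 derive0.
Qed.

Lemma smooth_vector_chart i j x V : dom A i x -> dom A j x ->
  smooth_at A (fun y => chart_comp i y (V y)) x ->
  smooth_at A (fun y => chart_comp j y (V y)) x.
Proof.
move=> ix jx /(smooth_atE tE _ ix) Vi; apply/(smooth_atE tE _ ix).
apply: smooth_germ_ext (dact_rep tE V ix (smooth_coord jx)) _.
by apply: (tame_derive tE) => //; exact: smooth_trans.
Qed.

Lemma smooth_vector_atE i x V : dom A i x ->
  smooth_vector_at A V x <-> smooth_at A (fun y => chart_comp i y (V y)) x.
Proof.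
move=> ix; have cx := atlas_chart_at hA ix.
by split; exact: smooth_vector_chart.
Qed.

Lemma smooth_vector_rep i x V : dom A i x ->
  smooth_vector_at A V x <-> smooth_germ (vector_rep i V) (coord A i x).
Proof.
by move=> ix; rewrite (smooth_vector_atE _ ix); exact: smooth_atE.
Qed.

Lemma smooth_vector_at_near i x V : dom A i x -> smooth_vector_at A V x ->
  \forall z \near coord A i x, smooth_vector_at A V (param A i z).
Proof.
move=> ix /(smooth_vector_atE V ix) /(smooth_at_near tE ix) Vi.
apply: near_mono _ (near_and (near_dom ix ix) Vi) => z [[iz _ _] Vz].
by apply/(smooth_vector_atE _ iz).
Qed.

Lemma smooth_dact (W : normedModType R) (tW : tame W) i x (f : X -> W) V :
  dom A i x -> smooth_at A f x -> smooth_vector_at A V x ->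
  smooth_at A (fun y => dact A y (V y) f) x.
Proof.
move=> ix fx Vx; apply/(smooth_atE tW _ ix).
apply: smooth_germ_ext (dact_rep tW V ix fx) _.
by apply: (tame_derive tW); [exact/(smooth_atE tW)|exact/smooth_vector_rep].
Qed.

(** The bracket at [x] is defined by components in the preferred chart at [x]; read in that chart,
    the claim is the field [tame_bracket] of [tW]. *)
Lemma bracket_act (W : normedModType R) (tW : tame W) i x (f : X -> W) V V' :
  dom A i x -> smooth_at A f x -> smooth_vector_at A V x ->
  smooth_vector_at A V' x ->
  dact A x (bracket A V V' x) f =
  dact A x (V x) (fun y => dact A y (V' y) f) -
  dact A x (V' x) (fun y => dact A y (V y) f).
Proof.
move=> /(atlas_chart_at hA) cx fx Vx V'x.
rewrite [in RHS]/dact.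
rewrite -(near_eq_derive _ (dact_rep tW V' cx fx)).
rewrite -(near_eq_derive _ (dact_rep tW V cx fx)).
have self U : vector_rep (c x) U (coord A (c x) x) = U x.
  by rewrite /vector_rep /chart_rep /= (atlas_coordK hA) // (chart_comp_self _ cx).
have := tame_bracket tW (f := chart_rep (c x) f) fx
   ((smooth_vector_rep _ cx).1 Vx) ((smooth_vector_rep _ cx).1 V'x).
by rewrite !self => ->.
Qed.

Lemma chart_comp_bracket i x V V' : dom A i x -> smooth_vector_at A V x ->
  smooth_vector_at A V' x ->
  chart_comp i x (bracket A V V' x) =
  dact A x (V x) (fun y => chart_comp i y (V' y)) -
  dact A x (V' x) (fun y => chart_comp i y (V y)).
Proof.
by move=> ix Vx V'x; rewrite {1}/chart_comp (bracket_act tE ix) //; exact: smooth_coord.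
Qed.

Lemma smooth_bracket i x V V' : dom A i x -> smooth_vector_at A V x ->
  smooth_vector_at A V' x -> smooth_vector_at A (bracket A V V') x.
Proof.
move=> ix Vx V'x; apply/(smooth_vector_atE _ ix).
have near_br : \forall z \near coord A i x,
   (fun y => dact A y (V y) (fun y => chart_comp i y (V' y)) -
  dact A y (V' y) (fun y => chart_comp i y (V y))) (param A i z) =
  (fun y => chart_comp i y (bracket A V V' y)) (param A i z).
  apply: near_mono _ (near_and (near_dom ix ix) (near_and (smooth_vector_at_near ix Vx)
    (smooth_vector_at_near ix V'x))) => z [[iz _ _] [Vz V'z]].
  by rewrite chart_comp_bracket.
apply: (smooth_at_ext tE ix near_br); apply: smooth_atB.
- exact: (smooth_dact tE ix ((smooth_vector_atE V' ix).1 V'x) Vx).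
- exact: (smooth_dact tE ix ((smooth_vector_atE V ix).1 Vx) V'x).
Qed.

Lemma dact_linear (W : normedModType R) (tW : tame W) x (f : X -> W) a v w :
  smooth_at A f x -> dact A x (a *: v + w) f = a *: dact A x v f + dact A x w f.
Proof.
move=> /(tame_differentiable tW) fd; have dE u := deriveE u fd.
apply: etrans (dE _) _; rewrite linearP.
by congr (_ *: _ + _); apply: esym; exact: dE.
Qed.

Lemma chart_comp_linear i x a v w : dom A i x ->
  chart_comp i x (a *: v + w) = a *: chart_comp i x v + chart_comp i x w.
Proof. by move=> ix; apply: (dact_linear tE); exact: smooth_coord. Qed.

Lemma chart_compD i x v w : dom A i x ->
  chart_comp i x (v + w) = chart_comp i x v + chart_comp i x w.
Proof. by move=> ix; have := chart_comp_linear 1 v w ix; rewrite !scale1r. Qed.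

Lemma chart_compZ i x a v : dom A i x ->
  chart_comp i x (a *: v) = a *: chart_comp i x v.
Proof.
by move=> ix; have := chart_comp_linear a v 0 ix; rewrite chart_comp0 !addr0.
Qed.

Lemma dactD (W : normedModType R) (tW : tame W) x (f g : X -> W) v :
  smooth_at A f x -> smooth_at A g x ->
  dact A x v (fun y => f y + g y) = dact A x v f + dact A x v g.
Proof.
move=> /(tame_differentiable tW) fd /(tame_differentiable tW) gd.
by apply: deriveD; exact: diff_derivable.
Qed.

Lemma dactM x (f g : X -> R) v : dom A (c x) x ->
  smooth_at A f x -> smooth_at A g x ->
  dact A x v (fun y => f y * g y) = dact A x v f * g x + f x * dact A x v g.
Proof.
move=> cx /smooth_germ_differentiable fd /smooth_germ_differentiable gd.
have := deriveM (diff_derivable (v := v) fd) (diff_derivable (v := v) gd).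
rewrite /= (atlas_coordK hA) // => E; apply: etrans E _.
by rewrite addrC /GRing.scale /= mulrC.
Qed.

Lemma dact_cst (W : normedModType R) x v (w : W) : dact A x v (fun=> w) = 0.
Proof. exact: derive_cst. Qed.

Lemma dact0 (W : normedModType R) x (f : X -> W) : dact A x 0 f = 0.
Proof. exact: derive0. Qed.

Lemma dact_ext (W : normedModType R) x (f g : X -> W) v :
  (\forall z \near coord A (c x) x, f (param A (c x) z) = g (param A (c x) z)) ->
  dact A x v f = dact A x v g.
Proof. exact: near_eq_derive. Qed.

(** The entries of [v] are its derivatives of the coordinate functions. This reduces identities
    between brackets to identities between operators on functions, where [bracket_act] applies. *)
Lemma vector_eq x v w : dom A (c x) x ->
  (forall f : X -> R, smooth_at A f x -> dact A x v f = dact A x w f) -> v = w.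
Proof.
move=> cx vw; have cS := smooth_coord cx; apply/rowP => j.
have H (u : 'rV[R]_m) : u ord0 j = dact A x u (fun y => coord A (c x) y ord0 j).
  rewrite -{1}(chart_comp_self u cx) /chart_comp.
  exact: (derive_rV u ord0 j cS).
by rewrite !H; apply: vw; have /smooth_at_mxP := cS; apply.
Qed.

Lemma bracketC x V V' : bracket A V V' x = - bracket A V' V x.
Proof. by rewrite /bracket opprB. Qed.

Lemma bracket_ext x U V V' : dom A (c x) x ->
  (\forall z \near coord A (c x) x, V (param A (c x) z) = V' (param A (c x) z)) ->
  bracket A U V x = bracket A U V' x.
Proof.
move=> cx VV'.
have Vx : V x = V' x.
  by have := nbhs_singleton VV'; rewrite /= (atlas_coordK hA).
rewrite /bracket Vx; apply: (f_equal (fun w => w - _)); apply: dact_ext.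
by apply: near_mono VV' => z /= ->.
Qed.

#[local] Opaque smooth_at smooth_vector_at dact bracket.

Section BracketAlgebra.
Variables (x : X) (cx : dom A (c x) x).
Variables (U V V' : X -> 'rV[R]_m).
Hypotheses (Us : smooth_vector_at A U x) (Vs : smooth_vector_at A V x)
  (V's : smooth_vector_at A V' x).

Let tR := @tame_real R.

Lemma smooth_vectorD : smooth_vector_at A (fun y => V y + V' y) x.
Proof.
have := smooth_germD ((smooth_vector_rep _ cx).1 Vs) ((smooth_vector_rep _ cx).1 V's).
move=> H; apply/(smooth_vector_rep _ cx); apply: smooth_germ_ext H.
apply: near_mono (near_dom cx cx) => z [iz _ _]; rewrite /vector_rep /chart_rep /=.
rewrite -[V _]scale1r [RHS](dact_linear tE) ?scale1r //; exact: smooth_coord.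
Qed.

Lemma smooth_vectorZ (f : X -> R) : smooth_at A f x ->
  smooth_vector_at A (fun y => f y *: V y) x.
Proof.
move=> fx; have H := smooth_atZ fx Vs; apply: (smooth_at_ext tE cx) H.
apply: near_mono (near_dom cx cx) => z [iz _ _] /=.
rewrite -[in RHS](addr0 (_ *: _)) [RHS](dact_linear tE); last exact: smooth_coord.
by rewrite dact0 addr0.
Qed.

Lemma dactDv y (f : X -> R) v w : smooth_at A f y ->
  dact A y (v + w) f = dact A y v f + dact A y w f.
Proof.
by move=> fy; have := dact_linear tR 1 v w fy; rewrite !scale1r.
Qed.

Lemma dactZv y (f : X -> R) a v : smooth_at A f y ->
  dact A y (a *: v) f = a * dact A y v f.
Proof.
by move=> fy; have := dact_linear tR a v 0 fy; rewrite dact0 !addr0.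
Qed.

Lemma bracketD : bracket A U (fun y => V y + V' y) x =
  bracket A U V x + bracket A U V' x.
Proof.
apply: (vector_eq cx) => f fx.
have e1 := bracket_act tR cx fx Us smooth_vectorD.
have e2 := bracket_act tR cx fx Us Vs.
have e3 := bracket_act tR cx fx Us V's.
have e4 := dactDv (bracket A U V x) (bracket A U V' x) fx.
have e5 : dact A x (U x) (fun y => dact A y (V y + V' y) f) =
    dact A x (U x) (fun y => dact A y (V y) f + dact A y (V' y) f).
  apply: dact_ext; apply: near_mono (smooth_at_near tR cx fx) => z fz.
  exact: dactDv fz.
have e6 := dactD tR (U x) (smooth_dact tR cx fx Vs) (smooth_dact tR cx fx V's).
have e7 := dactDv (V x) (V' x) (smooth_dact tR cx fx Us).
have alg (a b p q r s t u v w : R) : a = b - p -> b = q + r -> p = s + t ->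
    u = q - s -> v = r - t -> w = u + v -> a = w.
  by move=> -> -> -> -> -> ->; ring.
exact: alg e1 (etrans e5 e6) e7 e2 e3 e4.
Qed.

Lemma bracketZ (f : X -> R) : smooth_at A f x ->
  bracket A U (fun y => f y *: V y) x =
  dact A x (U x) f *: V x + f x *: bracket A U V x.
Proof.
move=> fx; apply: (vector_eq cx) => g gx.
have e1 := bracket_act tR cx gx Us (smooth_vectorZ fx).
have e2 := bracket_act tR cx gx Us Vs.
have e3 : dact A x (U x) (fun y => dact A y (f y *: V y) g) =
    dact A x (U x) (fun y => f y * dact A y (V y) g).
  apply: dact_ext; apply: near_mono (smooth_at_near tR cx gx) => z gz.
  exact: dactZv gz.
have e4 := dactM (U x) cx fx (smooth_dact tR cx gx Vs).
have e5 := dactZv (f x) (V x) (smooth_dact tR cx gx Us).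
have e6 := dact_linear tR (dact A x (U x) f) (V x) (f x *: bracket A U V x) gx.
have e7 := dactZv (f x) (bracket A U V x) gx.
have alg (fx' uf a b p q r s t u : R) : a = b - p -> b = uf * q + fx' * r ->
    p = fx' * s -> t = r - s -> u = uf * q + fx' * t -> a = u.
  by move=> -> -> -> -> ->; ring.
by apply: alg e1 (etrans e3 e4) e5 e2 _; rewrite e6 e7.
Qed.

End BracketAlgebra.

Lemma dact_bracket_step x (f : X -> R) P Q S : dom A (c x) x ->
  smooth_at A f x -> smooth_vector_at A P x -> smooth_vector_at A Q x ->
  smooth_vector_at A S x ->
  dact A x (P x) (fun y => dact A y (bracket A Q S y) f) =
  dact A x (P x) (fun y => dact A y (Q y) (fun z => dact A z (S z) f)) -
  dact A x (P x) (fun y => dact A y (S y) (fun z => dact A z (Q z) f)).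
Proof.
move=> cx fx Ps Qs Ss; have tR := @tame_real R.
have E : dact A x (P x) (fun y => dact A y (bracket A Q S y) f) =
    dact A x (P x) (fun y => dact A y (Q y) (fun z => dact A z (S z) f)
      + -1 * dact A y (S y) (fun z => dact A z (Q z) f)).
  apply: dact_ext; apply: near_mono (near_and (near_and (smooth_at_near tR cx fx)
    (near_dom cx cx)) (near_and (smooth_vector_at_near cx Qs)
    (smooth_vector_at_near cx Ss))) => z [[fz [iz _ _]] [Qz Sz]].
  by rewrite mulN1r; exact: (bracket_act tR iz fz Qz Sz).
have s1 := smooth_dact tR cx (smooth_dact tR cx fx Ss) Qs.
have s2 := smooth_dact tR cx (smooth_dact tR cx fx Qs) Ss.
have s3 := smooth_at_cst A (-1 : R) x.
apply: etrans E _; apply: etrans (dactD tR _ s1 (smooth_atM s3 s2)) _.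
by rewrite (dactM (P x) cx s3 s2) dact_cst mul0r add0r mulN1r.
Qed.

Lemma bracket_jacobi x U V V' : dom A (c x) x -> smooth_vector_at A U x ->
  smooth_vector_at A V x -> smooth_vector_at A V' x ->
  bracket A U (bracket A V V') x =
  bracket A (bracket A U V) V' x + bracket A V (bracket A U V') x.
Proof.
move=> cx Us Vs V's; have tR := @tame_real R.
apply: (vector_eq cx) => f fx.
have bUV := smooth_bracket cx Us Vs.
have bUV' := smooth_bracket cx Us V's.
have bVV' := smooth_bracket cx Vs V's.
have d P := smooth_dact tR cx fx (V := P).
have alg (abc acb bac bca cab cba l l1 l2 r r1 r2 s s1 s2 q: R) :
  l = l1 - l2 -> l1 = abc - acb -> l2 = bca - cba ->
  r = r1 - r2 -> r1 = abc - bac -> r2 = cab - cba ->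
  s = s1 - s2 -> s1 = bac - bca -> s2 = acb - cab -> q = r + s -> l = q.
  by move=> -> -> -> -> -> -> -> -> -> ->; ring.
apply: alg (bracket_act tR cx fx Us bVV')
  (dact_bracket_step cx fx Us Vs V's) (bracket_act tR cx (d _ Us) Vs V's)
  (bracket_act tR cx fx bUV V's) (bracket_act tR cx (d _ V's) Us Vs)
  (dact_bracket_step cx fx V's Us Vs)
  (bracket_act tR cx fx Vs bUV') (dact_bracket_step cx fx Vs Us V's)
  (bracket_act tR cx (d _ Vs) Us V's) _.
exact: dactDv.
Qed.

End SmoothAtlas.

(** * The slit bundle *)

Section RowBlocks.
Context (R : realType) (n p : nat).

Lemma smooth_germ_linear m q (f : {linear 'rV[R]_m -> 'rV[R]_q}) x :
  smooth_germ f x.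
Proof. by exists setT; split=> //; [exact: openT|move=> k; exact: Ck_linear]. Qed.

Lemma smooth_germ_comp_rV m q r (f : 'rV[R]_m -> 'rV[R]_q)
    (g : 'rV[R]_q -> 'rV[R]_r) x :
  smooth_germ f x -> smooth_germ g (f x) -> smooth_germ (g \o f) x.
Proof. exact: (tame_comp (tame_rV R r)). Qed.

Lemma smooth_germ_row_mx m (f : 'rV[R]_m -> 'rV[R]_n) (g : 'rV[R]_m -> 'rV[R]_p) x :
  smooth_germ f x -> smooth_germ g x -> smooth_germ (fun y => row_mx (f y) (g y)) x.
Proof.
move=> /smooth_germ_mxP fx /smooth_germ_mxP gx; apply/smooth_germ_mxP => i j.
case: (splitP j) => k jk.
  apply: eq_smooth_germ (fx i k) => y; rewrite mxE.
  by case: splitP => k' /=; rewrite jk => kk; [congr (f y _ _); exact: val_inj|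
    have := ltn_ord k; rewrite kk ltnNge leq_addr].
apply: eq_smooth_germ (gx i k) => y; rewrite mxE.
by case: splitP => k' /=; rewrite jk => kk; [have :=
  ltn_ord k'; rewrite -kk ltnNge leq_addr|
  congr (g y _ _); apply: val_inj; exact: addnI kk].
Qed.

Lemma derive_linear m q (f : {linear 'rV[R]_m -> 'rV[R]_q}) x v : 'D_v f x = f v.
Proof.
have fd := tame_differentiable (tame_rV R q) (smooth_germ_linear f x).
by rewrite (deriveE v fd) (diff_lin x (linear_rV_continuous (f := f))).
Qed.

Lemma derive_comp_lsubmx (W : normedModType R) (tW : tame W)
    (f : 'rV[R]_n -> W) (z v : 'rV[R]_(n + p)) :
  smooth_germ f (lsubmx z) -> 'D_v (f \o lsubmx) z = 'D_(lsubmx v) f (lsubmx z).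
Proof.
move=> fz; have d1 := tame_differentiable (tame_rV R n) (smooth_germ_linear lsubmx z).
have := derive_comp v d1 (tame_differentiable tW fz) => E; apply: etrans E _.
by rewrite (derive_linear lsubmx).
Qed.

Lemma smooth_germ_lsubmx (W : normedModType R) (tW : tame W)
    (f : 'rV[R]_n -> W) (z : 'rV[R]_(n + p)) :
  smooth_germ f (lsubmx z) -> smooth_germ (f \o lsubmx) z.
Proof. by move=> fz; apply: (tame_comp tW) => //; exact: smooth_germ_linear. Qed.

(** This is the shape of the fibre part of a change of induced charts: the differential of a base
    map, at the base point [lsubmx y], applied to a varying vector. Read on the total space it is a
    derivative of [f \o lsubmx] along the field [row_mx (V y) 0]. *)
Lemma smooth_germ_derive_lsubmx (W : normedModType R) (tW : tame W)
    (f : 'rV[R]_n -> W) (V : 'rV[R]_(n + p) -> 'rV[R]_n) (z : 'rV[R]_(n + p)) :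
  smooth_germ f (lsubmx z) -> smooth_germ V z ->
  smooth_germ (fun y => 'D_(V y) f (lsubmx y)) z.
Proof.
move=> fz Vz.
have E : \forall y \near z, 'D_(row_mx (V y) 0) (f \o lsubmx) y =
    'D_(V y) f (lsubmx y).
  have := smooth_germ_near_preim (smooth_germ_linear lsubmx z) (smooth_germ_near fz).
  by apply: near_mono => y fy; rewrite (derive_comp_lsubmx tW) // row_mxKl.
apply: smooth_germ_ext E _; apply: (tame_derive tW).
  exact: smooth_germ_lsubmx.
by apply: smooth_germ_row_mx => //; exact: smooth_germ_cst.
Qed.

End RowBlocks.

Section SlitAtlas.
Context (R : realType) (n : nat) (M : topologicalType) (A : atlas R n M).
Hypothesis hM : smooth_manifold A.
Notation TM := (TM R n M).
Implicit Types (u : TM) (x : M) (i j : chart A).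

Lemma dom_chart_at x : dom A (chart_at A x) x.
Proof. by have [_ + _ _] := hM; apply. Qed.

Lemma dom_open i : open (dom A i).
Proof. by have [_ _ + _] := hM; move=> /(_ i) []. Qed.

Lemma manifold_atlas : smooth_atlas A.
Proof.
have [_ _ hA tA] := hM; split.
- by move=> i x _; exact: dom_chart_at.
- move=> i j; have [_ oi Ki _ Pi] := hA i.
  have -> : coord A i @` (dom A i `&` dom A j) =
      (coord A i @` dom A i) `&` param A i @^-1` dom A j.
    apply/seteqP; split=> [z [x [ix jx] <-]|z [[x ix <-]]] /=.
      by split; [exists x|rewrite /= Ki].
    by rewrite Ki // => jx; exists x.
  rewrite openE => z [zi zj] /=; apply: filterI; first exact: open_nbhs_nbhs.
  have Pz : {for z, continuous (param A i)}.
    by move: Pi; rewrite continuous_open_subspace // => /(_ z); rewrite inE; apply.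
  by apply: Pz; apply: open_nbhs_nbhs; split=> //; exact: dom_open.
- by move=> i x ix; have [_ _ + _ _] := hA i; apply.
- exact: tA.
Qed.

Let hA := manifold_atlas.

Lemma slit_coordK i u : dom (slit_atlas A) i u ->
  param (slit_atlas A) i (coord (slit_atlas A) i u) = u.
Proof.
case: u => x v [/= ix v0].
rewrite row_mxKl row_mxKr (atlas_coordK hA) //; congr pair.
by rewrite -(chart_comp_trans hA _ ix (dom_chart_at x)) (chart_comp_self hA _ ix).
Qed.

Lemma slit_image i j :
  coord (slit_atlas A) i @` (dom (slit_atlas A) i `&` dom (slit_atlas A) j) =
  [set z | (coord A i @` (dom A i `&` dom A j)) (lsubmx z) /\ rsubmx z != 0].
Proof.
apply/seteqP; split=> z.
  move=> [[x v] [[/= ix v0] [/= jx _]] <-] /=; rewrite row_mxKl row_mxKr; split.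
    by exists x.
  by apply: contra v0 => /eqP /(chart_comp_eq0 hA ix) ->.
move=> [[x [ix jx] xz] z0].
have zE := hsubmxK z; rewrite -xz in zE.
exists (x, 'D_(rsubmx z) (coord A (chart_at A x) \o param A i) (coord A i x)).
  suff : 'D_(rsubmx z) (coord A (chart_at A x) \o param A i) (coord A i x) != 0.
    by split; split.
  apply: contra z0 => /eqP z0; have := chart_comp_inv hA (rsubmx z) ix.
  by rewrite z0 chart_comp0 => <-.
by rewrite /= (chart_comp_inv hA _ ix).
Qed.

Lemma slit_open_image i j :
  open (coord (slit_atlas A) i @` (dom (slit_atlas A) i `&` dom (slit_atlas A) j)).
Proof.
rewrite slit_image openE => z [zi z0].
have h1 : \forall y \near z, (coord A i @` (dom A i `&` dom A j)) (lsubmx y).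
  apply: (smooth_germ_near_preim (smooth_germ_linear (@lsubmx R 1 n n) z)).
  by apply: open_nbhs_nbhs; split=> //; exact: (atlas_open hA).
have h2 : \forall y \near z, rsubmx y != 0.
  have rc := smooth_germ_continuous (smooth_germ_linear (@rsubmx R 1 n n) z).
  exact: (@cvgr_neq0 _ _ _ _ (nbhs_filter z) rsubmx (rsubmx z)).
exact: near_and h1 h2.
Qed.

Lemma slit_transE i j u : dom (slit_atlas A) i u -> dom (slit_atlas A) j u ->
  (coord (slit_atlas A) j \o param (slit_atlas A) i) (coord (slit_atlas A) i u) =
  let z := coord (slit_atlas A) i u in
  row_mx ((coord A j \o param A i) (lsubmx z))
      ('D_(rsubmx z) (coord A j \o param A i) (lsubmx z)).
Proof.
move=> iu ju; rewrite [LHS]/comp (slit_coordK iu).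
case: u iu ju => x v [/= ix _] [/= jx _]; rewrite row_mxKl row_mxKr.
by rewrite (atlas_coordK hA ix) (chart_comp_trans hA v ix jx).
Qed.

Lemma slit_smooth_atlas : smooth_atlas (slit_atlas A).
Proof.
split.
- by move=> i u [/= _ u0]; split=> //=; exact: dom_chart_at.
- exact: slit_open_image.
- exact: slit_coordK.
move=> i j k; apply: Ck_loc => z zij.
have tE := tame_rV R n.
have germ : smooth_germ (coord (slit_atlas A) j \o param (slit_atlas A) i) z.
  have tau : smooth_germ (coord A j \o param A i) (lsubmx z).
    by move: zij; rewrite slit_image => -[[x [ix jx] <-] _]; exact: (smooth_trans hA).
  apply: (@smooth_germ_ext _ _ _ (fun z => row_mx ((coord A j \o param A i) (lsubmx z))
      ('D_(rsubmx z) (coord A j \o param A i) (lsubmx z)))).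
    have : \forall y \near z, (coord (slit_atlas A) i @`
        (dom (slit_atlas A) i `&` dom (slit_atlas A) j)) y.
      by apply: open_nbhs_nbhs; split=> //; exact: slit_open_image.
    by apply: near_mono => y [u [iu ju] <-]; rewrite slit_transE.
  apply: smooth_germ_row_mx; first exact: (smooth_germ_lsubmx tE).
  apply: (smooth_germ_derive_lsubmx tE) => //.
  exact: (smooth_germ_linear (@rsubmx R 1 n n)).
by have [U [oU Uz sU]] := germ; exists U; split=> //; exact: sU.
Qed.

End SlitAtlas.

Section SlitFields.
Context (R : realType) (n : nat) (M : topologicalType) (A : atlas R n M).
Hypothesis hM : smooth_manifold A.
Notation TM := (TM R n M).
Notation B := (slit_atlas A).
Notation pfield := (TM -> 'rV[R]_n).
Notation vfield := (TM -> 'rV[R]_(n + n)).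
Implicit Types (u v : TM) (x : M) (i j : chart A) (X Y Z : pfield) (V W : vfield).

Let hA := manifold_atlas hM.
Let hB := slit_smooth_atlas hM.
Let c u := chart_at A u.1.
Let tn := tame_rV R n.
Let tnn := tame_rV R (n + n).

Lemma slit_dom u : slit u -> dom B (c u) u.
Proof. by move=> u0; split=> //=; exact: dom_chart_at. Qed.

Lemma dom_slit i u : dom B i u -> slit u. Proof. by case. Qed.

Lemma near_slit u : slit u ->
  \forall z \near coord B (c u) u, slit (param B (c u) z).
Proof.
move=> u0; have uc := slit_dom u0.
by apply: near_mono (near_dom hB uc uc) => z [/dom_slit].
Qed.

Lemma slit_coordE u : coord B (c u) u = row_mx (coord A (c u) u.1) u.2.
Proof. by rewrite /= (chart_comp_self hA _ (dom_chart_at hM u.1)). Qed.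

Lemma slit_param_fibre x y :
  param B (chart_at A x) (row_mx (coord A (chart_at A x) x) y) = (x, y).
Proof.
have ix := dom_chart_at hM x.
rewrite /= row_mxKl row_mxKr (atlas_coordK hA) //; congr pair.
rewrite -[RHS](derive_id (coord A (chart_at A x) x) y); apply: near_eq_derive.
by apply: near_mono (near_dom hA ix ix) => z [_ zK _].
Qed.

Lemma gammaE u (v : 'rV[R]_n) : gamma A u v = row_mx 0 v.
Proof.
have ix := dom_chart_at hM u.1.
rewrite /gamma derive1E.
have -> : (fun t : R => coord B (chart_at B u) (u.1, u.2 + t *: v)) =
    (fun t : R => t *: row_mx 0 v + row_mx (coord A (c u) u.1) u.2).
  apply/funext => t; rewrite scale_row_mx add_row_mx scaler0 add0r [_ + u.2]addrC.
  by rewrite /= (chart_comp_self hA _ ix).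
have [_ ->] : is_derive (0:R) (1:R)
    (fun t : R => t *: row_mx 0 v + row_mx (coord A (c u) u.1) u.2) (row_mx 0 v).
  exact: (is_derive_line0 id _ _ _).1 (is_derive_id _ _).
by [].
Qed.

Lemma rhoE u w : slit u -> rho A u w = lsubmx w.
Proof.
move=> u0; rewrite /rho /dact -/(c u).
rewrite -[RHS](derive_linear (@lsubmx R 1 n n) (coord B (c u) u)).
apply: near_eq_derive.
have lg := smooth_germ_linear (@lsubmx R 1 n n) (coord B (c u) u).
have ix := dom_chart_at hM u.1.
have near_id : \forall z \near lsubmx (coord B (c u) u),
    coord A (c u) (param A (c u) z) = z.
  rewrite /= row_mxKl.
  by apply: near_mono (near_dom hA ix ix) => z [].
by apply: near_mono (smooth_germ_near_preim lg near_id).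
Qed.

(** In the preferred chart the fibre through [u] is an affine subspace whose fibre coordinates are
    the vector itself. The two difference quotients therefore coincide, and no smoothness of [f] is
    involved. *)
Lemma vact_fibre (W : normedModType R) u (v : 'rV[R]_n) (f : TM -> W) :
  dact B u (row_mx 0 v) f = 'D_v (fun y => f (u.1, y)) u.2.
Proof.
rewrite /dact /derive -/(c u).
suff -> : (fun h : R => h^-1 *: (((f \o param B (c u)) \o shift (coord B (c u) u))
      (h *: row_mx 0 v) - (f \o param B (c u)) (coord B (c u) u))) =
   (fun h : R => h^-1 *: (((fun y => f (u.1, y)) \o shift u.2) (h *: v)
      - f (u.1, u.2))) by [].
apply/funext => h; rewrite slit_coordE.
rewrite /comp /shift scale_row_mx add_row_mx scaler0 add0r.
by rewrite !slit_param_fibre.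
Qed.

Lemma smooth_fibre (W : normedModType R) (tW : tame W) u (f : TM -> W) :
  smooth_at B f u -> smooth_germ (fun y => f (u.1, y)) u.2.
Proof.
move=> fu.
have E : (fun y => f (u.1, y)) =
    (f \o param B (c u)) \o (fun y => row_mx (coord A (c u) u.1) y).
  by apply/funext => y; rewrite /comp slit_param_fibre.
rewrite E; apply: (tame_comp tW).
  apply: smooth_germ_row_mx; first exact: smooth_germ_cst.
  exact: (smooth_germ_linear idfun).
by rewrite -slit_coordE.
Qed.

Lemma chart_comp_vertical i u (v : 'rV[R]_n) : dom B i u ->
  chart_comp (A := B) i u (row_mx 0 v) = row_mx 0 (chart_comp i u.1 v).
Proof.
move=> [ix _]; rewrite [LHS]vact_fibre /=.
apply: etrans (_ : lim ((fun h : R => row_mx 0 (chart_comp i u.1 v)) @ (0:R)^') = _).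
  rewrite /derive; congr (lim _); rewrite eqEsubset; split; apply: near_eq_cvg.
    near=> h; have h0 : h != 0 by near: h; exact: nbhs_dnbhs_neq.
    rewrite /= (chart_comp_linear hA) // opp_row_mx add_row_mx subrr addrK.
    by rewrite scale_row_mx scaler0 scalerA mulVf // scale1r.
  near=> h; have h0 : h != 0 by near: h; exact: nbhs_dnbhs_neq.
  rewrite /= (chart_comp_linear hA) // opp_row_mx add_row_mx subrr addrK.
  by rewrite scale_row_mx scaler0 scalerA mulVf // scale1r.
by apply: cvg_lim => //; exact: cvg_cst.
Unshelve. all: by end_near. Qed.

Lemma lsubmx_chart_comp i u w : dom B i u ->
  lsubmx (chart_comp (A := B) i u w) = chart_comp i u.1 (lsubmx w).
Proof.
move=> iu; have [ix _] := iu; have uc := slit_dom (dom_slit iu).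
have sg := smooth_trans hB uc iu.
have dg := tame_differentiable tnn sg.
have dl := tame_differentiable tn
  (smooth_germ_linear (@lsubmx R 1 n n) ((coord B i \o param B (c u)) (coord B (c u) u))).
have := derive_comp w dg dl; rewrite [in RHS](derive_linear (@lsubmx R 1 n n)).
move=> E; apply: etrans (esym E) _.
have -> : lsubmx \o (coord B i \o param B (c u)) =
    (coord A i \o param A (c u)) \o lsubmx.
  by apply/funext => z; rewrite /= row_mxKl.
have tau := smooth_trans hA (dom_chart_at hM u.1) ix.
have lE : lsubmx (coord B (c u) u) = coord A (c u) u.1 by rewrite /= row_mxKl.
by rewrite (derive_comp_lsubmx tn) ?lE.
Qed.

Definition pfield_comp i X : pfield := fun v => chart_comp i v.1 (X v).

Lemma smooth_pfield_chart i j X u : dom B i u -> dom B j u ->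
  smooth_at B (pfield_comp i X) u -> smooth_at B (pfield_comp j X) u.
Proof.
move=> iu ju Xi; have [ix _] := iu; have [jx _] := ju.
apply/(smooth_atE hB tn _ iu); have {}Xi := (smooth_atE hB tn _ iu).1 Xi.
have tau : smooth_germ (coord A j \o param A i) (lsubmx (coord B i u)).
  by rewrite /= row_mxKl; exact: (smooth_trans hA).
apply: smooth_germ_ext (smooth_germ_derive_lsubmx tn tau Xi).
apply: near_mono (near_dom hB iu ju) => z [[iz _] zK [jz _]].
rewrite /chart_rep /= /pfield_comp (chart_comp_trans hA _ iz jz).
have lz : coord A i (param B i z).1 = lsubmx z by rewrite -[in RHS]zK /= row_mxKl.
by rewrite lz.
Qed.

Lemma smooth_pfieldE i X u : dom B i u -> smooth_pfield A X ->
  smooth_at B (pfield_comp i X) u.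
Proof.
move=> iu Xs; apply: (smooth_pfield_chart (slit_dom (dom_slit iu)) iu).
exact: (Xs u (dom_slit iu)).
Qed.

End SlitFields.

Section FieldOperations.
Context (R : realType) (n : nat) (M : topologicalType) (A : atlas R n M).
Hypothesis hM : smooth_manifold A.
Notation TM := (TM R n M).
Notation B := (slit_atlas A).
Notation pfield := (TM -> 'rV[R]_n).
Notation vfield := (TM -> 'rV[R]_(n + n)).
Implicit Types (u v : TM) (x : M) (i j : chart A) (X Y Z : pfield) (V W : vfield).

Let hA := manifold_atlas hM.
Let hB := slit_smooth_atlas hM.
Let c u := chart_at A u.1.
Let tR := tame_real R.
Let tn := tame_rV R n.
Let tnn := tame_rV R (n + n).
Let sd := slit_dom hM.

Lemma near_slit_forall u (P : TM -> Prop) : slit u -> (forall v, slit v -> P v) ->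
  \forall z \near coord B (c u) u, P (param B (c u) z).
Proof. by move=> u0 PQ; apply: near_mono (near_slit hM u0) => z /PQ. Qed.

Lemma dact_slit_ext (W : normedModType R) u w (f g : TM -> W) : slit u ->
  (forall v, slit v -> f v = g v) -> dact B u w f = dact B u w g.
Proof. by move=> u0 fg; apply: dact_ext;
  exact: (near_slit_forall (P := fun v => f v = g v)). Qed.

Lemma smooth_at_slit_ext (W : normedModType R) (tW : tame W) u (f g : TM -> W) :
  slit u -> (forall v, slit v -> f v = g v) -> smooth_at B f u -> smooth_at B g u.
Proof.
move=> u0 fg; apply: (smooth_at_ext hB tW (sd u0)).
exact: (near_slit_forall (P := fun v => f v = g v)).
Qed.

Lemma smooth_fn_ext (f g : TM -> R) : (forall v, slit v -> f v = g v) ->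
  smooth_fn A f -> smooth_fn A g.
Proof. by move=> fg fs u u0; apply: (smooth_at_slit_ext tR u0 fg); exact: fs. Qed.

Lemma smooth_pfield_ext X Y : (forall v, slit v -> X v = Y v) ->
  smooth_pfield A X -> smooth_pfield A Y.
Proof.
move=> XY Xs u u0; apply: (smooth_at_slit_ext tn u0) (Xs u u0) => v v0.
by rewrite XY.
Qed.

Lemma smooth_vfield_ext V W : (forall v, slit v -> V v = W v) ->
  smooth_vfield A V -> smooth_vfield A W.
Proof.
move=> VW Vs u u0; apply: (smooth_at_slit_ext tnn u0) (Vs u u0) => v v0.
by rewrite VW.
Qed.

Lemma smooth_at_dom_ext (W : normedModType R) (tW : tame W) i u (f g : TM -> W) :
  dom B i u -> (forall v, dom B i v -> f v = g v) ->
  smooth_at B f u -> smooth_at B g u.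
Proof.
move=> iu fg; apply: (smooth_at_ext hB tW iu).
by apply: near_mono (near_dom hB iu iu) => z [iz _ _]; exact: fg.
Qed.

Lemma smooth_pfieldD X Y : smooth_pfield A X -> smooth_pfield A Y ->
  smooth_pfield A (fun v => X v + Y v).
Proof.
move=> Xs Ys u u0.
apply: (smooth_at_dom_ext tn (sd u0) _ (smooth_atD (Xs u u0) (Ys u u0))) => v [iv _].
by rewrite (chart_compD hA).
Qed.

Lemma smooth_pfieldZ (f : TM -> R) X : smooth_fn A f -> smooth_pfield A X ->
  smooth_pfield A (fun v => f v *: X v).
Proof.
move=> fs Xs u u0.
apply: (smooth_at_dom_ext tn (sd u0) _ (smooth_atZ (fs u u0) (Xs u u0))) => v [iv _].
by rewrite (chart_compZ hA).
Qed.

Lemma smooth_fn_cst (a : R) : smooth_fn A (fun=> a).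
Proof. by move=> u u0; exact: smooth_at_cst. Qed.

Lemma smooth_fnD (f g : TM -> R) : smooth_fn A f -> smooth_fn A g ->
  smooth_fn A (fun v => f v + g v).
Proof. by move=> fs gs u u0; apply: smooth_atD; [exact: fs|exact: gs]. Qed.

Lemma smooth_fnM (f g : TM -> R) : smooth_fn A f -> smooth_fn A g ->
  smooth_fn A (fun v => f v * g v).
Proof. by move=> fs gs u u0; apply: smooth_atM; [exact: fs|exact: gs]. Qed.

Lemma smooth_fnN (f : TM -> R) : smooth_fn A f -> smooth_fn A (fun v => - f v).
Proof. by move=> fs u u0; apply: smooth_atN; exact: fs. Qed.

Lemma smooth_pfield0 : smooth_pfield A (fun=> 0).
Proof.
move=> u u0; apply: (smooth_at_dom_ext tn (sd u0) _ (smooth_at_cst B 0 u)) => v _.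
by rewrite chart_comp0.
Qed.

Lemma smooth_vfield0 : smooth_vfield A (fun=> 0).
Proof.
move=> u u0; apply: (smooth_at_dom_ext tnn (sd u0) _ (smooth_at_cst B 0 u)) => v _.
by rewrite chart_comp0.
Qed.

Lemma smooth_pfieldN X : smooth_pfield A X -> smooth_pfield A (fun v => - X v).
Proof.
move=> Xs; apply: smooth_pfield_ext (smooth_pfieldZ (smooth_fn_cst (-1)) Xs) => v _.
by rewrite scaleN1r.
Qed.

Lemma smooth_vfieldD V W : smooth_vfield A V -> smooth_vfield A W ->
  smooth_vfield A (fun v => V v + W v).
Proof.
by move=> Vs Ws u u0; exact: (smooth_vectorD hB (sd u0) (Vs u u0) (Ws u u0)).
Qed.

Lemma smooth_vfieldZ (f : TM -> R) V : smooth_fn A f -> smooth_vfield A V ->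
  smooth_vfield A (fun v => f v *: V v).
Proof.
by move=> fs Vs u u0; exact: (smooth_vectorZ hB (sd u0) (Vs u u0) (fs u u0)).
Qed.

Lemma smooth_bracket_vfield V W : smooth_vfield A V -> smooth_vfield A W ->
  smooth_vfield A (bracket B V W).
Proof.
by move=> Vs Ws u u0; exact: (smooth_bracket hB (sd u0) (Vs u u0) (Ws u u0)).
Qed.

Lemma smooth_vact V (f : TM -> R) : smooth_vfield A V -> smooth_fn A f ->
  smooth_fn A (fun v => vact A v (V v) f).
Proof.
by move=> Vs fs u u0; exact: (smooth_dact hB tR (sd u0) (fs u u0) (Vs u u0)).
Qed.

Lemma smooth_row_mx (f g : TM -> 'rV[R]_n) u : smooth_at B f u -> smooth_at B g u ->
  smooth_at B (fun v => row_mx (f v) (g v)) u.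
Proof. exact: smooth_germ_row_mx. Qed.

Lemma smooth_at_linear p q (l : {linear 'rV[R]_p -> 'rV[R]_q}) (f : TM -> 'rV[R]_p) u :
  smooth_at B f u -> smooth_at B (fun v => l (f v)) u.
Proof. by move=> fu; apply: smooth_germ_comp_rV fu _; exact: smooth_germ_linear. Qed.

Lemma smooth_gammaf X : smooth_pfield A X -> smooth_vfield A (gammaf A X).
Proof.
move=> Xs u u0; have := smooth_row_mx (smooth_at_cst B 0 u) (Xs u u0).
apply: (smooth_at_dom_ext tnn (sd u0)) => v iv.
by rewrite /gammaf (gammaE hM) (chart_comp_vertical hM _ iv).
Qed.

Lemma smooth_rhof V : smooth_vfield A V -> smooth_pfield A (rhof A V).
Proof.
move=> Vs u u0; have := smooth_at_linear (@lsubmx R 1 n n) (Vs u u0).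
apply: (smooth_at_dom_ext tn (sd u0)) => v iv.
by rewrite /rhof (rhoE hM _ (dom_slit iv)) -(lsubmx_chart_comp hM _ iv).
Qed.

Lemma smooth_eta : smooth_pfield A (@eta R n M).
Proof.
move=> u u0; have := smooth_at_linear (@rsubmx R 1 n n) (smooth_coord hB (sd u0)).
by apply: (smooth_at_dom_ext tn (sd u0)) => v iv; rewrite /= row_mxKr.
Qed.

(* The flat vertical derivative, fibre by fibre. *)
Definition fibre_derive X Y : pfield := fun u => 'D_(X u) (fun y => Y (u.1, y)) u.2.

Lemma comp_fibre X u (y : 'rV[R]_n) : chart_comp (c u) u.1 (X (u.1, y)) = X (u.1, y).
Proof. by rewrite (chart_comp_self hA _ (dom_chart_at hM u.1)). Qed.

Lemma smooth_pfield_fibre X u : smooth_pfield A X -> slit u ->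
  smooth_germ (fun y => X (u.1, y)) u.2.
Proof.
move=> Xs u0; have := smooth_fibre hM tn (Xs u u0).
by apply: eq_smooth_germ => y; rewrite comp_fibre.
Qed.

(** Only base components of the bracket count, and those of [gammaf A X] vanish near [u]; what
    remains is the vertical derivative of the base components of [V]. The result thus depends on [V]
    through [rhof A V] only. *)
Lemma rho_bracket_gamma X V u : smooth_pfield A X -> smooth_vfield A V -> slit u ->
  rho A u (bracket B (gammaf A X) V u) = fibre_derive X (rhof A V) u.
Proof.
move=> Xs Vs u0; have gs := smooth_gammaf Xs.
rewrite (rhoE hM _ u0) /bracket.
have comm (W W' : vfield) : smooth_vfield A W' ->
    lsubmx (dact B u (W u) (fun y => chart_comp (A := B) (chart_at B u) y (W' y))) =
    dact B u (W u) (fun y => lsubmx (chart_comp (A := B) (chart_at B u) y (W' y))).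
  move=> Ws; have d1 := tame_differentiable tnn (Ws u u0).
  have d2 := tame_differentiable tn (smooth_germ_linear (@lsubmx R 1 n n) _).
  have := derive_comp (W u) d1 (d2 _); rewrite (derive_linear (@lsubmx R 1 n n)).
  by move=> E; apply: esym.
have e0 : dact B u (V u)
    (fun y => lsubmx (chart_comp (A := B) (chart_at B u) y (gammaf A X y))) = 0.
  apply: etrans (dact_cst B u (V u) (0 : 'rV[R]_n)); apply: dact_ext.
  apply: near_mono (near_dom hB (sd u0) (sd u0)) => z [iz _ _].
  by rewrite /gammaf (gammaE hM) (chart_comp_vertical hM _ iz) row_mxKl.
have e1 : dact B u (row_mx 0 (X u))
    (fun y => lsubmx (chart_comp (A := B) (chart_at B u) y (V y))) =
    dact B u (row_mx 0 (X u)) (fun y => chart_comp (c u) y.1 (rhof A V y)).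
  apply: dact_ext; apply: near_mono (near_dom hB (sd u0) (sd u0)) => z [iz _ _].
  by rewrite (lsubmx_chart_comp hM _ iz) /rhof (rhoE hM _ (dom_slit iz)).
have e2 : dact B u (row_mx 0 (X u)) (fun y => chart_comp (c u) y.1 (rhof A V y)) =
    fibre_derive X (rhof A V) u.
  apply: etrans (vact_fibre hM u (X u) _) _; apply: (f_equal (fun f => 'D_(X u) f u.2)).
  by apply/funext => y; exact: comp_fibre.
have e3 := comm (gammaf A X) V Vs; rewrite /gammaf (gammaE hM) in e3.
apply: etrans (linearB _ _ _) _; rewrite {1}/gammaf (gammaE hM).
apply: etrans (f_equal2 (fun a b => a - b) (etrans e3 (etrans e1 e2))
  (etrans (comm V (gammaf A X) gs) e0)) _.
exact: subr0.
Qed.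

Lemma bracket_gamma X Y u : smooth_pfield A X -> smooth_pfield A Y -> slit u ->
  bracket B (gammaf A X) (gammaf A Y) u =
  gamma A u (fibre_derive X Y u - fibre_derive Y X u).
Proof.
move=> Xs Ys u0; rewrite (gammaE hM) /bracket.
have E (X' Y' : pfield) : smooth_pfield A Y' -> dact B u (gammaf A X' u)
    (fun y => chart_comp (A := B) (chart_at B u) y (gammaf A Y' y)) =
    row_mx 0 (fibre_derive X' Y' u).
  move=> Ys'.
  have -> : dact B u (gammaf A X' u)
      (fun y => chart_comp (A := B) (chart_at B u) y (gammaf A Y' y)) =
     dact B u (row_mx 0 (X' u)) (fun y => row_mx 0 (chart_comp (c u) y.1 (Y' y))).
    rewrite /gammaf (gammaE hM).
    apply: dact_ext; apply: near_mono (near_dom hB (sd u0) (sd u0)) => z [iz _ _].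
    by rewrite (gammaE hM) (chart_comp_vertical hM _ iz).
  pose l := mulmxr (row_mx 0 1%:M : 'M[R]_(n, n + n)) : {linear 'rV[R]_n -> 'rV[R]_(n + n)}.
  have lE w : l w = row_mx 0 w by rewrite /l /= mul_mx_row mulmx0 mulmx1.
  have d1 := tame_differentiable tn (smooth_pfield_fibre Ys' u0).
  have d2 := tame_differentiable tnn (smooth_germ_linear l (Y' (u.1, u.2))).
  apply: etrans (vact_fibre hM u (X' u) _) _.
  have -> : (fun y => row_mx 0 (chart_comp (c u) (u.1, y).1 (Y' (u.1, y)))) =
      l \o (fun y => Y' (u.1, y)).
    by apply: funext => y; rewrite /comp lE; congr row_mx; exact: comp_fibre.
  apply: etrans (derive_comp (X' u) d1 d2) _.
  by rewrite (derive_linear l) lE.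
apply: etrans (f_equal2 (fun a b => a - b) (E X Y Ys) (E Y X Xs)) _.
by rewrite opp_row_mx add_row_mx subr0.
Qed.

Lemma fibre_derive_eta X u : fibre_derive X (@eta R n M) u = X u.
Proof. exact: derive_id. Qed.

Lemma vact_gamma X (f : TM -> R) u :
  vact A u (gammaf A X u) f = 'D_(X u) (fun y => f (u.1, y)) u.2.
Proof. by rewrite /vact /gammaf (gammaE hM) (vact_fibre hM). Qed.

End FieldOperations.

(** * Local extension of fields *)

Section LocalExtension.
Context (R : realType) (n : nat) (M : topologicalType) (A : atlas R n M).
Hypothesis hM : smooth_manifold A.
Notation TM := (TM R n M).
Notation B := (slit_atlas A).
Notation pfield := (TM -> 'rV[R]_n).
Notation vfield := (TM -> 'rV[R]_(n + n)).
Implicit Types (u v : TM) (x : M) (i j : chart A) (X Y Z : pfield) (V W : vfield).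

Let hA := manifold_atlas hM.
Let hB := slit_smooth_atlas hM.
Let c u := chart_at A u.1.
Let tR := tame_real R.
Let tnn := tame_rV R (n + n).
Let sd := slit_dom hM.

Lemma param_continuous i z : (coord A i @` dom A i) z ->
  {for z, continuous (param A i)}.
Proof.
have [_ _ /(_ i) [_ oi _ _ Pi] _] := hM => zi.
by move: Pi; rewrite continuous_open_subspace // => /(_ z); rewrite inE; apply.
Qed.

(** The ball is compact and [M] is Hausdorff. A closed set carrying the support is what makes the
    extension by 0 of a bump function smooth outside the chart domain. *)
Lemma param_closed_ball i a (r : R) :
  closed_ball_ Num.Def.normr a r `<=` coord A i @` dom A i ->
  closed (param A i @` closed_ball_ Num.Def.normr a r).
Proof.
move=> sub; apply: compact_closed; first by have [[]] := hM.
apply: continuous_compact.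
  apply: continuous_in_subspaceT => z; rewrite inE => /sub.
  exact: param_continuous.
apply: bounded_closed_compact; last exact: closed_closed_ball_.
exists (`|a| + r); split; first exact: num_real.
move=> N ltN z /= zr; apply: le_trans (ltW ltN).
have -> : z = a - (a - z) by rewrite subKr.
by rewrite (le_trans (ler_normB _ _)) // lerD2l.
Qed.

Lemma norm_lsubmx_le p q (z : 'rV[R]_(p + q)) : `|lsubmx z| <= `|z|.
Proof.
by apply: rV_norm_le => // j; rewrite mxE; exact: norm_coord_le.
Qed.

(** The bump is taken in the induced coordinates, and the points where it is nonzero lie over the
    closed set [K], inside the chart domain. The last conclusion allows a product of [f] with
    anything smooth over [dom A (c u)] to be extended by 0. *)
Lemma local_bump u : slit u ->
  exists f : TM -> R, [/\ smooth_fn A f, f u != 0 &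
    forall v, slit v -> ~ dom A (c u) v.1 ->
      \forall z \near coord B (c v) v, f (param B (c v) z) = 0].
Proof.
move=> u0; set i := c u; set a := coord B i u.
have ix : dom A i u.1 by exact: dom_chart_at.
have [r2 r20 Pr2] : exists2 r, 0 < r &
    forall z, `|coord A i u.1 - z| < r -> (coord A i @` dom A i) z.
  have [_ _ /(_ i) [_ oi _ _ _] _] := hM.
  have : \forall z \near coord A i u.1, (coord A i @` dom A i) z.
    by apply: open_nbhs_nbhs; split=> //; exists u.1.
  move=> /nbhs_ballP [r /= r0 sub]; exists r => // z zr; apply: sub.
  by rewrite -ball_normE.
(* Half the radius, so that even the closed ball of radius [r] lies in the chart image. *)
pose r := r2 / 2.
have r0 : 0 < r by rewrite divr_gt0.
pose f v := if `[< dom A i v.1 >] then bump a (r ^+ 2) (coord B i v) else 0.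
have fK v : f v != 0 -> dom A i v.1 /\ `|coord B i v - a| < r.
  rewrite /f; case: asboolP => [iv|]; last by rewrite eqxx.
  by move=> /(bump_neq0 r0).
pose K := param A i @` closed_ball_ Num.Def.normr (coord A i u.1) r.
have subK : closed_ball_ Num.Def.normr (coord A i u.1) r `<=` coord A i @` dom A i.
  move=> z /= zr; apply: Pr2; apply: le_lt_trans zr _.
  by rewrite ltr_pdivrMr // ltr_pMr // ltr1n.
have cK : closed K by exact: param_closed_ball.
have f0 v : ~ K v.1 -> f v = 0.
  move=> vK; apply/eqP; apply: contra_notT vK => /fK [iv av].
  exists (coord A i v.1); last exact: (atlas_coordK hA).
  suff : `|coord A i u.1 - coord A i v.1| <= r by [].
  rewrite distrC; apply: le_trans (ltW av).
  have -> : coord A i v.1 - coord A i u.1 = lsubmx (coord B i v - a).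
    exact: esym (etrans (linearB _ _ _)
      (f_equal2 (fun p q => p - q) (row_mxKl _ _) (row_mxKl _ _))).
  exact: norm_lsubmx_le.
have near0 v : slit v -> ~ dom A i v.1 ->
    \forall z \near coord B (c v) v, f (param B (c v) z) = 0.
  move=> v0 iv; have vK : (~` K) v.1.
    move=> [z /subK [y iy <-]]; rewrite (atlas_coordK hA) // => yv.
    by apply: iv; rewrite -yv.
  have vx := dom_chart_at hM v.1.
  have pc : {for lsubmx (coord B (c v) v), continuous (param A (c v))}.
    by apply: param_continuous; rewrite /= row_mxKl; exists v.1.
  have nK : \forall z \near lsubmx (coord B (c v) v), (~` K) (param A (c v) z).
    apply: pc; apply: open_nbhs_nbhs; split; first exact: closed_openC.
    by rewrite /= row_mxKl (atlas_coordK hA).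
  have := smooth_germ_near_preim (smooth_germ_linear (@lsubmx R 1 n n) _) nK.
  by apply: near_mono => z zK; exact: (f0 (param B (c v) z) zK).
exists f; split=> //.
- move=> v v0; case: (pselect (dom A i v.1)) => iv.
    have Bv : dom B i v by [].
    have sb : smooth_at B (fun w => bump a (r ^+ 2) (coord B i w)) v.
      exact: (smooth_germ_comp_real (smooth_coord hB Bv) (bump_smooth a (r ^+ 2) _)).
    apply: (smooth_at_dom_ext hM tR Bv) sb => w [iw _].
    by rewrite /f; case: asboolP.
  apply: (smooth_at_ext hB tR (sd v0) _ (smooth_at_cst B 0 v)).
  by apply: near_mono (near0 v v0 iv) => z ->.
rewrite /f; case: asboolP => // _.
by rewrite gt_eqF // bump_gt0 // exprn_gt0.
Qed.

(** A coordinate field need not extend globally; the cut-off [f] is the price for extending it. The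
    same [f] serves all [w], so the fields built on basis vectors form a frame over the chart
    wherever [f] is nonzero. *)
Lemma local_vfields u : slit u -> exists f : TM -> R,
  [/\ smooth_fn A f, f u != 0 & forall w : 'rV[R]_(n + n), exists V,
    smooth_vfield A V /\ forall v, dom B (c u) v ->
      chart_comp (A := B) (c u) v (V v) = f v *: w].
Proof.
move=> u0; set i := c u.
have [f [fs fu f0]] := local_bump u0.
exists f; split=> // w.
pose V v := if `[< dom A i v.1 >] then
  f v *: 'D_w (coord B (chart_at B v) \o param B i) (coord B i v) else 0.
have VE v : dom B i v -> chart_comp (A := B) i v (V v) = f v *: w.
  move=> iv; rewrite /V; case: asboolP => [_|]; last by case: iv.
  by rewrite (chart_compZ hB) // (chart_comp_inv hB).
exists V; split=> // v v0; case: (pselect (dom A i v.1)) => iv.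
  have Bv : dom B i v by [].
  apply: (smooth_vector_atE hB V Bv).2.
  have := smooth_atZ (fs v v0) (smooth_at_cst B w v).
  by apply: (smooth_at_dom_ext hM tnn Bv) => v' iv'; rewrite VE.
have vd := sd v0; apply: (smooth_at_ext hB tnn vd _ (smooth_at_cst B 0 v)).
apply: near_mono (near_and (near_dom hB vd vd) (f0 v v0 iv)) => z [[iz _ _] fz].
rewrite /V; case: asboolP => _; first by rewrite fz scale0r chart_comp0.
by rewrite chart_comp0.
Qed.

Lemma vfield_at u (w : 'rV[R]_(n + n)) : slit u ->
  exists2 V, smooth_vfield A V & V u = w.
Proof.
move=> u0; have [f [_ fu H]] := local_vfields u0.
have [V [Vs VE]] := H ((f u)^-1 *: w); exists V => //.
rewrite -(chart_comp_self hB (V u) (sd u0)) VE; last exact: sd.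
by rewrite scalerA divff // scale1r.
Qed.

Lemma pfield_at u (w : 'rV[R]_n) : slit u -> exists2 X, smooth_pfield A X & X u = w.
Proof.
move=> u0; have [V Vs Vu] := vfield_at (row_mx w 0) u0.
exists (rhof A V); first exact: smooth_rhof.
by rewrite /rhof (rhoE hM _ u0) Vu row_mxKl.
Qed.

Section Connection.
Variable nabla : TM -> 'rV[R]_(n + n) -> pfield -> 'rV[R]_n.
Hypothesis hn : connection A nabla.

(** The function [f] equal to 0 on the slit bundle and to 1 elsewhere counts as smooth, and the
    difference [Z] of the two fields satisfies [Z = f Z]. At [u] both factors vanish, so the Leibniz
    rule gives a zero derivative. *)
Lemma nabla_slit_ext u w X Y : slit u -> smooth_pfield A X -> smooth_pfield A Y ->
  (forall v, slit v -> X v = Y v) -> nabla u w X = nabla u w Y.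
Proof.
move=> u0 Xs Ys XY; have [_ nD nM _] := hn.
pose Z v := X v - Y v.
have Zs : smooth_pfield A Z by exact: (smooth_pfieldD hM Xs (smooth_pfieldN hM Ys)).
pose f v : R := if v.2 != 0 then 0 else 1.
have fs : smooth_fn A f.
  apply: (smooth_fn_ext hM _ (smooth_fn_cst A 0)) => v v0.
  by rewrite /f ifT.
have Z0 : nabla u w Z = 0.
  have -> : Z = (fun v => f v *: Z v).
    apply/funext => v; rewrite /f; case: ifP => v0; last by rewrite scale1r.
    by rewrite /Z XY // subrr scaler0.
  by rewrite nM // /Z XY // subrr scaler0 /f ifT // scale0r addr0.
have -> : X = (fun v => Y v + Z v) by apply/funext => v; rewrite /Z subrKC.
by rewrite nD // Z0 addr0.
Qed.

End Connection.
End LocalExtension.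

(** * The horizontal map *)

Section SmoothMatrices.
Context (R : realType) (m : nat) (X : Type) (A : atlas R m X) (x : X).

Lemma smooth_at_mulmx p q r (F : X -> 'M[R]_(p, q)) (G : X -> 'M[R]_(q, r)) :
  smooth_at A F x -> smooth_at A G x -> smooth_at A (fun y => F y *m G y) x.
Proof.
move=> /smooth_at_mxP Fs /smooth_at_mxP Gs; apply/smooth_at_mxP => i j.
have : smooth_at A (fun y => \sum_(l < q) F y i l * G y l j) x.
  by apply: smooth_at_sum => l _; exact: smooth_atM (Fs i l) (Gs l j).
by apply: eq_smooth_germ => y; rewrite /= mxE.
Qed.

Lemma smooth_at_det q (F : X -> 'M[R]_q) :
  (forall i j, smooth_at A (fun y => F y i j) x) -> smooth_at A (fun y => \det (F y)) x.
Proof.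
move=> Fs; rewrite /determinant; apply: smooth_at_sum => s _.
apply: smooth_atM; first exact: smooth_at_cst.
by apply: smooth_at_prod => i _; exact: Fs.
Qed.

Lemma smooth_at_adj q (F : X -> 'M[R]_q) :
  (forall i j, smooth_at A (fun y => F y i j) x) -> smooth_at A (fun y => \adj (F y)) x.
Proof.
move=> Fs; apply/smooth_at_mxP => i j.
have cs : smooth_at A (fun y => cofactor (F y) j i) x.
  apply: smooth_atM; first exact: smooth_at_cst.
  apply: smooth_at_det => i' j'.
  by apply: eq_smooth_germ (Fs (lift j i') (lift i j')) => y; rewrite /= !mxE.
by apply: eq_smooth_germ cs => y; rewrite /= mxE.
Qed.

End SmoothMatrices.

Section Beta.
Context (R : realType) (n : nat) (M : topologicalType) (A : atlas R n M).
Hypothesis hM : smooth_manifold A.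
Notation TM := (TM R n M).
Notation B := (slit_atlas A).
Notation pfield := (TM -> 'rV[R]_n).
Notation vfield := (TM -> 'rV[R]_(n + n)).
Implicit Types (u v : TM) (x : M) (i : chart A) (X Y Z : pfield) (V W : vfield).

Let hA := manifold_atlas hM.
Let hB := slit_smooth_atlas hM.
Let c u := chart_at A u.1.
Let tnn := tame_rV R (n + n).
Let sd := slit_dom hM.

Lemma chart_comp_sum i v (I : Type) (r : seq I) (F : I -> 'rV[R]_n) : dom B i v ->
  chart_comp i v.1 (\sum_(l <- r) F l) = \sum_(l <- r) chart_comp i v.1 (F l).
Proof.
move=> [iv _]; apply: (big_morph (chart_comp i v.1)); last exact: chart_comp0.
by move=> a b; rewrite (chart_compD hA).
Qed.

Lemma slit_chart_comp_sum i v (I : Type) (r : seq I) (F : I -> 'rV[R]_(n + n)) :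
  dom B i v -> chart_comp (A := B) i v (\sum_(l <- r) F l) =
  \sum_(l <- r) chart_comp (A := B) i v (F l).
Proof.
move=> iv; apply: (big_morph (chart_comp (A := B) i v)); last exact: chart_comp0.
by move=> a b; rewrite (chart_compD hB).
Qed.

Lemma chart_comp_inj i v (a b : 'rV[R]_n) : dom B i v ->
  chart_comp i v.1 a = chart_comp i v.1 b -> a = b.
Proof.
move=> [iv _] ab; apply/eqP; rewrite -subr_eq0; apply/eqP/(chart_comp_eq0 hA iv).
by rewrite (chart_compD hA _ _ iv) ab -(chart_compD hA _ _ iv) subrr chart_comp0.
Qed.

Variable nabla : TM -> 'rV[R]_(n + n) -> pfield -> 'rV[R]_n.
Hypothesis hn : connection A nabla.
Hypothesis hr : regular A nabla.

Lemma nabla_linear u Y (a : R) w w' : slit u -> smooth_pfield A Y ->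
  nabla u (a *: w + w') Y = a *: nabla u w Y + nabla u w' Y.
Proof. by move=> u0 Ys; have [+ _ _ _] := hn; apply. Qed.

Lemma nablaDl u Y w w' : slit u -> smooth_pfield A Y ->
  nabla u (w + w') Y = nabla u w Y + nabla u w' Y.
Proof. by move=> u0 Ys; have := nabla_linear 1 w w' u0 Ys; rewrite !scale1r. Qed.

Lemma nabla0l u Y : slit u -> smooth_pfield A Y -> nabla u 0 Y = 0.
Proof.
move=> u0 Ys; have := nablaDl 0 0 u0 Ys; rewrite addr0.
by move/eqP; rewrite -subr_eq0 opprD addNKr oppr_eq0 => /eqP.
Qed.

Lemma nablaZl u Y (a : R) w : slit u -> smooth_pfield A Y ->
  nabla u (a *: w) Y = a *: nabla u w Y.
Proof.
by move=> u0 Ys; have := nabla_linear a w 0 u0 Ys; rewrite nabla0l // !addr0.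
Qed.

Lemma nabla_suml u Y (I : Type) (r : seq I) (F : I -> 'rV[R]_(n + n)) :
  slit u -> smooth_pfield A Y ->
  nabla u (\sum_(l <- r) F l) Y = \sum_(l <- r) nabla u (F l) Y.
Proof.
move=> u0 Ys; apply: (big_morph (fun w => nabla u w Y)); last exact: nabla0l.
by move=> a b; rewrite nablaDl.
Qed.

Let eta_s : smooth_pfield A (@eta R n M) := smooth_eta hM.

(** When a vector projecting to [v] is split by regularity, its part in the kernel of the connection
    map still projects to [v]. Hence the default value 0 of [beta] never intervenes. *)
Lemma beta_spec u (v : 'rV[R]_n) : slit u ->
  Kmap nabla u (beta A nabla u v) = 0 /\ rho A u (beta A nabla u v) = v.
Proof.
move=> u0; have [/(_ (row_mx v 0)) [a [b [wE ra Kb]]] _] := hr u0.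
apply: (@xgetPex _ 0 [set w | Kmap nabla u w = 0 /\ rho A u w = v]).
exists b; split=> //; move: ra; rewrite !(rhoE hM _ u0) => ra.
by have := congr1 lsubmx wE; rewrite row_mxKl linearD /= ra add0r => ->.
Qed.

Lemma beta_unique u (v : 'rV[R]_n) w : slit u ->
  Kmap nabla u w = 0 -> rho A u w = v -> beta A nabla u v = w.
Proof.
move=> u0 Kw rw; have [Kb rb] := beta_spec v u0.
have [_ inj] := hr u0; apply/eqP; rewrite -subr_eq0; apply/eqP/inj.
  by move: rb rw; rewrite !(rhoE hM _ u0) linearB /= => -> ->; rewrite subrr.
by rewrite /Kmap -scaleN1r addrC nabla_linear // -!/(Kmap _ _ _) Kb Kw scaler0 addr0.
Qed.

Lemma K_gamma_inj u (v : 'rV[R]_n) : slit u ->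
  Kmap nabla u (row_mx 0 v) = 0 -> v = 0.
Proof.
move=> u0 Kv; have [_ inj] := hr u0.
have := inj (row_mx 0 v); rewrite (rhoE hM _ u0) row_mxKl => /(_ erefl Kv) E.
by have := congr1 rsubmx E; rewrite row_mxKr linear0.
Qed.

(* In a chart the horizontal lift of a field with components x has components
   (x, - x N G^-1), where N and G are, up to a common factor, the matrices of the
   connection map on horizontal and vertical coordinate fields. *)
Lemma smooth_betaf X : smooth_pfield A X -> smooth_vfield A (betaf A nabla X).
Proof.
move=> Xs u u0; set i := c u.
have [f [fs fu H]] := local_vfields hM u0.
have [E HE] := choice (fun j : 'I_n => H (row_mx (delta_mx ord0 j) 0)).
have Es j := (HE j).1; have Ec j := (HE j).2.
pose e j := rhof A (E j).
have es j : smooth_pfield A (e j) by exact: smooth_rhof.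
have ec j v : dom B i v -> chart_comp i v.1 (e j v) = f v *: delta_mx ord0 j.
  move=> iv; rewrite /e /rhof (rhoE hM _ (dom_slit iv)) -(lsubmx_chart_comp hM _ iv).
  by rewrite Ec // linearZ /= row_mxKl.
have covs V : smooth_vfield A V -> smooth_pfield A (cov nabla V (@eta R n M)).
  by move=> Vs; have [_ _ _] := hn; apply.
pose comps (V : 'I_n -> vfield) v (j : 'I_n) :=
  chart_comp i v.1 (cov nabla (V j) (@eta R n M) v).
pose N v := \matrix_(j, l) comps E v j ord0 l.
pose G v := \matrix_(j, l) comps (fun j => gammaf A (e j)) v j ord0 l.
have entry V (l : 'I_n) : smooth_vfield A V ->
    smooth_at B (fun v => chart_comp i v.1 (cov nabla V (@eta R n M) v) ord0 l) u.
  move=> Vs; have := smooth_pfieldE hM (sd u0) (covs V Vs).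
  by move=> /smooth_at_mxP /(_ ord0 l).
have Ns j l : smooth_at B (fun v => N v j l) u.
  by apply: eq_smooth_germ (entry (E j) l (Es j)) => z; rewrite /= mxE.
have Gs j l : smooth_at B (fun v => G v j l) u.
  have gs := smooth_gammaf hM (es j).
  by apply: eq_smooth_germ (entry _ l gs) => z; rewrite /= mxE.
have rowE (F : TM -> 'I_n -> 'rV[R]_n) (y : 'rV[R]_n) v :
    y *m (\matrix_(j, l) F v j ord0 l) = \sum_j y ord0 j *: F v j.
  apply/rowP => l; rewrite mxE summxE; apply: eq_bigr => j _.
  by rewrite !mxE.
have KG v (y : 'rV[R]_n) : dom B i v ->
    chart_comp i v.1 (Kmap nabla v (row_mx 0 (\sum_j y ord0 j *: e j v))) = y *m G v.
  move=> iv; have v0 := dom_slit iv.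
  have -> : row_mx 0 (\sum_j y ord0 j *: e j v) =
      \sum_j y ord0 j *: gammaf A (e j) v :> 'rV[R]_(n + n).
    rewrite -[RHS]hsubmxK !linear_sum /=; congr row_mx.
      rewrite big1 // => j _; by rewrite linearZ /= /gammaf (gammaE hM) row_mxKl scaler0.
    by apply: eq_bigr => j _; rewrite linearZ /= /gammaf (gammaE hM) row_mxKr.
  rewrite /Kmap (nabla_suml _ _ v0 eta_s) (chart_comp_sum _ _ iv) /G rowE.
  apply: eq_bigr => j _; rewrite (nablaZl _ _ v0 eta_s).
  by rewrite (chart_compZ hA) //; case: iv.
have KN v (y : 'rV[R]_n) : dom B i v ->
    chart_comp i v.1 (Kmap nabla v (\sum_j y ord0 j *: E j v)) = y *m N v.
  move=> iv; have v0 := dom_slit iv.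
  rewrite /Kmap (nabla_suml _ _ v0 eta_s) (chart_comp_sum _ _ iv) /N rowE.
  apply: eq_bigr => j _; rewrite (nablaZl _ _ v0 eta_s).
  by rewrite (chart_compZ hA) //; case: iv.
have ecs v (y : 'rV[R]_n) : dom B i v ->
    chart_comp i v.1 (\sum_j y ord0 j *: e j v) = f v *: y.
  move=> iv; rewrite (chart_comp_sum _ _ iv) {2}[y]row_sum_delta scaler_sumr.
  apply: eq_bigr => j _; rewrite (chart_compZ hA) ?ec //; last by case: iv.
  by rewrite !scalerA mulrC.
(* A row vector killed by [G v] yields a vertical vector killed by the connection map, hence zero by
   regularity; as [f v] is nonzero, so are its components. *)
have Gu v : dom B i v -> f v != 0 -> G v \in unitmx.
  move=> iv fv; rewrite -row_free_unit -kermx_eq0; apply/eqP/row_matrixP => r.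
  rewrite row0; set y := row r _.
  have yG : y *m G v = 0 by rewrite /y -row_mul mulmx_ker row0.
  have K0 := etrans (etrans (KG v y iv) yG) (esym (chart_comp0 i v.1)).
  have y0 := K_gamma_inj (dom_slit iv) (chart_comp_inj iv K0).
  have := ecs v y iv; rewrite y0 chart_comp0 => /esym/eqP.
  by rewrite scaler_eq0 (negbTE fv) => /eqP.
pose x v := chart_comp i v.1 (X v).
(* Cramer's rule: smoothness can be read off the determinant and the adjugate, which are polynomial
   in the entries. *)
pose z v := x v *m N v *m ((\det (G v))^-1 *: \adj (G v)).
have bE v : dom B i v -> f v != 0 ->
    chart_comp (A := B) i v (betaf A nabla X v) = row_mx (x v) (- z v).
  move=> iv fv; have v0 := dom_slit iv; have [iv1 _] := iv.
  have zG : z v *m G v = x v *m N v.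
    have := mulVmx (Gu v iv fv); rewrite /invmx (Gu v iv fv) => GG.
    by rewrite /z -mulmxA GG mulmx1.
  pose a := \sum_j x v ord0 j *: E j v.
  pose b : 'rV[R]_(n + n) := row_mx 0 (\sum_j z v ord0 j *: e j v).
  have -> : betaf A nabla X v = (f v)^-1 *: (a + (-1) *: b).
    apply: (beta_unique v0).
      apply: (chart_comp_inj iv); rewrite chart_comp0 /Kmap.
      rewrite (nablaZl _ _ v0 eta_s) (nablaDl _ _ v0 eta_s) (nablaZl _ _ v0 eta_s).
      rewrite -!/(Kmap _ _ _) (chart_compZ hA _ _ iv1) (chart_compD hA _ _ iv1).
      by rewrite (chart_compZ hA _ _ iv1) (KN _ _ iv) (KG _ _ iv) zG scaleN1r subrr scaler0.
    rewrite (rhoE hM _ v0) linearZ linearD linearZ /= row_mxKl scaler0 addr0.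
    apply: (chart_comp_inj iv); rewrite (chart_compZ hA _ _ iv1) linear_sum /=.
    have -> : \sum_j lsubmx (x v ord0 j *: E j v) = \sum_j x v ord0 j *: e j v.
      by apply: eq_bigr => j _; rewrite linearZ /= /e /rhof (rhoE hM _ v0).
    rewrite (ecs _ _ iv) scalerA (mulVf fv) scale1r; exact: erefl.
  have ca : chart_comp (A := B) i v a = row_mx (f v *: x v) 0.
    rewrite /a (slit_chart_comp_sum _ _ iv).
    transitivity (\sum_j x v ord0 j *: (f v *: row_mx (delta_mx ord0 j : 'rV[R]_n)
      (0 : 'rV[R]_n))).
      by apply: eq_bigr => j _; rewrite (chart_compZ hB _ _ iv) (Ec _ _ iv).
    rewrite -[LHS]hsubmxK !linear_sum /= [in RHS](row_sum_delta (x v)) scaler_sumr.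
    apply: (f_equal2 (@row_mx R 1 n n)); [apply: eq_bigr|apply: big1] => j _.
      by rewrite !linearZ /= row_mxKl !scalerA mulrC.
    by rewrite !linearZ /= row_mxKr !scaler0.
  have cb : chart_comp (A := B) i v b = row_mx 0 (f v *: z v).
    rewrite /b (chart_comp_vertical hM _ iv) (ecs _ _ iv); exact: erefl.
  rewrite (chart_compZ hB _ _ iv) (chart_compD hB _ _ iv) (chart_compZ hB _ _ iv) ca cb.
  rewrite !scale_row_mx add_row_mx scale_row_mx scaler0 addr0 add0r scaleN1r scalerN.
  rewrite !scalerA (mulVf fv) !scale1r; exact: erefl.
have iu : dom B i u by exact: sd.
have xs : smooth_at B x u by exact: (smooth_pfieldE hM iu Xs).
have Gdet : \det (G u) != 0 by have := Gu u iu fu; rewrite unitmxE unitfE.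
have zs : smooth_at B z u.
  apply: smooth_at_mulmx; first apply: smooth_at_mulmx => //.
    exact/smooth_at_mxP.
  apply: smooth_atZ; last exact: smooth_at_adj.
  apply: smooth_at_inv; [exact: iu|exact: (atlas_coordK hB iu)|exact: Gdet|].
  exact: smooth_at_det.
have nf : \forall t \near coord B (c u) u, f (param B (c u) t) != 0.
  have fc := smooth_germ_continuous (fs u u0).
  apply: (@cvgr_neq0 _ _ _ _ (nbhs_filter _) (f \o param B (c u)) _ fc).
  exact: (eq_ind_r (fun t => f t != 0) fu (atlas_coordK hB iu)).
apply: (smooth_vector_atE hB _ iu).2.
apply: (smooth_at_ext hB tnn iu _ (smooth_row_mx xs (smooth_atN zs))).
apply: near_mono (near_and (near_dom hB iu iu) nf) => t [[it _ _] ft].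
by rewrite bE.
Qed.
End Beta.

(** * Algebra of the Cartan connection *)

Section CartanAlgebra.
Variables (F : comPzRingType) (G X : lmodType F).
Variables (act : X -> F -> F) (br : X -> X -> X).
Hypothesis actDl : forall V W f, act (V + W) f = act V f + act W f.
Hypothesis actZl : forall a V f, act (a *: V) f = a * act V f.
Hypothesis actD : forall V f f', act V (f + f') = act V f + act V f'.
Hypothesis actM : forall V f f', act V (f * f') = act V f * f' + f * act V f'.
Hypothesis brC : forall V W, br V W = - br W V.
Hypothesis brD : forall U V W, br U (V + W) = br U V + br U W.
Hypothesis brZ : forall U f V, br U (f *: V) = act U f *: V + f *: br U V.
Hypothesis jacobi : forall U V W, br U (br V W) = br (br U V) W + br V (br U W).
Hypothesis br_act : forall V W f,
  act (br V W) f = act V (act W f) - act W (act V f).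

Variables (rho : X -> G) (gam bt : G -> X).
Hypothesis rhoD : forall V W, rho (V + W) = rho V + rho W.
Hypothesis rhoZ : forall f V, rho (f *: V) = f *: rho V.
Hypothesis gamD : forall Y Z, gam (Y + Z) = gam Y + gam Z.
Hypothesis gamZ : forall f Y, gam (f *: Y) = f *: gam Y.
Hypothesis btD : forall Y Z, bt (Y + Z) = bt Y + bt Z.
Hypothesis btZ : forall f Y, bt (f *: Y) = f *: bt Y.
Hypothesis rho_gam : forall Y, rho (gam Y) = 0.
Hypothesis rho_bt : forall Y, rho (bt Y) = Y.
Hypothesis rho_br_gam : forall Y V, rho (br (gam Y) V) = rho (br (gam Y) (bt (rho V))).

(* The flat vertical connection. *)
Variable vflat : G -> G -> G.
Hypothesis vflat_def : forall Y Z, rho (br (gam Y) (bt Z)) = vflat Y Z.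
Hypothesis br_gam : forall Y Z,
  br (gam Y) (gam Z) = gam (vflat Y Z) - gam (vflat Z Y).

Variable eta : G.
Hypothesis vflat_eta : forall Y, vflat Y eta = Y.

(* e stands for the square of the Finsler function. *)
Variables (e : F) (g : G -> G -> F).
Hypothesis cancel2 : forall f : F, 2 * f = 0 -> f = 0.
Hypothesis hessian : forall Y Z,
  2 * g Y Z = act (gam Y) (act (gam Z) e) - act (gam (vflat Y Z)) e.
Hypothesis act_eta_e : act (gam eta) e = 2 * e.
Hypothesis g_inj : forall Y, (forall Z, g Y Z = 0) -> Y = 0.

Variable nab : X -> G -> G.
Hypothesis nabDl : forall V W Y, nab (V + W) Y = nab V Y + nab W Y.
Hypothesis nabZl : forall f V Y, nab (f *: V) Y = f *: nab V Y.
Hypothesis nabD : forall V Y Z, nab V (Y + Z) = nab V Y + nab V Z.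
Hypothesis nabZ : forall V f Y, nab V (f *: Y) = act V f *: Y + f *: nab V Y.
Hypothesis nab_bt_eta : forall Y, nab (bt Y) eta = 0.
Hypothesis regular : forall V, rho V = 0 -> nab V eta = 0 -> V = 0.
Hypothesis nabg : forall V Y Z, act V (g Y Z) = g (nab V Y) Z + g Y (nab V Z).
Hypothesis nabQ : forall Y Z,
  nab (bt Y) Z - nab (bt Z) Y = rho (br (bt Y) (bt Z)).

Variable torsT : G -> G -> G.
Hypothesis torsTE : forall Y Z, torsT Y Z = nab (gam Y) Z - vflat Y Z.
Hypothesis torsT_sym : forall Y Z W, g (torsT Y Z) W = g (torsT Y W) Z.

(* The horizontal Berwald derivative. *)
Variable hflat : G -> G -> G.
Hypothesis hflat_def : forall Y Z, nab (br (bt Y) (gam Z)) eta = hflat Y Z.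

Variable torsP : G -> G -> G.
Hypothesis torsPE : forall Y Z, torsP Y Z = hflat Y Z - nab (bt Y) Z.

Definition curv (V W : X) (Z : G) : G :=
  - nab V (nab W Z) + nab W (nab V Z) + nab (br V W) Z.

Local Notation K V := (nab V eta).

(** * Elementary rules for the operations *)

Lemma map0_of_addr (A B : zmodType) (f : A -> B) :
  (forall x y, f (x + y) = f x + f y) -> f 0 = 0.
Proof. by move=> fD; apply: (@addrI _ (f 0)); rewrite -fD !addr0. Qed.

Lemma mapN_of_addr (A B : zmodType) (f : A -> B) :
  (forall x y, f (x + y) = f x + f y) -> forall x, f (- x) = - f x.
Proof.
by move=> fD x; apply/eqP; rewrite -addr_eq0 -fD addNr (map0_of_addr fD).
Qed.

Lemma mapB_of_addr (A B : zmodType) (f : A -> B) :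
  (forall x y, f (x + y) = f x + f y) -> forall x y, f (x - y) = f x - f y.
Proof. by move=> fD x y; rewrite fD (mapN_of_addr fD). Qed.

Lemma act0 V : act V 0 = 0. Proof. exact: map0_of_addr (actD V). Qed.
Lemma actN V f : act V (- f) = - act V f. Proof. exact: mapN_of_addr (actD V) f. Qed.
Lemma actB V f f' : act V (f - f') = act V f - act V f'.
Proof. exact: mapB_of_addr (actD V) f f'. Qed.
Lemma actBl V W f : act (V - W) f = act V f - act W f.
Proof. exact: (mapB_of_addr (fun V W => actDl V W f)). Qed.
Lemma act1 V : act V 1 = 0.
Proof.
by have := actM V 1 1; rewrite !mulr1 mul1r -{1}[act V 1]addr0 => /addrI.
Qed.
Lemma act_nat V m : act V m%:R = 0.
Proof. by elim: m => [|m IH]; rewrite ?act0 // -natr1 actD IH act1 addr0. Qed.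

Lemma brN U V : br U (- V) = - br U V. Proof. exact: mapN_of_addr (brD U) V. Qed.
Lemma brB U V W : br U (V - W) = br U V - br U W.
Proof. exact: mapB_of_addr (brD U) V W. Qed.
Lemma brDl U V W : br (U + V) W = br U W + br V W.
Proof. by rewrite brC brD opprD -!brC. Qed.
Lemma brNl U W : br (- U) W = - br U W. Proof. by rewrite brC brN -brC. Qed.
Lemma brBl U V W : br (U - V) W = br U W - br V W.
Proof. by rewrite brDl brNl. Qed.
Lemma brZl f V W : br (f *: V) W = - act W f *: V + f *: br V W.
Proof. by rewrite brC brZ opprD scaleNr -[- (f *: _)]scalerN -brC. Qed.
Lemma rhoN V : rho (- V) = - rho V. Proof. exact: mapN_of_addr rhoD V. Qed.
Lemma rhoB V W : rho (V - W) = rho V - rho W.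
Proof. exact: mapB_of_addr rhoD V W. Qed.
Lemma gamB Y Z : gam (Y - Z) = gam Y - gam Z.
Proof. exact: mapB_of_addr gamD Y Z. Qed.
Lemma btN Y : bt (- Y) = - bt Y. Proof. exact: mapN_of_addr btD Y. Qed.
Lemma btB Y Z : bt (Y - Z) = bt Y - bt Z.
Proof. exact: mapB_of_addr btD Y Z. Qed.
Lemma nab0 V : nab V 0 = 0. Proof. exact: map0_of_addr (nabD V). Qed.
Lemma nabB V Y Z : nab V (Y - Z) = nab V Y - nab V Z.
Proof. exact: mapB_of_addr (nabD V) Y Z. Qed.
Lemma nabNl V Y : nab (- V) Y = - nab V Y.
Proof. exact: (mapN_of_addr (fun V W => nabDl V W Y)). Qed.
Lemma nabBl V W Y : nab (V - W) Y = nab V Y - nab W Y.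
Proof. exact: (mapB_of_addr (fun V W => nabDl V W Y)). Qed.
Lemma nab0l Y : nab 0 Y = 0.
Proof. exact: (map0_of_addr (fun V W => nabDl V W Y)). Qed.

Lemma eq2 (a b : F) : 2 * a = 2 * b -> a = b.
Proof.
by move=> ab; apply/eqP; rewrite -subr_eq0; apply/eqP/cancel2; rewrite mulrBr ab subrr.
Qed.

(** The closing device of the computations below: known equations, summed by [addE], form [c = d],
    and the difference with the goal is an identity for [ring]. *)
Lemma lincomb (a b c d : F) : c = d -> a - b = c - d -> a = b.
Proof. by move=> ->; rewrite subrr => /subr0_eq. Qed.

Lemma addE (a b c d : F) : a = b -> c = d -> a + c = b + d.
Proof. by move=> -> ->. Qed.

(** * The flat vertical connection, the metric and the Cartan tensor *)

Lemma vflatDl Y Y' Z : vflat (Y + Y') Z = vflat Y Z + vflat Y' Z.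
Proof. by rewrite -!vflat_def gamD brDl rhoD. Qed.
Lemma vflatD Y Z Z' : vflat Y (Z + Z') = vflat Y Z + vflat Y Z'.
Proof. by rewrite -!vflat_def btD brD rhoD. Qed.
Lemma vflatB Y Z Z' : vflat Y (Z - Z') = vflat Y Z - vflat Y Z'.
Proof. exact: mapB_of_addr (vflatD Y) Z Z'. Qed.
Lemma vflatBl Y Y' Z : vflat (Y - Y') Z = vflat Y Z - vflat Y' Z.
Proof. exact: (mapB_of_addr (fun Y Y' => vflatDl Y Y' Z)). Qed.
Lemma vflatZl f Y Z : vflat (f *: Y) Z = f *: vflat Y Z.
Proof. by rewrite -!vflat_def gamZ brZl rhoD !rhoZ rho_gam scaler0 add0r. Qed.
Lemma vflatZ f Y Z : vflat Y (f *: Z) = act (gam Y) f *: Z + f *: vflat Y Z.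
Proof. by rewrite -!vflat_def btZ brZ rhoD !rhoZ rho_bt. Qed.

(** Flatness of the vertical connection is the [rho]-part of the Jacobi identity for [gam Y],
    [gam Z] and [bt W]; by [rho_br_gam] the inner brackets count through their projections only. *)
Lemma vflat_curv Y Z W :
  vflat Y (vflat Z W) - vflat Z (vflat Y W) = vflat (vflat Y Z - vflat Z Y) W.
Proof.
rewrite -[RHS]vflat_def gamB -br_gam.
have -> : br (br (gam Y) (gam Z)) (bt W) =
  br (gam Y) (br (gam Z) (bt W)) - br (gam Z) (br (gam Y) (bt W)).
  by rewrite jacobi addrK.
by rewrite rhoB; congr (_ - _); rewrite [RHS]rho_br_gam !vflat_def.
Qed.

(** The Hessian of [e] is symmetric because the flat connection is torsion-free, which is
    [br_gam]. *)
Lemma gC Y Z : g Y Z = g Z Y.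
Proof.
apply: eq2; rewrite !hessian.
have := br_act (gam Y) (gam Z) e; rewrite br_gam actBl => E.
by apply: (lincomb (esym E)); ring.
Qed.

Lemma gDl Y Y' Z : g (Y + Y') Z = g Y Z + g Y' Z.
Proof. by apply: eq2; rewrite mulrDr !hessian vflatDl !gamD !actDl; ring. Qed.
Lemma gZl f Y Z : g (f *: Y) Z = f * g Y Z.
Proof.
by apply: eq2; rewrite mulrCA !hessian vflatZl !gamZ !actZl; ring.
Qed.
Lemma gD Y Z Z' : g Y (Z + Z') = g Y Z + g Y Z'.
Proof. by rewrite gC gDl gC [g Z' _]gC. Qed.
Lemma gZ f Y Z : g Y (f *: Z) = f * g Y Z.
Proof. by rewrite gC gZl gC. Qed.
Lemma gN Y Z : g Y (- Z) = - g Y Z. Proof. exact: mapN_of_addr (gD Y) Z. Qed.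
Lemma gB Y Z Z' : g Y (Z - Z') = g Y Z - g Y Z'.
Proof. exact: mapB_of_addr (gD Y) Z Z'. Qed.
Lemma gNl Y Z : g (- Y) Z = - g Y Z.
Proof. exact: (mapN_of_addr (fun Y Y' => gDl Y Y' Z)). Qed.
Lemma gBl Y Y' Z : g (Y - Y') Z = g Y Z - g Y' Z.
Proof. exact: (mapB_of_addr (fun Y Y' => gDl Y Y' Z)). Qed.
Lemma g0 Y : g Y 0 = 0. Proof. exact: map0_of_addr (gD Y). Qed.
Lemma g0l Y : g 0 Y = 0. Proof. by rewrite gC g0. Qed.

Definition glin := (gDl, gZl, gNl, gBl, gD, gZ, gN, gB, g0, g0l).

Lemma eq_g Y Z : (forall W, g Y W = g Z W) -> Y = Z.
Proof.
by move=> YZ; apply/eqP; rewrite -subr_eq0; apply/eqP/g_inj => W; rewrite gBl YZ subrr.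
Qed.

Lemma vflatE Y Z : vflat Y Z = nab (gam Y) Z - torsT Y Z.
Proof. by rewrite torsTE subKr. Qed.

(* The vertical derivative of g is symmetric since g is a Hessian for the flat
   connection, and the metric connection nab differs from it by torsT. *)
Lemma act_gam_g Y Z W : act (gam Y) (g Z W) =
  g (vflat Y Z) W + g Z (vflat Y W) + 2 * g (torsT Y Z) W.
Proof.
rewrite nabg !vflatE !glin; have -> : g Z (torsT Y W) = g (torsT Y Z) W.
  by rewrite gC torsT_sym.
by ring.
Qed.

(** By [act_gam_g], [2 * g (torsT Y Z) W] is half the third flat derivative of [e], and derivatives
    for a flat torsion-free connection commute. With [torsT_sym] this gives total symmetry. *)
Lemma torsTC_g Y Z W : g (torsT Y Z) W = g (torsT Z Y) W.
Proof.
apply: eq2.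
have E Y' Z' : 2 * g (torsT Y' Z') W =
    act (gam Y') (g Z' W) - g (vflat Y' Z') W - g Z' (vflat Y' W).
  by rewrite act_gam_g; ring.
rewrite !E; apply: eq2.
have h A B := hessian A B.
have H2 A B C : 2 * act (gam A) (g B C) =
    act (gam A) (act (gam B) (act (gam C) e)) - act (gam A) (act (gam (vflat B C)) e).
  by rewrite -actB -hessian actM (act_nat _ 2) mul0r add0r.
have a3 := br_act (gam Y) (gam Z) (act (gam W) e).
rewrite br_gam actBl in a3.
have a4 : act (gam (vflat Y (vflat Z W))) e - act (gam (vflat Z (vflat Y W))) e =
    act (gam (vflat (vflat Y Z) W)) e - act (gam (vflat (vflat Z Y) W)) e.
  by rewrite -!actBl -!gamB vflat_curv vflatBl.
rewrite !mulrBr !H2 !h; apply: (lincomb (addE (esym a3) (esym a4))); ring.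
Qed.

Lemma torsTC Y Z : torsT Y Z = torsT Z Y.
Proof. by apply: eq_g => W; exact: torsTC_g. Qed.

Lemma g_eta Y : 2 * g eta Y = act (gam Y) e.
Proof.
rewrite gC hessian act_eta_e vflat_eta actM (act_nat _ 2).
by ring.
Qed.

Lemma act_gam_g_eta Y Z : act (gam Y) (g eta Z) = g Y Z + g eta (vflat Y Z).
Proof.
apply: eq2; rewrite mulrDr hessian.
have -> : 2 * act (gam Y) (g eta Z) = act (gam Y) (2 * g eta Z).
  by rewrite actM (act_nat _ 2); ring.
by rewrite !g_eta; ring.
Qed.

(** The form [g eta] is half the differential of [e], so its flat derivative is already the Hessian
    [g]; this leaves no room for the [torsT] term of [act_gam_g]. *)
Lemma torsT_eta Y : torsT Y eta = 0.
Proof.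
apply: g_inj => Z; apply: eq2; rewrite mulr0.
have := act_gam_g Y eta Z; rewrite act_gam_g_eta vflat_eta => E.
by apply: (lincomb (esym E)); ring.
Qed.

Lemma torsT_eta_l Y : torsT eta Y = 0.
Proof. by rewrite torsTC torsT_eta. Qed.

Lemma torsTDl Y Y' Z : torsT (Y + Y') Z = torsT Y Z + torsT Y' Z.
Proof.
by rewrite !torsTE gamD nabDl vflatDl opprD addrACA.
Qed.
Lemma torsTZl f Y Z : torsT (f *: Y) Z = f *: torsT Y Z.
Proof.
by rewrite !torsTE gamZ nabZl vflatZl scalerBr.
Qed.
Lemma K_gam Y : K (gam Y) = Y.
Proof.
by have := torsT_eta Y; rewrite torsTE vflat_eta => /subr0_eq.
Qed.

Lemma split V : V = bt (rho V) + gam (K V).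
Proof.
apply/eqP; rewrite -subr_eq0; apply/eqP/regular.
  by rewrite rhoB rhoD rho_bt rho_gam addr0 subrr.
by rewrite nabBl nabDl nab_bt_eta K_gam add0r subrr.
Qed.

Lemma eE : g eta eta = e.
Proof. by apply: eq2; rewrite g_eta. Qed.

(** * The horizontal Berwald derivative and the tensor P *)

Lemma act_bt_e Y : act (bt Y) e = 0.
Proof. by rewrite -eE nabg !nab_bt_eta g0 g0l addr0. Qed.

Lemma br_bt_gam Y Z : br (bt Y) (gam Z) = gam (hflat Y Z) - bt (vflat Z Y).
Proof.
rewrite [LHS]split hflat_def addrC; congr (_ + _).
by rewrite brC rhoN btN vflat_def.
Qed.

Lemma br_gam_bt Y Z : br (gam Y) (bt Z) = bt (vflat Y Z) - gam (hflat Z Y).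
Proof. by rewrite brC br_bt_gam opprB. Qed.

Lemma hflatE Y Z : hflat Y Z = nab (bt Y) Z + torsP Y Z.
Proof. by rewrite torsPE addrC subrK. Qed.

Lemma torsPDl Y Y' Z : torsP (Y + Y') Z = torsP Y Z + torsP Y' Z.
Proof. by rewrite !torsPE -!hflat_def btD brDl !nabDl opprD addrACA. Qed.
Lemma torsPD Y Z Z' : torsP Y (Z + Z') = torsP Y Z + torsP Y Z'.
Proof. by rewrite !torsPE -!hflat_def gamD brD nabDl nabD opprD addrACA. Qed.
Lemma torsPZ f Y Z : torsP Y (f *: Z) = f *: torsP Y Z.
Proof.
rewrite !torsPE -!hflat_def gamZ brZ nabDl !nabZl K_gam nabZ scalerBr.
by rewrite opprD addrACA subrr add0r.
Qed.
Lemma torsPB Y Z Z' : torsP Y (Z - Z') = torsP Y Z - torsP Y Z'.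
Proof. exact: mapB_of_addr (torsPD Y) Z Z'. Qed.

(** As [e] is constant along horizontal fields, applying the bracket of [bt Y] and [gam Z] to [e]
    shows that [act (bt Y) (g eta Z)] equals [g eta (hflat Y Z)]; since [nab] is metric it also
    equals [g eta (nab (bt Y) Z)]. *)
Lemma g_eta_torsP Y Z : g eta (torsP Y Z) = 0.
Proof.
have E : act (bt Y) (g eta Z) = g eta (nab (bt Y) Z).
  by rewrite nabg nab_bt_eta g0l add0r.
have E2 : 2 * act (bt Y) (g eta Z) = act (gam (hflat Y Z)) e.
  have -> : 2 * act (bt Y) (g eta Z) = act (bt Y) (2 * g eta Z).
    by rewrite actM (act_nat _ 2); ring.
  rewrite g_eta; have := br_act (bt Y) (gam Z) e.
  rewrite br_bt_gam actBl !act_bt_e act0 => E'.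
  by apply: (lincomb (esym E')); ring.
apply: eq2; rewrite mulr0.
have := hflatE Y Z => H; move: E2; rewrite -g_eta H gD E => E2.
by apply: (lincomb (esym E2)); ring.
Qed.

Local Notation S := (bt eta).

Lemma rho_br_S Z : rho (br S (bt Z)) = nab S Z.
Proof. by rewrite -nabQ nab_bt_eta subr0. Qed.

Lemma br_S_gam Y : br S (gam Y) = gam (hflat eta Y) - bt Y.
Proof. by rewrite br_bt_gam vflat_eta. Qed.

Lemma rho_br_S_gam Y : rho (br S (gam Y)) = - Y.
Proof. by rewrite br_S_gam rhoB rho_gam rho_bt sub0r. Qed.

Lemma gE Y Z W : Y = Z -> g Y W = g Z W. Proof. by move->. Qed.

(** The horizontal part of the Jacobi identity for [S], [gam Y] and [bt Z]; it computes the
    commutator of [nab S] with the flat derivative [vflat Y]. *)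
Lemma jacobi_S Y Z : nab S (vflat Y Z) + hflat Z Y =
  vflat (hflat eta Y) Z - (nab (bt Y) Z - nab (bt Z) Y) + vflat Y (nab S Z).
Proof.
have := congr1 rho (jacobi S (gam Y) (bt Z)).
rewrite br_gam_bt brB rhoB rho_br_S rho_br_S_gam opprK => ->.
rewrite rhoD br_S_gam brBl rhoB vflat_def nabQ; congr (_ + _).
by rewrite rho_br_gam rho_br_S vflat_def.
Qed.

(* The form d(g(eta, rho -)) is invariant under the spray S = bt eta; evaluated on
   (gam Y, bt Z) this compares hflat eta with nab S. *)
Lemma torsP_eta_l Y : torsP eta Y = 0.
Proof.
apply: g_inj => Z.
have gS A : act S (g eta A) = g eta (nab S A) by rewrite nabg nab_bt_eta g0l add0r.
have gY A : act (bt Y) (g eta A) = g eta (nab (bt Y) A).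
  by rewrite nabg nab_bt_eta g0l add0r.
have s1 := nabg S Y Z.
have s2 := br_act S (gam Y) (g eta Z).
rewrite br_S_gam actBl gS gY !act_gam_g_eta actD gS in s2.
have J := gE eta (jacobi_S Y Z); rewrite !glin ![g _ eta]gC in J.
have PZ := g_eta_torsP Z Y; rewrite torsPE !glin in PZ.
rewrite torsPE !glin.
apply: (lincomb (addE (addE s2 J) (addE s1 (esym PZ)))).
by ring.
Qed.

Lemma hflat_eta Y : hflat eta Y = nab S Y.
Proof. by rewrite hflatE torsP_eta_l addr0. Qed.

(** The vertical part of the Jacobi identity for [S], [gam Y] and [gam Z]: bracketing with [S] turns
    a vertical field into a horizontal one, up to a vertical term, so [hflat] appears. Derivatives
    along [S] are eliminated by [jacobi_S]. *)
Lemma hflatC Y Z : hflat Y Z - hflat Z Y = nab (bt Y) Z - nab (bt Z) Y.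
Proof.
have JK := congr1 (fun V => K V) (jacobi S (gam Y) (gam Z)).
rewrite br_gam brB !br_S_gam !hflat_eta in JK.
rewrite brBl brB !br_gam br_bt_gam br_gam_bt !(nabDl, nabNl) in JK.
rewrite !K_gam !nab_bt_eta in JK.
have JY := jacobi_S Y Z; have JZ := jacobi_S Z Y.
rewrite hflat_eta in JY; rewrite hflat_eta in JZ.
apply: eq_g => W; apply: eq2.
have := gE W JK; have := gE W JY; have := gE W JZ; rewrite !glin => eZ eY eK.
apply: (lincomb (addE eK (addE (esym eY) eZ))); ring.
Qed.

Lemma torsPC Y Z : torsP Y Z = torsP Z Y.
Proof.
apply: eq_g => W; have := gE W (hflatC Y Z).
by rewrite !torsPE !glin => E; apply: (lincomb E); ring.
Qed.

(** The bracket of [S] and [gam Y], which is [gam (nab S Y) - bt Y], is applied to [g Z W] in two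
    ways. On the arguments the commutator involves the Berwald derivative [hflat Y], whereas the
    metric is parallel for [nab (bt Y)]; the discrepancy is [torsP]. *)
Lemma torsT_torsP Y Z W :
  2 * g (nab S (torsT Y Z) - torsT (nab S Y) Z - torsT Y (nab S Z)) W =
  g (torsP Y Z) W + g Z (torsP Y W).
Proof.
have e2 := br_act S (gam Y) (g Z W).
rewrite br_S_gam hflat_eta actBl !(nabg S) !actD (nabg (bt Y)) !act_gam_g in e2.
rewrite !actD !actM !(act_nat _ 2) !(nabg S) in e2.
have JZ := gE W (jacobi_S Y Z); have JW := gE Z (jacobi_S Y W).
rewrite !hflat_eta !glin in JZ JW; rewrite ![g _ Z]gC in JW.
have hZ := gE W (hflatC Y Z); have hW := gE Z (hflatC Y W).
rewrite !glin in hZ hW; rewrite ![g _ Z]gC in hW.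
rewrite !glin !torsPE !glin.
apply: (lincomb (addE (esym (addE JZ JW)) (addE (esym e2) (esym (addE hZ hW))))); ring.
Qed.

Lemma dtorsT_sym Y Z W :
  g (nab S (torsT Y Z) - torsT (nab S Y) Z - torsT Y (nab S Z)) W =
  g (nab S (torsT Y W) - torsT (nab S Y) W - torsT Y (nab S W)) Z.
Proof.
have := nabg S (torsT Y Z) W; rewrite torsT_sym nabg => E.
rewrite !glin (torsT_sym Y (nab S Z)) (torsT_sym Y (nab S W)).
by apply: (lincomb (esym (addE E (torsT_sym (nab S Y) Z W)))); ring.
Qed.

(** [torsT_torsP] identifies only the part of [torsP] symmetric in the last two slots. The remaining
    difference [q] is symmetric in the first two slots and skew in the last two, which forces it to
    vanish. *)
Lemma torsP_torsT Y Z :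
  torsP Y Z = nab S (torsT Y Z) - torsT (nab S Y) Z - torsT Y (nab S Z).
Proof.
pose n A B C := g (nab S (torsT A B) - torsT (nab S A) B - torsT A (nab S B)) C.
have n12 A B C : n A B C = n B A C.
  by rewrite /n (torsTC A B) (torsTC _ B) (torsTC _ (nab S B)) addrAC.
have n23 A B C : n A B C = n A C B by exact: dtorsT_sym.
pose q A B C := g (torsP A B) C - n A B C.
have q12 A B C : q A B C = q B A C by rewrite /q torsPC n12.
have q23 A B C : q A B C = - q A C B.
  have := torsT_torsP A B C; rewrite -/(n A B C) gC [g B _]gC => E.
  by rewrite /q (n23 A C B); apply: (lincomb (esym E)); rewrite gC; ring.
apply: eq_g => W; rewrite -/(n Y Z W); apply: eq2.
have q0 : q Y Z W = - q Y Z W.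
  by rewrite {1}q23 q12 q23 opprK q12 q23 q12.
by rewrite /q in q0; apply: (lincomb q0); ring.
Qed.

Lemma torsP_sym Y Z W : g (torsP Y Z) W = g (torsP Y W) Z.
Proof. by rewrite !torsP_torsT dtorsT_sym. Qed.

Lemma nab_S_torsT Y Z :
  nab S (torsT Y Z) = torsP Y Z + torsT (nab S Y) Z + torsT Y (nab S Z).
Proof. by rewrite torsP_torsT; apply: eq_g => W; rewrite !glin; ring. Qed.

(** * Curvature of a metric connection split as D + A *)

Lemma curv_skew V W Z U : g (curv V W Z) U = - g (curv V W U) Z.
Proof.
have E := br_act V W (g Z U); rewrite !(nabg V, nabg W, nabg (br V W)) !actD in E.
rewrite !(nabg V, nabg W) in E; rewrite /curv !glin.
by rewrite ![g _ Z]gC; apply: (lincomb E); ring.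
Qed.

Section Decomposition.
Variables (D A : X -> G -> G) (V W : X).
Hypothesis nabE : forall V Y, nab V Y = D V Y + A V Y.
Hypothesis A_sym : forall V Y Z, g (A V Y) Z = g (A V Z) Y.

(** The sign is opposite to that of [curv]. *)
Definition curvD Z := D V (D W Z) - D W (D V Z) - D (br V W) Z.

Definition derA (V' W' : X) Z U :=
  act V' (g (A W' Z) U) - g (A W' (D V' Z)) U - g (A W' Z) (D V' U).

Lemma curv_decomposition Z U : g (curv V W Z) U =
  - g (curvD Z) U - (derA V W Z U - derA W V Z U - g (A (br V W) Z) U)
  + g (A W Z) (A V U) - g (A V Z) (A W U).
Proof.
have e1 := nabg V (A W Z) U; have e2 := nabg W (A V Z) U.
rewrite /curv /curvD /derA [nab W Z]nabE [nab V Z]nabE !nabD.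
rewrite !(nabE _ (D _ _)) (nabE (br V W)).
rewrite !(nabE _ U) !glin in e1 e2; rewrite !glin.
by apply: (lincomb (addE e1 (esym e2))); ring.
Qed.

Lemma derA_sym V' W' Z U : derA V' W' Z U = derA V' W' U Z.
Proof.
rewrite /derA (A_sym W' Z U) (A_sym W' (D V' Z)) (A_sym W' (D V' U)).
by ring.
Qed.

Lemma curv_skew_part Z U : 2 * g (curv V W Z) U =
  g (curvD U) Z - g (curvD Z) U + 2 * (g (A W Z) (A V U) - g (A V Z) (A W U)).
Proof.
have e1 := curv_decomposition Z U; have e2 := curv_decomposition U Z.
have e3 := curv_skew V W U Z.
rewrite (derA_sym V W U) (derA_sym W V U) (A_sym (br V W) U) in e2.
rewrite (gC (A W U)) (gC (A V U)) in e2.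
by apply: (lincomb (addE e1 (addE (esym e2) e3))); ring.
Qed.

Lemma curv_sym_part Z U :
  2 * (derA V W Z U - derA W V Z U - g (A (br V W) Z) U) =
  - (g (curvD Z) U + g (curvD U) Z).
Proof.
have e1 := curv_decomposition Z U; have e2 := curv_decomposition U Z.
have e3 := curv_skew V W U Z.
rewrite (derA_sym V W U) (derA_sym W V U) (A_sym (br V W) U) in e2.
rewrite (gC (A W U)) (gC (A V U)) in e2.
by apply: (lincomb (addE e1 (addE e2 (esym e3)))); ring.
Qed.

End Decomposition.

Definition berwald V Y := vflat (K V) Y + hflat (rho V) Y.
Definition cartan_berwald V Y := torsT (K V) Y - torsP (rho V) Y.

Lemma nab_berwald V Y : nab V Y = berwald V Y + cartan_berwald V Y.
Proof.
rewrite /berwald /cartan_berwald torsTE torsPE {1}[V]split nabDl opprB.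
by apply: eq_g => W; rewrite !glin; ring.
Qed.

Lemma cartan_berwald_sym V Y Z :
  g (cartan_berwald V Y) Z = g (cartan_berwald V Z) Y.
Proof. by rewrite /cartan_berwald !glin torsT_sym torsP_sym. Qed.

Lemma vflat0l Y : vflat 0 Y = 0.
Proof. exact: (map0_of_addr (fun Z Z' => vflatDl Z Z' Y)). Qed.
Lemma hflat0l Y : hflat 0 Y = 0.
Proof.
rewrite -hflat_def (map0_of_addr btD) (map0_of_addr (fun V W => brDl V W _)).
exact: nab0l.
Qed.
Lemma torsT0l Y : torsT 0 Y = 0.
Proof. exact: (map0_of_addr (fun Z Z' => torsTDl Z Z' Y)). Qed.
Lemma torsP0l Y : torsP 0 Y = 0.
Proof. exact: (map0_of_addr (fun Z Z' => torsPDl Z Z' Y)). Qed.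

Lemma berwald_gam Y Z : berwald (gam Y) Z = vflat Y Z.
Proof. by rewrite /berwald K_gam rho_gam hflat0l addr0. Qed.
Lemma berwald_bt Y Z : berwald (bt Y) Z = hflat Y Z.
Proof. by rewrite /berwald nab_bt_eta rho_bt vflat0l add0r. Qed.
Lemma cartan_berwald_gam Y Z : cartan_berwald (gam Y) Z = torsT Y Z.
Proof. by rewrite /cartan_berwald K_gam rho_gam torsP0l subr0. Qed.
Lemma cartan_berwald_bt Y Z : cartan_berwald (bt Y) Z = - torsP Y Z.
Proof. by rewrite /cartan_berwald nab_bt_eta rho_bt torsT0l sub0r. Qed.
Lemma berwaldD V W Y : berwald (V + W) Y = berwald V Y + berwald W Y.
Proof.
rewrite /berwald nabDl rhoD vflatDl -addrA; apply: eq_g => U.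
have hD A B : hflat (A + B) Y = hflat A Y + hflat B Y.
  by rewrite -!hflat_def btD brDl nabDl.
by rewrite hD !glin; ring.
Qed.
Lemma berwaldN V Y : berwald (- V) Y = - berwald V Y.
Proof. exact: (mapN_of_addr (fun V W => berwaldD V W Y)). Qed.
Lemma cartan_berwaldD V W Y :
  cartan_berwald (V + W) Y = cartan_berwald V Y + cartan_berwald W Y.
Proof.
by rewrite /cartan_berwald nabDl rhoD torsTDl torsPDl opprD addrACA.
Qed.

Lemma vcurv_torsT Y Z W U : g (curv (gam Y) (gam Z) W) U =
  g (torsT Z W) (torsT Y U) - g (torsT Y W) (torsT Z U).
Proof.
apply: eq2; rewrite (curv_skew_part (gam Y) (gam Z) nab_berwald cartan_berwald_sym).
have F0 B : curvD berwald (gam Y) (gam Z) B = 0.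
  rewrite /curvD !berwald_gam br_gam berwaldD berwaldN !berwald_gam.
  by rewrite vflat_curv vflatBl subrr.
by rewrite !F0 !g0l !cartan_berwald_gam; ring.
Qed.

(** The vertical part of the bracket of two horizontal lifts. As horizontal lifts annihilate [eta],
    it equals [curv (bt Y) (bt Z) eta]. *)
Definition Rhat Y Z := K (br (bt Y) (bt Z)).

Lemma br_bt Y Z :
  br (bt Y) (bt Z) = bt (nab (bt Y) Z - nab (bt Z) Y) + gam (Rhat Y Z).
Proof. by rewrite [LHS]split -nabQ. Qed.

(** The vertical part of the Jacobi identity for [bt Y], [bt Z] and [gam W]. The right side is minus
    the flat derivative of the tensor [Rhat] along [W]. *)
Lemma curvD_bt Y Z W : curvD berwald (bt Y) (bt Z) W =
  Rhat Y (vflat W Z) - Rhat Z (vflat W Y) - vflat W (Rhat Y Z).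
Proof.
have JK := congr1 (fun V => K V) (jacobi (bt Y) (bt Z) (gam W)).
rewrite br_bt br_bt_gam (br_bt_gam Y W) brB brB brDl br_gam !br_bt_gam in JK.
rewrite !(nabDl, nabNl) !K_gam !nab_bt_eta in JK.
rewrite -/(Rhat Y (vflat W Z)) -/(Rhat Z (vflat W Y)) in JK.
rewrite /curvD !berwald_bt br_bt berwaldD berwald_bt berwald_gam.
apply: eq_g => U; have := gE U JK; rewrite !glin => e1.
by apply: (lincomb e1); ring.
Qed.

(** * The curvature hypothesis and Schur's lemma *)

Variables (k : F) (H : G -> G -> F).
Hypothesis cancel_e : forall f, e * f = 0 -> f = 0.
Hypothesis cancel_k : forall f, k * f = 0 -> f = 0.
Hypothesis k_hom : act (gam eta) k = 0.
Hypothesis H_ind : forall Y, H Y eta = 0.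
(* Both hold because the fields orthogonal to eta span a space of dimension at
   least 2 at each point. *)
Hypothesis perp_parallel : forall alpha : G -> F,
  (forall Y Z, g Y eta = 0 -> g Z eta = 0 -> alpha Z *: Y = alpha Y *: Z) ->
  forall Z, g Z eta = 0 -> alpha Z = 0.
Hypothesis perp_cancel : forall f,
  (forall Y, g Y eta = 0 -> g Y Y * f = 0) -> f = 0.

(* The angular metric multiplied by e, and its Kulkarni-Nomizu product. *)
Definition angular Y Z := e * g Y Z - g Y eta * g Z eta.
Definition kulkarni (B : G -> G -> F) X' Y Z W :=
  B X' Z * angular Y W + angular X' Z * B Y W
  - B Y Z * angular X' W - angular Y Z * B X' W.

(** The h-curvature paired with [W] and multiplied by [e]: this clears the denominator of the
    angular metric, since [F] offers cancellation by [e] but no division. *)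
Hypothesis hcurvE : forall X' Y Z W,
  e * g (curv (bt X') (bt Y) Z) W =
  k * (e * (g X' Z * g Y W - g Y Z * g X' W) + kulkarni H X' Y Z W).

Lemma cancel_eE a b : e * a = e * b -> a = b.
Proof.
by move=> ab; apply/eqP; rewrite -subr_eq0; apply/eqP/cancel_e; rewrite mulrBr ab subrr.
Qed.

Lemma cancel_kE a b : k * a = k * b -> a = b.
Proof.
by move=> ab; apply/eqP; rewrite -subr_eq0; apply/eqP/cancel_k; rewrite mulrBr ab subrr.
Qed.

Lemma angular_eta Y : angular Y eta = 0.
Proof. by rewrite /angular eE; ring. Qed.

(** The angular metric and [H] both annihilate [eta], so only the constant curvature term survives
    when the third argument is [eta]. *)
Lemma RhatE Y Z : Rhat Y Z = k *: (g Y eta *: Z - g Z eta *: Y).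
Proof.
apply: eq_g => W; apply: cancel_eE.
have := hcurvE Y Z eta W; rewrite /kulkarni !angular_eta !H_ind.
rewrite /curv !nab_bt_eta !nab0 oppr0 !add0r -/(Rhat Y Z) => ->.
by rewrite !glin; ring.
Qed.

Lemma curvD_btE Y Z W : curvD berwald (bt Y) (bt Z) W =
  - (act (gam W) k *: (g Y eta *: Z - g Z eta *: Y)
     + k *: (g Y W *: Z - g Z W *: Y)).
Proof.
rewrite curvD_bt !RhatE vflatZ vflatB !vflatZ.
have E A : act (gam W) (g A eta) = g A W + g (vflat W A) eta.
  by rewrite gC act_gam_g_eta [g W _]gC [g eta _]gC.
by rewrite !E; apply: eq_g => U; rewrite !glin; ring.
Qed.

Lemma berwald_torsion V W :
  berwald V (rho W) - berwald W (rho V) = rho (br V W).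
Proof.
rewrite {3}[V]split {3}[W]split brD !brDl !rhoD -nabQ br_bt_gam br_gam_bt br_gam.
rewrite !rhoB !rho_gam !rho_bt /berwald.
have hC := hflatC (rho V) (rho W).
apply: eq_g => U; have := gE U hC; rewrite !glin => e1.
by apply: (lincomb e1); ring.
Qed.

Lemma berwaldB V Y Z : berwald V (Y - Z) = berwald V Y - berwald V Z.
Proof.
have hD A B C : hflat A (B + C) = hflat A B + hflat A C.
  by rewrite -!hflat_def gamD brD nabDl.
rewrite /berwald vflatB (mapB_of_addr (hD _)).
by apply: eq_g => U; rewrite !glin; ring.
Qed.

(** The first Bianchi identity: [berwald] is torsion-free by [berwald_torsion], so the projected
    Jacobi identity expands into its curvature. *)
Lemma bianchi U V W :
  curvD berwald U V (rho W) + curvD berwald V W (rho U)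
  + curvD berwald W U (rho V) = 0.
Proof.
have J := congr1 rho (jacobi U V W).
have E A B : rho (br A B) = berwald A (rho B) - berwald B (rho A).
  by rewrite berwald_torsion.
rewrite rhoD (E U (br V W)) (E (br U V) W) (E V (br U W)) !E !berwaldB in J.
rewrite /curvD (brC W U) berwaldN.
apply: eq_g => Q; have := gE Q J; rewrite !glin => e1.
by apply: (lincomb e1); ring.
Qed.

(* The orthogonal projection, up to the factor e. *)
Lemma perp_proj Y : g (e *: Y - g Y eta *: eta) eta = 0.
Proof. by rewrite !glin eE; ring. Qed.

(** In the Bianchi identity for [eta] and two fields [Y], [Z] orthogonal to it, the terms in [k]
    itself cancel and the vertical derivatives of [k] along [Y] and [Z] make these fields
    proportional, hence vanish. Homogeneity settles the direction [eta]. *)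
Lemma act_gam_k Y : act (gam Y) k = 0.
Proof.
have perp Z : g Z eta = 0 -> act (gam Z) k = 0.
  apply: (@perp_parallel (fun B => act (gam B) k)) => {}Y {}Z Y0 Z0.
  have := bianchi (bt eta) (bt Y) (bt Z); rewrite !rho_bt !curvD_btE k_hom Y0 Z0 eE.
  move=> B; apply: eq_g => W; apply: cancel_eE; have := gE W B.
  rewrite !glin [g eta Y]gC [g eta Z]gC Y0 Z0 [g Z Y]gC => e1.
  by apply: (lincomb (esym e1)); ring.
apply: cancel_e; have := perp _ (perp_proj Y).
rewrite gamB !gamZ actBl !actZl k_hom => e1.
by apply: (lincomb e1); ring.
Qed.

(** The second Bianchi identity, as the vertical part of the Jacobi identity for three horizontal
    lifts; the [torsP] terms cancel by symmetry. *)
Lemma schur_bt Y Z W :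
  act (bt Y) k *: (g Z eta *: W - g W eta *: Z)
  + act (bt Z) k *: (g W eta *: Y - g Y eta *: W)
  + act (bt W) k *: (g Y eta *: Z - g Z eta *: Y) = 0.
Proof.
have JK := congr1 (fun V => K V) (jacobi (bt Y) (bt Z) (bt W)).
rewrite !br_bt !brD brDl (brC (gam _)) in JK.
rewrite !br_bt !br_bt_gam !(nabDl, nabNl) !K_gam !nab_bt_eta !RhatE in JK.
rewrite !hflatE !(nabZ, nabB) !torsPZ !torsPB !torsPZ in JK.
have aE A B : act (bt A) (g B eta) = g (nab (bt A) B) eta.
  by rewrite nabg nab_bt_eta g0 addr0.
rewrite !aE (torsPC Z Y) (torsPC W Y) (torsPC W Z) in JK.
apply: eq_g => U; have := gE U JK; rewrite !glin => e1.
by apply: (lincomb e1); ring.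
Qed.

Lemma act_perp_bt_k Y : g Y eta = 0 -> act (bt Y) k = 0.
Proof.
apply: (@perp_parallel (fun B => act (bt B) k)) => {}Y Z Y0 Z0.
have := schur_bt Y Z eta; rewrite Y0 Z0 eE => E.
apply: eq_g => W; apply: cancel_eE; have := gE W E; rewrite !glin => e1.
by apply: (lincomb e1); ring.
Qed.

(** For [Y] orthogonal to [eta], both [gam Y] and [bt Y] annihilate [k], hence so does their
    bracket, whose horizontal part is the lift of [vflat Y Y]. Differentiating [g eta Y = 0] shows
    that this field has the inner product [- g Y Y] with [eta], so [g Y Y] times the derivative
    along [S] vanishes. *)
Lemma act_S_k : act S k = 0.
Proof.
apply: perp_cancel => Y Y0.
have e1 := br_act (gam Y) (bt Y) k.
rewrite br_gam_bt actBl !act_gam_k (act_perp_bt_k Y0) !act0 !subr0 in e1.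
have := act_perp_bt_k (perp_proj (vflat Y Y)).
rewrite btB !btZ actBl !actZl e1 mulr0 sub0r => e2.
have e3 := act_gam_g_eta Y Y; rewrite gC Y0 act0 in e3.
rewrite gC in e2; have -> : g Y Y = - g eta (vflat Y Y).
  by apply: (lincomb (esym e3)); ring.
by apply: (lincomb e2); ring.
Qed.

(** In [curv_sym_part] for [S] and [bt Y] the right side vanishes: once [k] is vertically constant,
    the Berwald curvature has the skew form of constant curvature. The term in [k * e] comes from
    the vertical part [Rhat eta Y = k *: (e *: Y - g Y eta *: eta)] of the bracket, on which
    [cartan_berwald] is [torsT]. *)
Lemma nab_S_torsP Y Z :
  nab S (torsP Y Z) = torsP (nab S Y) Z + torsP Y (nab S Z) - (k * e) *: torsT Y Z.
Proof.
apply: eq_g => W; apply: eq2.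
have E := curv_sym_part S (bt Y) nab_berwald cartan_berwald_sym Z W.
rewrite !curvD_btE /derA br_bt !cartan_berwaldD nab_bt_eta subr0 in E.
rewrite !cartan_berwald_bt cartan_berwald_gam !berwald_bt !hflat_eta in E.
rewrite torsP_eta_l RhatE eE !torsP_eta_l in E.
have e1 := nabg S (torsP Y Z) W.
rewrite !torsTZl (mapB_of_addr (fun A B => torsTDl A B Z)) !torsTZl torsT_eta_l in E.
rewrite !glin oppr0 act0 actN nabg !act_gam_k in E; rewrite !glin.
by apply: (lincomb (esym E)); ring.
Qed.

(** * Differentiation of the curvature identity along the spray *)

Lemma act_S_e : act S e = 0. Proof. exact: act_bt_e. Qed.

Definition derS (B : G -> G -> F) Y Z :=
  act S (B Y Z) - B (nab S Y) Z - B Y (nab S Z).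

Lemma hcurv_torsP X' Y Z W : k * kulkarni H X' Y Z W =
  e * (g (torsP Y Z) (torsP X' W) - g (torsP X' Z) (torsP Y W)).
Proof.
have := curv_skew_part (bt X') (bt Y) nab_berwald cartan_berwald_sym Z W.
have := hcurvE X' Y Z W; set c := g (curv _ _ _) _ => h E.
rewrite !curvD_btE !act_gam_k !cartan_berwald_bt !glin in E.
apply: eq2.
apply: (lincomb (addE (congr1 ( *%R 2) (esym h)) (congr1 ( *%R e) E))).
by ring.
Qed.

(** The polarisation, at [torsT] and [torsP], of the quadratic expression on the right of
    [hcurv_torsP]. It arises from differentiating that expression along [S], as the derivative of
    [torsP] is a multiple of [torsT]. *)
Definition mixed X' Y Z W :=
  g (torsT Y Z) (torsP X' W) + g (torsP Y Z) (torsT X' W)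
  - (g (torsT X' Z) (torsP Y W) + g (torsP X' Z) (torsT Y W)).

Lemma derS_kulkarni (B : G -> G -> F) X' Y Z W :
  act S (kulkarni B X' Y Z W) =
  kulkarni (derS B) X' Y Z W + kulkarni B (nab S X') Y Z W
  + kulkarni B X' (nab S Y) Z W + kulkarni B X' Y (nab S Z) W
  + kulkarni B X' Y Z (nab S W).
Proof.
have aE A C : act S (angular A C) = angular (nab S A) C + angular A (nab S C).
  rewrite /angular actB !actM act_S_e !(nabg S) nab_bt_eta !g0 mul0r.
  by ring.
rewrite /kulkarni /derS !(actB, actD, actN) !actM !aE.
by ring.
Qed.

Lemma derS_hcurv X' Y Z W :
  k * kulkarni (derS H) X' Y Z W = - (k * e * e) * mixed X' Y Z W.
Proof.
have e0 := congr1 (act S) (hcurv_torsP X' Y Z W).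
rewrite !actM act_S_k act_S_e derS_kulkarni actB !(nabg S) !nab_S_torsP !glin in e0.
(* The identity with one argument replaced by its derivative removes the terms by which [act S]
   differs from covariant differentiation. *)
have e1 := hcurv_torsP (nab S X') Y Z W; have e2 := hcurv_torsP X' (nab S Y) Z W.
have e3 := hcurv_torsP X' Y (nab S Z) W; have e4 := hcurv_torsP X' Y Z (nab S W).
rewrite /mixed.
apply: (lincomb (addE e0 (esym (addE (addE e1 e2) (addE e3 e4))))).
by ring.
Qed.

Lemma derS2_hcurv X' Y Z W :
  k * kulkarni (derS (derS H)) X' Y Z W = - (k * e * e) *
    (2 * (g (torsP Y Z) (torsP X' W) - g (torsP X' Z) (torsP Y W))
     - 2 * k * e * (g (torsT Y Z) (torsT X' W) - g (torsT X' Z) (torsT Y W))).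
Proof.
have e0 := congr1 (act S) (derS_hcurv X' Y Z W).
rewrite !actM actN !actM act_S_k act_S_e derS_kulkarni in e0.
have mE : act S (mixed X' Y Z W) = mixed (nab S X') Y Z W + mixed X' (nab S Y) Z W
  + mixed X' Y (nab S Z) W + mixed X' Y Z (nab S W)
  + (2 * (g (torsP Y Z) (torsP X' W) - g (torsP X' Z) (torsP Y W))
     - 2 * k * e * (g (torsT Y Z) (torsT X' W) - g (torsT X' Z) (torsT Y W))).
  rewrite /mixed !(actB, actD, actN) !(nabg S) !nab_S_torsP !nab_S_torsT !glin.
  by ring.
rewrite mE in e0.
have e1 := derS_hcurv (nab S X') Y Z W; have e2 := derS_hcurv X' (nab S Y) Z W.
have e3 := derS_hcurv X' Y (nab S Z) W; have e4 := derS_hcurv X' Y Z (nab S W).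
apply: (lincomb (addE e0 (esym (addE (addE e1 e2) (addE e3 e4))))).
by ring.
Qed.

Theorem vcurv_kulkarni X' Y Z W :
  2 * k * e * e * e * g (curv (gam X') (gam Y) Z) W =
  2 * k * e * kulkarni H X' Y Z W + kulkarni (derS (derS H)) X' Y Z W.
Proof.
apply: cancel_kE; rewrite vcurv_torsT.
have E2 := derS2_hcurv X' Y Z W.
(* With the factor [2 * k * e] the terms quadratic in [torsP] cancel, and those quadratic in [torsT]
   remain. *)
have E := congr1 ( *%R (2 * k * e)) (hcurv_torsP X' Y Z W).
by apply: (lincomb (esym (addE E E2))); ring.
Qed.

End CartanAlgebra.

(** * Modules of fields *)

(* Fields on the slit bundle are taken to vanish off the slit bundle, so that they
   form honest modules over the ring of functions. *)
Record field_class (R : realType) (n : nat) (M : topologicalType) (A : atlas R n M)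
    (W : lmodType R) := FieldClass {
  in_class :> (TM R n M -> W) -> Prop;
  class_ext : forall f g, (forall u, slit u -> f u = g u) -> in_class f -> in_class g;
  class0 : in_class (fun=> 0);
  classD : forall f g, in_class f -> in_class g -> in_class (fun u => f u + g u);
  classZ : forall a f, smooth_fn A a -> in_class f -> in_class (fun u => a u *: f u)
}.

Record field (R : realType) (n : nat) (M : topologicalType) (A : atlas R n M)
    (W : lmodType R) (C : field_class A W) := Field {
  field_fun :> TM R n M -> W;
  field_in : C field_fun;
  field_off : forall u, u.2 = 0 -> field_fun u = 0
}.

HB.instance Definition _ R n M A W C := gen_eqMixin (@field R n M A W C).
HB.instance Definition _ R n M A W C := gen_choiceMixin (@field R n M A W C).

Section Fields.
Context (R : realType) (n : nat) (M : topologicalType) (A : atlas R n M).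
Context (W : lmodType R) (C : field_class A W).
Implicit Types (X Y Z : field C).

Lemma field_eq X Y : (forall u, slit u -> X u = Y u) -> X = Y.
Proof.
move=> XY; have : field_fun X = field_fun Y.
  apply/funext => u; case: (eqVneq u.2 0) => [u0|]; last exact: XY.
  by rewrite !field_off.
case: X Y {XY} => [X Xc X0] [Y Yc Y0] /= XY; subst Y.
by congr Field; exact: Prop_irrelevance.
Qed.

Definition cut_fun (f : TM R n M -> W) u := if u.2 == 0 then 0 else f u.

Lemma cut_funE f u : slit u -> cut_fun f u = f u.
Proof. by rewrite /cut_fun /slit /= => /negbTE ->. Qed.

Lemma cut_subproof f : C f -> C (cut_fun f).
Proof. by apply: class_ext => u u0; rewrite cut_funE. Qed.

Lemma cut_off f u : u.2 = 0 -> cut_fun f u = 0.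
Proof. by rewrite /cut_fun => ->; rewrite eqxx. Qed.

Fact cut_subproof2 f (fC : C f) : {X : field C | forall u, slit u -> X u = f u}.
Proof. by exists (Field (cut_subproof fC) (@cut_off f)) => u; exact: cut_funE. Qed.

(* Opaque, to prevent the unifier from unfolding derivatives. *)
Definition cut f (fC : C f) : field C := sval (cut_subproof2 fC).

Lemma cutE f (fC : C f) u : slit u -> cut fC u = f u.
Proof. exact: (svalP (cut_subproof2 fC)). Qed.

Definition field0 : field C := cut (class0 C).
Definition fieldD X Y : field C := cut (classD (field_in X) (field_in Y)).
Definition fieldZ a (as_ : smooth_fn A a) X : field C := cut (classZ as_ (field_in X)).
Definition fieldN X : field C := fieldZ (@smooth_fn_cst R n M A (-1)) X.

Lemma fieldDA : associative fieldD.
Proof. by move=> X Y Z; apply: field_eq => u u0; rewrite !cutE // addrA. Qed.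
Lemma fieldDC : commutative fieldD.
Proof. by move=> X Y; apply: field_eq => u u0; rewrite !cutE // addrC. Qed.
Lemma field0D : left_id field0 fieldD.
Proof. by move=> X; apply: field_eq => u u0; rewrite !cutE // add0r. Qed.
Lemma fieldND : left_inverse field0 fieldN fieldD.
Proof. by move=> X; apply: field_eq => u u0; rewrite !cutE // scaleN1r addNr. Qed.

End Fields.

HB.instance Definition _ R n M A W C := GRing.isZmodule.Build (@field R n M A W C)
  (@fieldDA R n M A W C) (@fieldDC R n M A W C) (@field0D R n M A W C)
  (@fieldND R n M A W C).

Section Evaluation.
Context (R : realType) (n : nat) (M : topologicalType) (A : atlas R n M).
Context (W : lmodType R) (C : field_class A W).
Implicit Types (X Y Z : field C).

Lemma slit_cases (u : TM R n M) : slit u \/ u.2 = 0.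
Proof. by case: (eqVneq u.2 0) => [|u0]; [right|left]. Qed.

Lemma ev0 u : (0 : field C) u = 0.
Proof. by have [u0|u0] := slit_cases u; [exact: cutE|exact: field_off]. Qed.
Lemma evD X Y u : (X + Y) u = X u + Y u.
Proof.
have [u0|u0] := slit_cases u; first exact: cutE.
by rewrite !(field_off _ u0) addr0.
Qed.
Lemma evN X u : (- X) u = - X u.
Proof.
have [u0|u0] := slit_cases u; last by rewrite !(field_off _ u0) oppr0.
by apply: etrans (cutE _ u0) _; rewrite scaleN1r.
Qed.
End Evaluation.

Section Modules.
Context (R : realType) (n : nat) (M : topologicalType) (A : atlas R n M).
Context (hM : smooth_manifold A).

Definition fn_class : field_class A R^o := @FieldClass R n M A R^o (smooth_fn A)
  (@smooth_fn_ext _ _ _ _ hM) (@smooth_fn_cst _ _ _ A 0) (@smooth_fnD _ _ _ A)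
  (@smooth_fnM _ _ _ A).
Definition pfield_class : field_class A 'rV[R]_n := @FieldClass R n M A _ (smooth_pfield A)
  (@smooth_pfield_ext _ _ _ _ hM) (smooth_pfield0 hM) (@smooth_pfieldD _ _ _ _ hM)
  (@smooth_pfieldZ _ _ _ _ hM).
Definition vfield_class : field_class A 'rV[R]_(n + n) :=
  @FieldClass R n M A _ (smooth_vfield A)
  (@smooth_vfield_ext _ _ _ _ hM) (smooth_vfield0 hM) (@smooth_vfieldD _ _ _ _ hM)
  (@smooth_vfieldZ _ _ _ _ hM).

Definition fns := field fn_class.
HB.instance Definition _ := GRing.Zmodule.on fns.

Implicit Types f h : fns.
Lemma evDf f h u : (f + h) u = f u + h u.
Proof. exact: (@evD _ _ _ _ _ fn_class f h u). Qed.
Lemma evNf f u : (- f) u = - f u.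
Proof. exact: (@evN _ _ _ _ _ fn_class f u). Qed.
Definition fn1 : fns := @cut _ _ _ _ _ fn_class _ (@smooth_fn_cst R n M A 1).
Definition fnM f h : fns := @cut _ _ _ _ _ fn_class _ (smooth_fnM (field_in f)
  (field_in h)).

Lemma evfnM f h u : fnM f h u = f u * h u.
Proof.
have [u0|u0] := slit_cases u; first exact: cutE.
by rewrite !(field_off _ u0) mul0r.
Qed.
Lemma fnMA : associative fnM.
Proof. by move=> f g h; apply: field_eq => u u0; rewrite !evfnM mulrA. Qed.
Lemma fnMC : commutative fnM.
Proof. by move=> f g; apply: field_eq => u u0; rewrite !evfnM mulrC. Qed.
Lemma fn1M : left_id fn1 fnM.
Proof. by move=> f; apply: field_eq => u u0; rewrite evfnM cutE // mul1r. Qed.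
Lemma fnMDl : left_distributive fnM +%R.
Proof. by move=> f g h; apply: field_eq => u u0; rewrite evDf !evfnM evDf mulrDl. Qed.
HB.instance Definition _ := GRing.Zmodule_isComPzRing.Build fns fnMA fnMC fn1M fnMDl.

Lemma ev1 u : slit u -> (1 : fns) u = 1. Proof. exact: cutE. Qed.
Lemma evM f h u : (f * h) u = f u * h u.
Proof. exact: evfnM. Qed.

Section Lmod.
Context (W : lmodType R) (C : field_class A W).
Implicit Types X Y : field C.

Definition fieldS f X : field C := fieldZ (field_in f) X.
Lemma evS f X u : fieldS f X u = f u *: X u.
Proof.
have [u0|u0] := slit_cases u; first exact: cutE.
by rewrite !(field_off _ u0) scaler0.
Qed.
Lemma fieldSA f h X : fieldS f (fieldS h X) = fieldS (f * h) X.
Proof. by apply: field_eq => u u0; rewrite !evS evM scalerA. Qed.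
Lemma field1S : left_id 1 fieldS.
Proof. by move=> X; apply: field_eq => u u0; rewrite evS ev1 // scale1r. Qed.
Lemma fieldSDr : right_distributive fieldS +%R.
Proof. by move=> f X Y; apply: field_eq => u u0; rewrite evD !evS evD scalerDr. Qed.
Lemma fieldSDl X : {morph fieldS^~ X : f h / f + h}.
Proof. by move=> f h; apply: field_eq => u u0; rewrite evD !evS evDf scalerDl. Qed.
End Lmod.

Definition pfs := field pfield_class.
Definition vfs := field vfield_class.
HB.instance Definition _ := GRing.Zmodule.on pfs.
HB.instance Definition _ := GRing.Zmodule.on vfs.
HB.instance Definition _ := GRing.Zmodule_isLmodule.Build fns pfs
  (@fieldSA _ pfield_class) (@field1S _ pfield_class) (@fieldSDr _ pfield_class)
  (@fieldSDl _ pfield_class).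
HB.instance Definition _ := GRing.Zmodule_isLmodule.Build fns vfs
  (@fieldSA _ vfield_class) (@field1S _ vfield_class) (@fieldSDr _ vfield_class)
  (@fieldSDl _ vfield_class).

Lemma evZ f (X : pfs) u : (f *: X) u = f u *: X u. Proof. exact: evS. Qed.
Lemma evZv f (V : vfs) u : (f *: V) u = f u *: V u. Proof. exact: evS. Qed.
End Modules.

(** * The Finsler metric *)

Section Metric.
Context (R : realType) (n : nat) (M : topologicalType) (A : atlas R n M).
Hypothesis hM : smooth_manifold A.
Notation TM := (TM R n M).
Notation pfield := (TM -> 'rV[R]_n).
Implicit Types (u : TM) (v w z : 'rV[R]_n) (X Y Z : pfield) (a : R).
Variable L : TM -> R.
Hypothesis hL : finsler_function A L.
Local Notation g := (metric L).

Definition sqL u : R := L u ^+ 2.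

Lemma smooth_sqL : smooth_fn A sqL.
Proof.
have [Ls _ _ _] := hL; apply: (smooth_fn_ext hM _ (smooth_fnM Ls Ls)) => u _.
by rewrite /sqL expr2.
Qed.

Lemma sqL_fibre u : slit u -> smooth_germ (fun y => sqL (u.1, y)) u.2.
Proof. by move=> u0; exact: (smooth_fibre hM (tame_real R) (smooth_sqL u0)). Qed.

Let two0 : (2 : R) != 0. Proof. by rewrite pnatr_eq0. Qed.

Lemma metricE u v w :
  2 * g u v w = 'D_v ('D_w (fun y => sqL (u.1, y))) u.2.
Proof. by rewrite /metric mulrA mulfV ?pnatr_eq0 // mul1r. Qed.

#[local] Opaque metric.

Lemma sqL_gt0 u : slit u -> 0 < sqL u.
Proof. by have [_ Lp _ _] := hL; move=> /Lp; rewrite /sqL => Lu; exact: exprn_gt0. Qed.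

Lemma metricC u v w : slit u -> g u v w = g u w v.
Proof.
move=> /sqL_fibre [U [oU Uu fU]].
have E := schwarz v w oU Uu (fU 2%N).
exact: (mulfI two0 (etrans (metricE u v w) (etrans E (esym (metricE u w v))))).
Qed.

Lemma metric_linear u a v w z : slit u ->
  g u (a *: v + w) z = a * g u v z + g u w z.
Proof.
move=> /sqL_fibre /(smooth_germ_derive z) /smooth_germ_differentiable fd.
have [D E] : exists D : {linear 'rV[R]_n -> R^o}, forall x, 2 * g u x z = D x.
  by eexists => x; apply: etrans (metricE u x z) _; exact: (deriveE x fd).
have lin (m : 'rV[R]_n -> R) : (forall x, 2 * m x = D x) ->
    m (a *: v + w) = a * m v + m w.
  move=> mD; apply: (mulfI two0); rewrite mulrDr mulrCA !mD.
  exact: linearP.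
exact: (lin (fun x => g u x z) E).
Qed.

Lemma metric0l u z : slit u -> g u 0 z = 0.
Proof.
move=> u0; have := metric_linear 1 0 0 z u0; rewrite scaler0 addr0 mul1r.
by move/eqP; rewrite -subr_eq0 opprD addNKr oppr_eq0 => /eqP.
Qed.

Lemma metricZl u a v z : slit u -> g u (a *: v) z = a * g u v z.
Proof. by move=> u0; have := metric_linear a v 0 z u0; rewrite metric0l // !addr0. Qed.

Lemma metricDl u v w z : slit u -> g u (v + w) z = g u v z + g u w z.
Proof. by move=> u0; have := metric_linear 1 v w z u0; rewrite scale1r mul1r. Qed.

Lemma metricNl u v z : slit u -> g u (- v) z = - g u v z.
Proof. by move=> u0; rewrite -scaleN1r metricZl // mulN1r. Qed.

Lemma metricZr u a v z : slit u -> g u z (a *: v) = a * g u z v.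
Proof.
move=> u0; apply: etrans (metricC _ _ u0) _; apply: etrans (metricZl _ _ _ u0) _.
by rewrite (metricC v z u0).
Qed.

Lemma metricDr u v w z : slit u -> g u z (v + w) = g u z v + g u z w.
Proof.
move=> u0; apply: etrans (metricC _ _ u0) _; apply: etrans (metricDl _ _ _ u0) _.
by rewrite (metricC v z u0) (metricC w z u0).
Qed.

Lemma metric_suml u (I : Type) (r : seq I) (F : I -> 'rV[R]_n) z : slit u ->
  g u (\sum_(l <- r) F l) z = \sum_(l <- r) g u (F l) z.
Proof.
move=> u0; apply: (big_morph (fun v => g u v z)); last exact: metric0l.
by move=> v w; exact: metricDl.
Qed.

Lemma metric_inj u v : slit u -> (forall w, g u v w = 0) -> v = 0.
Proof.
move=> u0 gv; have [_ _ _ gp] := hL; apply/eqP; apply: contraT => /(gp u u0 v).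
by rewrite gv ltxx.
Qed.

Lemma metric_eq u v w : slit u -> (forall z, g u v z = g u w z) -> v = w.
Proof.
move=> u0 vw; apply/eqP; rewrite -subr_eq0; apply/eqP/(metric_inj u0) => z.
by rewrite metricDl // metricNl // vw subrr.
Qed.

Lemma metric_riesz u (l : 'rV[R]_n -> R) : slit u ->
  (forall a v w, l (a *: v + w) = a * l v + l w) ->
  exists v, forall w, g u v w = l w.
Proof.
move=> u0 ll.
have l0 : l 0 = 0.
  have := ll 1 0 0; rewrite scaler0 addr0 mul1r.
  by move/eqP; rewrite -subr_eq0 opprD addNKr oppr_eq0 => /eqP.
pose G : 'M[R]_n := \matrix_(i, j) g u (delta_mx ord0 i) (delta_mx ord0 j).
have gG v j : g u v (delta_mx ord0 j) = (v *m G) ord0 j.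
  rewrite {1}[v]row_sum_delta metric_suml // mxE; apply: eq_bigr => i _.
  by rewrite metricZl // !mxE.
have sum_l (f : 'rV[R]_n -> R) w : (forall a x y, f (a *: x + y) = a * f x + f y) ->
    f 0 = 0 -> f w = \sum_j w ord0 j * f (delta_mx ord0 j).
  move=> fl f0; rewrite {1}[w]row_sum_delta (big_morph f (op1 := +%R) (id1 := 0)) //.
    by apply: eq_bigr => j _; have := fl (w ord0 j) (delta_mx ord0 j) 0; rewrite f0 !addr0.
  by move=> x y; have := fl 1 x y; rewrite scale1r mul1r.
have gsum v w : g u v w = \sum_j w ord0 j * (v *m G) ord0 j.
  rewrite (sum_l (g u v)) => [|a x y|]; first by apply: eq_bigr => j _; rewrite gG.
    by rewrite metricDr // metricZr.
  by rewrite metricC // metric0l.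
have Gu : G \in unitmx.
  rewrite -row_free_unit -kermx_eq0; apply/eqP/row_matrixP => r.
  rewrite row0; apply: (metric_inj u0) => w; rewrite gsum big1 // => j _.
  by rewrite -row_mul mulmx_ker row0 mxE mulr0.
exists ((\row_j l (delta_mx ord0 j)) *m invmx G) => w.
rewrite gsum (sum_l l) //; apply: eq_bigr => j _.
by rewrite -mulmxA mulVmx // mulmx1 mxE.
Qed.

(** [sharp] is a choice with default 0. [metric_riesz] provides existence, and since every vector at
    [u] is the value of a smooth field, testing against fields determines the vector. Linearity of
    [b X] is needed at [u] only, through [l]. *)
Lemma sharpE (b : pfield -> pfield -> TM -> R) X u (l : 'rV[R]_n -> R) w : slit u ->
  (forall a v w, l (a *: v + w) = a * l v + l w) ->
  (forall Y, smooth_pfield A Y -> b X Y u = l (Y u)) ->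
  g u (sharp A L b X u) w = l w.
Proof.
move=> u0 ll bl; have [v gv] := metric_riesz u0 ll.
have H : forall Y, smooth_pfield A Y -> g u (sharp A L b X u) (Y u) = b X Y u.
  apply: (@xgetPex _ 0 [set v | forall Y, smooth_pfield A Y -> g u v (Y u) = b X Y u]).
  by exists v => Y Ys; rewrite gv bl.
by have [Y Ys <-] := pfield_at hM w u0; rewrite H // bl.
Qed.

(** In [metric] both directions are frozen. Differentiating the derivative along the field [Z] also
    differentiates [Z] itself, and the last term removes this contribution. *)
Lemma metric_hessian Y Z u : smooth_pfield A Z -> slit u ->
  2 * g u (Y u) (Z u) =
  vact A u (gammaf A Y u) (fun v : TM => vact A v (gammaf A Z v) sqL)
  - vact A u (gammaf A (fibre_derive Y Z) u) sqL.
Proof.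
move=> Zs u0; apply: etrans (metricE _ _ _) _.
have E := derive_derive (Y u) (sqL_fibre u0) (smooth_pfield_fibre hM Zs u0).
have [U [oU Uu fU]] := sqL_fibre u0.
have E1 := vact_gamma hM Y (fun v : TM => vact A v (gammaf A Z v) sqL) u.
have E2 := vact_gamma hM (fibre_derive Y Z) sqL u.
have E3 : (fun y => vact A ((u.1, y) : TM) (gammaf A Z (u.1, y)) sqL) =
    (fun y => 'D_(Z (u.1, y)) (fun y => sqL (u.1, y)) y).
  by apply/funext => y; exact: (vact_gamma hM Z sqL (u.1, y)).
apply: etrans (esym (f_equal2 (fun a b => a - b) (etrans E1 _) E2)); last first.
  apply: etrans (congr1 (fun f => 'D_(Y u) f u.2) E3) E.
have E4 : Z u = Z (u.1, u.2) by rewrite -surjective_pairing.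
rewrite (schwarz (Y u) (Z u) oU Uu (fU 2%N)) E4 /fibre_derive addrAC subrr add0r.
exact: erefl.
Qed.

Lemma vact_eta_sqL u : slit u ->
  vact A u (gammaf A (@eta R n M) u) sqL = 2 * sqL u.
Proof.
move=> u0; rewrite (vact_gamma hM) /eta.
set f := fun y => sqL (u.1, y).
have fd : derivable f u.2 u.2.
  by apply: diff_derivable; exact: smooth_germ_differentiable (sqL_fibre u0).
have [_ D0] := (is_derive_line0 f u.2 u.2 _).1 (derivableP fd).
rewrite -D0.
pose h (t : R) := (1 + t) * (1 + t) * sqL u.
have hd : is_derive (0:R) (1:R) h (2 * sqL u).
  have d1 := is_deriveD (is_derive_cst (1:R) (0:R) (1:R)) (is_derive_id (0:R) (1:R)).
  have := is_deriveM (is_deriveM d1 d1) (is_derive_cst (sqL u) (0:R) (1:R)).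
  move=> H; apply: (is_derive_eq H).
  rewrite scaler0 add0r add0r /GRing.scale /=. 
  have -> : (cst (1:R) + id) 0 = 1 by rewrite -[RHS]addr0.
  ring.
have [_ <-] := hd; apply: near_eq_derive.
(* Homogeneity of [L] is available for the positive factors [1 + t] only. *)
have t1 : \forall t \near (0:R), - 1 < t.
  apply/nbhs_ballP; exists 1 => //= t; rewrite -ball_normE /= sub0r normrN.
  by rewrite ltr_norml => /andP[].
apply: near_mono t1 => t t1.
have [_ _ Lh _] := hL.
have tp : 0 < 1 + t by rewrite -ltrBlDl sub0r.
rewrite /f /h /sqL (_ : t *: u.2 + u.2 = (1 + t) *: u.2).
  by rewrite Lh // exprMn -surjective_pairing.
by rewrite scalerDl scale1r addrC.
Qed.
End Metric.

(** * The Cartan connection as an algebraic structure *)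

Section Instance.
Context (R : realType) (n : nat) (M : topologicalType) (A : atlas R n M).
Context (hM : smooth_manifold A) (L : TM R n M -> R) (hL : finsler_function A L).
Notation TM := (TM R n M).
Notation B := (slit_atlas A).
Notation pfield := (TM -> 'rV[R]_n).
Notation vfield := (TM -> 'rV[R]_(n + n)).
Variable nabla : TM -> 'rV[R]_(n + n) -> pfield -> 'rV[R]_n.
Hypothesis hC : cartan_connection A nabla L.
Notation F := (fns hM).
Notation G := (pfs hM).
Notation X := (vfs hM).
Implicit Types (u : TM) (f h : F) (Y Z : G) (U V W : X).

Let hn : connection A nabla. Proof. by case: hC. Qed.
Let hr : regular A nabla. Proof. by case: hC. Qed.
Let hB := slit_smooth_atlas hM.
Let tR := tame_real R.
Let sd := slit_dom hM.
#[local] Opaque metric.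

Lemma bracket_slit_ext (U V V' : vfield) u : slit u ->
  (forall v, slit v -> V v = V' v) -> bracket B U V u = bracket B U V' u.
Proof.
move=> u0 VV; apply: (bracket_ext hB _ (sd u0)).
exact: (near_slit_forall hM (P := fun v => V v = V' v) u0 VV).
Qed.

Lemma bracket_slit_extl (U V V' : vfield) u : slit u ->
  (forall v, slit v -> V v = V' v) -> bracket B V U u = bracket B V' U u.
Proof.
move=> u0 VV; rewrite (bracketC B u V) (bracketC B u V').
by rewrite (bracket_slit_ext _ u0 VV).
Qed.

Lemma fibre_derive_slit_ext (Y Z Z' : pfield) u : slit u ->
  (forall v, slit v -> Z v = Z' v) -> fibre_derive Y Z u = fibre_derive Y Z' u.
Proof.
move=> u0 ZZ; rewrite /fibre_derive.
apply: etrans (esym (vact_fibre hM u (Y u) Z)) _.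
apply: etrans (vact_fibre hM u (Y u) Z').
exact: dact_slit_ext.
Qed.

Lemma rhof_betaf (Z : pfield) u : slit u -> rhof A (betaf A nabla Z) u = Z u.
Proof. by move=> u0; exact: (beta_spec hM hr _ u0).2. Qed.

Lemma smooth_cov (V : vfield) (Y : pfield) : smooth_vfield A V -> smooth_pfield A Y ->
  smooth_pfield A (cov nabla V Y).
Proof. by move=> Vs Ys; have [_ _ _] := hn; apply. Qed.

Let smooth_bt (Y : pfield) : smooth_pfield A Y -> smooth_vfield A (betaf A nabla Y) :=
  smooth_betaf hM hn hr (X := Y).

Lemma rho_bracket_gamma_beta (Y Z : pfield) u : smooth_pfield A Y -> smooth_pfield A Z ->
  slit u -> rho A u (bracket B (gammaf A Y) (betaf A nabla Z) u) = fibre_derive Y Z u.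
Proof.
move=> Ys Zs u0; rewrite (rho_bracket_gamma hM Ys (smooth_bt Zs) u0).
by apply: fibre_derive_slit_ext => // v v0; exact: rhof_betaf.
Qed.

Lemma smooth_fibre_derive (Y Z : pfield) : smooth_pfield A Y -> smooth_pfield A Z ->
  smooth_pfield A (fibre_derive Y Z).
Proof.
move=> Ys Zs; have bs := smooth_bracket_vfield hM (smooth_gammaf hM Ys) (smooth_bt Zs).
apply: (smooth_pfield_ext hM _ (smooth_rhof hM bs)) => u u0.
exact: rho_bracket_gamma_beta.
Qed.

Lemma smooth_metric (Y Z : pfield) : smooth_pfield A Y -> smooth_pfield A Z ->
  smooth_fn A (pform_of (metric L) Y Z).
Proof.
move=> Ys Zs; have Ls := smooth_sqL hM hL.
have va (V : vfield) (f : TM -> R) := @smooth_vact _ _ _ _ hM V f.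
have s1 := va _ _ (smooth_gammaf hM Ys) (va _ _ (smooth_gammaf hM Zs) Ls).
have s2 := va _ _ (smooth_gammaf hM (smooth_fibre_derive Ys Zs)) Ls.
have s3 := smooth_fnM (smooth_fn_cst A 2^-1) (smooth_fnD s1 (smooth_fnN s2)).
apply: (smooth_fn_ext hM _ s3) => u u0.
apply: etrans (congr1 ( *%R 2^-1) (esym (metric_hessian hM hL Y Zs u0))) _.
by rewrite mulrA mulVf ?pnatr_eq0 // mul1r.
Qed.

(* The operations are opaque, to prevent the unifier from unfolding derivatives. *)
Fact act_op_subproof : {act_op : X -> F -> F |
  forall V f u, slit u -> act_op V f u = vact A u (V u) f}.
Proof.
by exists (fun V f =>
  @cut _ _ _ _ _ (fn_class hM) _ (smooth_vact hM (field_in V) (field_in f))) => *;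
  exact: cutE.
Qed.
Definition act_op := sval act_op_subproof.
Lemma act_opE V f u : slit u -> act_op V f u = vact A u (V u) f.
Proof. exact: (svalP act_op_subproof). Qed.

Fact bracket_op_subproof : {bracket_op : X -> X -> X |
  forall V W u, slit u -> bracket_op V W u = bracket B V W u}.
Proof.
by exists (fun V W =>
  @cut _ _ _ _ _ (vfield_class hM) _ (smooth_bracket_vfield hM (field_in V)
    (field_in W))) => *;
  exact: cutE.
Qed.
Definition bracket_op := sval bracket_op_subproof.
Lemma bracket_opE V W u : slit u -> bracket_op V W u = bracket B V W u.
Proof. exact: (svalP bracket_op_subproof). Qed.

Fact rho_op_subproof : {rho_op : X -> G |
  forall V u, slit u -> rho_op V u = rho A u (V u)}.
Proof.
by exists (fun V =>
  @cut _ _ _ _ _ (pfield_class hM) _ (smooth_rhof hM (field_in V))) => *;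
  exact: cutE.
Qed.
Definition rho_op := sval rho_op_subproof.
Lemma rho_opE V u : slit u -> rho_op V u = rho A u (V u).
Proof. exact: (svalP rho_op_subproof). Qed.

Fact gamma_op_subproof : {gamma_op : G -> X |
  forall Y u, slit u -> gamma_op Y u = gamma A u (Y u)}.
Proof.
by exists (fun Y =>
  @cut _ _ _ _ _ (vfield_class hM) _ (smooth_gammaf hM (field_in Y))) => *;
  exact: cutE.
Qed.
Definition gamma_op := sval gamma_op_subproof.
Lemma gamma_opE Y u : slit u -> gamma_op Y u = gamma A u (Y u).
Proof. exact: (svalP gamma_op_subproof). Qed.

Fact beta_op_subproof : {beta_op : G -> X |
  forall Y u, slit u -> beta_op Y u = beta A nabla u (Y u)}.
Proof.
by exists (fun Y =>
  @cut _ _ _ _ _ (vfield_class hM) _ (smooth_bt (field_in Y))) => *;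
  exact: cutE.
Qed.
Definition beta_op := sval beta_op_subproof.
Lemma beta_opE Y u : slit u -> beta_op Y u = beta A nabla u (Y u).
Proof. exact: (svalP beta_op_subproof). Qed.

Fact eta_op_subproof : {eta_op : G |
  forall u, slit u -> eta_op u = @eta R n M u}.
Proof.
by exists (@cut _ _ _ _ _ (pfield_class hM) _ (smooth_eta hM)) => *;
  exact: cutE.
Qed.
Definition eta_op := sval eta_op_subproof.
Lemma eta_opE u : slit u -> eta_op u = @eta R n M u.
Proof. exact: (svalP eta_op_subproof). Qed.

Fact sqL_op_subproof : {sqL_op : F |
  forall u, slit u -> sqL_op u = sqL L u}.
Proof.
by exists (@cut _ _ _ _ _ (fn_class hM) _ (smooth_sqL hM hL)) => *;
  exact: cutE.
Qed.
Definition sqL_op := sval sqL_op_subproof.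
Lemma sqL_opE u : slit u -> sqL_op u = sqL L u.
Proof. exact: (svalP sqL_op_subproof). Qed.

Fact metric_op_subproof : {metric_op : G -> G -> F |
  forall Y Z u, slit u -> metric_op Y Z u = metric L u (Y u) (Z u)}.
Proof.
by exists (fun Y Z =>
  @cut _ _ _ _ _ (fn_class hM) _ (smooth_metric (field_in Y) (field_in Z))) => *;
  exact: cutE.
Qed.
Definition metric_op := sval metric_op_subproof.
Lemma metric_opE Y Z u : slit u -> metric_op Y Z u = metric L u (Y u) (Z u).
Proof. exact: (svalP metric_op_subproof). Qed.

Fact nabla_op_subproof : {nabla_op : X -> G -> G |
  forall V Y u, slit u -> nabla_op V Y u = nabla u (V u) Y}.
Proof.
by exists (fun V Y =>
  @cut _ _ _ _ _ (pfield_class hM) _ (smooth_cov (field_in V) (field_in Y))) => *;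
  exact: cutE.
Qed.
Definition nabla_op := sval nabla_op_subproof.
Lemma nabla_opE V Y u : slit u -> nabla_op V Y u = nabla u (V u) Y.
Proof. exact: (svalP nabla_op_subproof). Qed.

Lemma vact_ext u w (f h : TM -> R) : slit u -> (forall v, slit v -> f v = h v) ->
  vact A u w f = vact A u w h.
Proof. by move=> u0 fh; exact: dact_slit_ext. Qed.

Lemma ev_funD (W' : lmodType R) (C : field_class A W') (Y Z : field C) :
  field_fun (Y + Z) = (fun u => Y u + Z u).
Proof. by apply/funext => u; exact: evD. Qed.

(** * Verification of the axioms of the algebraic structure *)

Lemma actDl V W f : act_op (V + W) f = act_op V f + act_op W f.
Proof.
apply: field_eq => u u0; rewrite evDf !(act_opE _ _ u0) evD.
exact: (dactDv _ _ (field_in f u u0)).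
Qed.

Lemma actZl h V f : act_op (h *: V) f = h * act_op V f.
Proof.
apply: field_eq => u u0; rewrite evM !(act_opE _ _ u0) evZv.
exact: (dactZv _ _ (field_in f u u0)).
Qed.

Lemma actD V f h : act_op V (f + h) = act_op V f + act_op V h.
Proof.
apply: field_eq => u u0; rewrite evDf !(act_opE _ _ u0).
have -> : field_fun (f + h) = (fun u => f u + h u) by apply/funext => v; exact: evDf.
exact: (dactD tR _ (field_in f u u0) (field_in h u u0)).
Qed.

Lemma actM V f h : act_op V (f * h) = act_op V f * h + f * act_op V h.
Proof.
apply: field_eq => u u0; rewrite evDf !evM !(act_opE _ _ u0).
have -> : field_fun (f * h) = (fun u => f u * h u) by apply/funext => v; exact: evM.
exact: (dactM hB _ (sd u0) (field_in f u u0) (field_in h u u0)).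
Qed.

Lemma brC V W : bracket_op V W = - bracket_op W V.
Proof. by apply: field_eq => u u0; rewrite evN !(bracket_opE _ _ u0) bracketC. Qed.

Lemma brD U V W : bracket_op U (V + W) = bracket_op U V + bracket_op U W.
Proof.
apply: field_eq => u u0; rewrite evD !(bracket_opE _ _ u0) (ev_funD V W).
exact: (bracketD hB (sd u0) (field_in U u u0) (field_in V u u0) (field_in W u u0)).
Qed.

Lemma brZ U f V : bracket_op U (f *: V) = act_op U f *: V + f *: bracket_op U V.
Proof.
apply: field_eq => u u0; rewrite evD !evZv !(bracket_opE _ _ u0) (act_opE _ _ u0).
have -> : field_fun (f *: V) = (fun u => f u *: V u) by apply/funext => v; exact: evZv.
exact: (bracketZ hB (sd u0) (field_in U u u0) (field_in V u u0) (field_in f u u0)).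
Qed.

Lemma jacobi U V W : bracket_op U (bracket_op V W) =
  bracket_op (bracket_op U V) W + bracket_op V (bracket_op U W).
Proof.
apply: field_eq => u u0; rewrite evD !(bracket_opE _ _ u0).
have bE V' W' v : slit v -> bracket_op V' W' v = bracket B V' W' v by exact: bracket_opE.
rewrite (bracket_slit_ext U u0 (bE V W)) (bracket_slit_ext V u0 (bE U W)).
rewrite (bracket_slit_extl W u0 (bE U V)).
exact: (bracket_jacobi hB (sd u0) (field_in U u u0) (field_in V u u0) (field_in W u u0)).
Qed.

Lemma br_act V W f : act_op (bracket_op V W) f =
  act_op V (act_op W f) - act_op W (act_op V f).
Proof.
apply: field_eq => u u0; rewrite evDf evNf !(act_opE _ _ u0) (bracket_opE _ _ u0).
have aE V' v : slit v -> act_op V' f v = vact A v (V' v) f by exact: act_opE.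
rewrite (vact_ext (V u) u0 (aE W)) (vact_ext (W u) u0 (aE V)).
exact: (bracket_act hB tR (sd u0) (field_in f u u0) (field_in V u u0) (field_in W u u0)).
Qed.

Lemma rhoD V W : rho_op (V + W) = rho_op V + rho_op W.
Proof.
by apply: field_eq => u u0; rewrite evD !(rho_opE _ u0) !(rhoE hM _ u0) evD linearD.
Qed.
Lemma rhoZ f V : rho_op (f *: V) = f *: rho_op V.
Proof.
by apply: field_eq => u u0; rewrite evZ !(rho_opE _ u0) !(rhoE hM _ u0) evZv linearZ.
Qed.
Lemma gamD Y Z : gamma_op (Y + Z) = gamma_op Y + gamma_op Z.
Proof.
apply: field_eq => u u0; rewrite evD !(gamma_opE _ u0) !(gammaE hM) evD.
by rewrite add_row_mx addr0.
Qed.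
Lemma gamZ f Y : gamma_op (f *: Y) = f *: gamma_op Y.
Proof.
apply: field_eq => u u0; rewrite evZv !(gamma_opE _ u0) !(gammaE hM) evZ.
by rewrite scale_row_mx scaler0.
Qed.
Lemma beta_linear u (a : R) (v w : 'rV[R]_n) : slit u ->
  beta A nabla u (a *: v + w) = a *: beta A nabla u v + beta A nabla u w.
Proof.
move=> u0; have [Kv rv] := beta_spec hM hr v u0.
have [Kw rw] := beta_spec hM hr w u0.
apply: (beta_unique hM hn hr u0).
  by rewrite /Kmap (nabla_linear hn _ _ _ u0
    (smooth_eta hM)) -!/(Kmap _ _ _) Kv Kw scaler0 addr0.
by move: rv rw; rewrite !(rhoE hM _ u0) linearP /= => -> ->.
Qed.
Lemma btD Y Z : beta_op (Y + Z) = beta_op Y + beta_op Z.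
Proof.
apply: field_eq => u u0; rewrite evD !(beta_opE _ u0) evD.
by have := beta_linear 1 (Y u) (Z u) u0; rewrite !scale1r.
Qed.
Lemma beta0 u : slit u -> beta A nabla u 0 = 0.
Proof.
move=> u0; have := beta_linear (-1) 0 0 u0.
by rewrite !scaleN1r oppr0 addr0 addNr.
Qed.
Lemma btZ f Y : beta_op (f *: Y) = f *: beta_op Y.
Proof.
apply: field_eq => u u0; rewrite evZv !(beta_opE _ u0) evZ.
by have := beta_linear (f u) (Y u) 0 u0; rewrite beta0 // !addr0.
Qed.
Lemma rho_gamma_op Y : rho_op (gamma_op Y) = 0.
Proof.
by apply: field_eq => u u0; rewrite ev0 (rho_opE _ u0) (rhoE hM _ u0) (gamma_opE _ u0)
  (gammaE hM) row_mxKl.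
Qed.
Lemma rho_beta_op Y : rho_op (beta_op Y) = Y.
Proof. by apply: field_eq => u u0; rewrite (rho_opE _ u0)
  (beta_opE _ u0); exact: rhof_betaf. Qed.

Lemma rho_bracket_gamma_opE Y V u : slit u ->
  rho_op (bracket_op (gamma_op Y) V) u = fibre_derive Y (rhof A V) u.
Proof.
move=> u0; rewrite (rho_opE _ u0) (bracket_opE _ _ u0).
have gE v : slit v -> gamma_op Y v = gammaf A Y v by exact: gamma_opE.
rewrite (bracket_slit_extl V u0 gE).
exact: (rho_bracket_gamma hM (field_in Y) (field_in V) u0).
Qed.

Lemma rho_bracket_gamma_op Y V : rho_op (bracket_op (gamma_op Y) V) =
  rho_op (bracket_op (gamma_op Y) (beta_op (rho_op V))).
Proof.
apply: field_eq => u u0; rewrite !(rho_bracket_gamma_opE _ _ u0).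
apply: (fibre_derive_slit_ext _ u0) => v v0.
have E : rho_op (beta_op (rho_op V)) v = rho_op V v by rewrite rho_beta_op.
exact: etrans (esym (rho_opE V v0)) (etrans (esym E) (rho_opE _ v0)).
Qed.

Definition vflat_op Y Z := rho_op (bracket_op (gamma_op Y) (beta_op Z)).

Lemma vflat_opE Y Z u : slit u -> vflat_op Y Z u = fibre_derive Y Z u.
Proof.
move=> u0; rewrite (rho_bracket_gamma_opE _ _ u0); apply:
  (fibre_derive_slit_ext _ u0) => v v0.
have E : rho_op (beta_op Z) v = Z v by rewrite rho_beta_op.
exact: etrans (esym (rho_opE _ v0)) E.
Qed.

Lemma bracket_gamma_op Y Z : bracket_op (gamma_op Y) (gamma_op Z) =
  gamma_op (vflat_op Y Z) - gamma_op (vflat_op Z Y).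
Proof.
apply: field_eq => u u0; rewrite evD evN (bracket_opE _ _ u0).
have gE (T : G) v : slit v -> gamma_op T v = gammaf A T v by exact: gamma_opE.
rewrite (bracket_slit_extl _ u0 (gE Y)) (bracket_slit_ext _ u0 (gE Z)).
rewrite (bracket_gamma hM (field_in Y) (field_in Z) u0) !(gamma_opE _ u0) !(vflat_opE _
  _ u0).
by rewrite !(gammaE hM) opp_row_mx add_row_mx subr0.
Qed.

Lemma vflat_eta_op Y : vflat_op Y eta_op = Y.
Proof.
apply: field_eq => u u0; rewrite (vflat_opE _ _ u0).
by rewrite (fibre_derive_slit_ext _ u0 eta_opE) fibre_derive_eta.
Qed.

Lemma fn_natE (m : nat) u : slit u -> (m%:R : F) u = m%:R.
Proof.
move=> u0; elim: m => [|m IH]; first by rewrite ev0.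
by rewrite -!natr1 evDf ev1 // IH.
Qed.

Lemma cancel2 f : 2 * f = 0 -> f = 0.
Proof.
move=> f0; apply: field_eq => u u0; have := congr1 (fun h : F => h u) f0.
rewrite evM (fn_natE _ u0) ev0 => /eqP; rewrite mulf_eq0 pnatr_eq0 /=.
by move/eqP.
Qed.

Lemma hessian Y Z : 2 * metric_op Y Z = act_op (gamma_op Y) (act_op
  (gamma_op Z) sqL_op) - act_op (gamma_op (vflat_op Y Z)) sqL_op.
Proof.
apply: field_eq => u u0; rewrite evM (fn_natE _ u0) evDf evNf
  (metric_opE _ _ u0) !(act_opE _ _ u0).
apply: etrans (metric_hessian hM hL Y (field_in Z) u0) _.
rewrite !(gamma_opE _ u0) (vflat_opE _ _ u0); congr (_ - _); last first.
  by apply: (vact_ext _ u0) => v v0; rewrite (sqL_opE v0).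
apply: (vact_ext _ u0) => v v0; rewrite (act_opE _ _ v0) (gamma_opE _ v0).
by apply: (vact_ext _ v0) => v' v'0; rewrite (sqL_opE v'0).
Qed.

Lemma act_eta_e : act_op (gamma_op eta_op) sqL_op = 2 * sqL_op.
Proof.
apply: field_eq => u u0; rewrite evM (fn_natE _ u0) (act_opE _ _ u0) (gamma_opE _ u0)
  (eta_opE u0) (sqL_opE u0).
rewrite (vact_ext _ u0 sqL_opE); exact: vact_eta_sqL.
Qed.

Lemma metric_op_inj Y : (forall Z, metric_op Y Z = 0) -> Y = 0.
Proof.
move=> gY; apply: field_eq => u u0; rewrite ev0; apply: (metric_inj hL u0) => w.
have [Z Zs <-] := pfield_at hM w u0.
have := congr1 (fun h : F => h u) (gY (@cut _ _ _ _ _ (pfield_class hM) _ Zs)).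
by rewrite (metric_opE _ _ u0) cutE // ev0.
Qed.

Lemma nabDl V W Y : nabla_op (V + W) Y = nabla_op V Y + nabla_op W Y.
Proof.
apply: field_eq => u u0; rewrite evD !(nabla_opE _ _ u0) evD.
exact: (nablaDl hn _ _ u0 (field_in Y)).
Qed.

Lemma nabZl f V Y : nabla_op (f *: V) Y = f *: nabla_op V Y.
Proof.
apply: field_eq => u u0; rewrite evZ !(nabla_opE _ _ u0) evZv.
exact: (nablaZl hn _ _ u0 (field_in Y)).
Qed.

Lemma nabD V Y Z : nabla_op V (Y + Z) = nabla_op V Y + nabla_op V Z.
Proof.
apply: field_eq => u u0; rewrite evD !(nabla_opE _ _ u0) (ev_funD Y Z).
by have [_ nD _ _] := hn; exact: nD u0 (field_in Y) (field_in Z).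
Qed.

Lemma nabZ V f Y : nabla_op V (f *: Y) = act_op V f *: Y + f *: nabla_op V Y.
Proof.
apply: field_eq => u u0; rewrite evD !evZ !(nabla_opE _ _ u0) (act_opE _ _ u0).
have -> : field_fun (f *: Y) = (fun u => f u *: Y u) by apply/funext => v; exact: evZ.
by have [_ _ nM _] := hn; exact: nM u0 (field_in f) (field_in Y).
Qed.

Lemma nabla_eta_op u w : slit u -> nabla u w eta_op = Kmap nabla u w.
Proof.
by move=> u0; apply: (nabla_slit_ext hM hn w u0 (field_in eta_op) (smooth_eta hM) eta_opE).
Qed.

Lemma nab_bt_eta Y : nabla_op (beta_op Y) eta_op = 0.
Proof.
apply: field_eq => u u0; rewrite ev0 (nabla_opE _ _ u0) (nabla_eta_op _ u0) (beta_opE _ u0).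
exact: (beta_spec hM hr _ u0).1.
Qed.

Lemma regularity V : rho_op V = 0 -> nabla_op V eta_op = 0 -> V = 0.
Proof.
move=> rV KV; apply: field_eq => u u0; rewrite ev0.
have [_] := hr u0; apply.
  by rewrite -(rho_opE V u0) rV ev0.
by rewrite -(nabla_eta_op _ u0) -(nabla_opE V eta_op u0) KV ev0.
Qed.

Lemma nabg V Y Z : act_op V (metric_op Y Z) =
  metric_op (nabla_op V Y) Z + metric_op Y (nabla_op V Z).
Proof.
apply: field_eq => u u0; have [_ _ cg _ _] := hC.
have := cg V Y Z (field_in V) (field_in Y) (field_in Z) u u0.
rewrite /cov2 /pform_of /cov => E.
rewrite evDf (act_opE _ _ u0) !(metric_opE _ _ u0) !(nabla_opE _ _ u0).
rewrite (vact_ext (V u) u0 (metric_opE Y Z)).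
by apply/eqP; rewrite -subr_eq0 opprD addrA; apply/eqP.
Qed.

Lemma nabQ Y Z : nabla_op (beta_op Y) Z - nabla_op (beta_op Z) Y =
  rho_op (bracket_op (beta_op Y) (beta_op Z)).
Proof.
apply: field_eq => u u0; have [_ _ _ cQ _] := hC.
have := cQ Y Z (field_in Y) (field_in Z) u u0.
rewrite /Qtorsion /torsion /cov => E.
rewrite evD evN !(nabla_opE _ _ u0) (rho_opE _ u0) (bracket_opE _ _ u0) !(beta_opE _ u0).
have bE T v : slit v -> beta_op T v = betaf A nabla T v by exact: beta_opE.
rewrite (bracket_slit_extl _ u0 (bE Y)) (bracket_slit_ext _ u0 (bE Z)).
move: E; rewrite /betaf.
have sb T : smooth_pfield A (rhof A (betaf A nabla (T : G))).
  exact: (smooth_rhof hM (smooth_bt (field_in T))).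
have nb w T := nabla_slit_ext hM hn w u0 (sb T) (field_in T) (fun v v0 => rhof_betaf T v0).
move=> E; have e1 := nb (beta A nabla u (Y u)) Z; have e2 := nb (beta A nabla u (Z u)) Y.
exact: etrans (f_equal2 (fun a b => a - b) (esym e1) (esym e2)) (subr0_eq E).
Qed.

Definition torsT_op Y Z := nabla_op (gamma_op Y) Z - vflat_op Y Z.

(** On the slit bundle [torsT_op] agrees with [Ttorsion]: the middle term of the torsion
    differentiates the projection of a vertical field, which is 0. *)
Lemma torsT_sym Y Z (W : G) : metric_op (torsT_op Y Z) W = metric_op (torsT_op Y W) Z.
Proof.
have cE T T' u : slit u -> torsT_op T T' u = Ttorsion A nabla T T' u.
  move=> u0; rewrite /torsT_op evD evN (nabla_opE _ _ u0) (vflat_opE _ _ u0).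
  rewrite /Ttorsion /torsion /cov.
  have sb : smooth_pfield A (rhof A (betaf A nabla T')).
    exact: (smooth_rhof hM (smooth_bt (field_in T'))).
  have e1 := nabla_slit_ext hM hn (gamma A u (T u)) u0 sb (field_in T')
    (fun v v0 => rhof_betaf T' v0).
  have sg := smooth_rhof hM (smooth_gammaf hM (field_in T)).
  have rg v : slit v -> rhof A (gammaf A T) v = (0 : G) v.
    by move=> v0; rewrite ev0 /rhof (rhoE hM _ v0) /gammaf (gammaE hM) row_mxKl.
  have e2 := nabla_slit_ext hM hn (beta A nabla u (T' u)) u0 sg (field_in (0 : G)) rg.
  have e3 : nabla u (beta A nabla u (T' u)) (0 : G) = 0.
    rewrite -(beta_opE T' u0) -(nabla_opE (beta_op T') 0 u0).
    have : nabla_op (beta_op T') (0 + 0) =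
      nabla_op (beta_op T') 0 + nabla_op (beta_op T') 0 by exact: nabD.
    rewrite addr0 -{1}[nabla_op _ _]addr0 => /addrI <-; exact: ev0.
  have e4 := rho_bracket_gamma_beta (field_in T) (field_in T') u0.
  rewrite (gamma_opE _ u0) -e4 /gammaf /betaf.
  have e5 := etrans (f_equal2 (fun a b => a - b) e1 (etrans e2 e3)) (subr0 _).
  exact: (f_equal2 (fun a b => a - b) (esym e5) (erefl (rho A u _))).
apply: field_eq => u u0; have [_ _ _ _ cT] := hC.
have := cT Y Z W (field_in Y) (field_in Z) (field_in W) u u0.
by rewrite !(metric_opE _ _ u0) !(cE _ _ _ u0).
Qed.

Lemma metric_op_eta : metric_op eta_op eta_op = sqL_op.
Proof.
have e2 : 2 * metric_op eta_op eta_op = 2 * sqL_op.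
  rewrite hessian vflat_eta_op act_eta_e; have -> : 2 * sqL_op = sqL_op + sqL_op by ring.
  by rewrite actD act_eta_e; ring.
by apply/eqP; rewrite -subr_eq0; apply/eqP/cancel2; rewrite mulrBr e2 subrr.
Qed.

Definition fn_of (f : TM -> R) (fs : smooth_fn A f) : F :=
  @cut _ _ _ _ _ (fn_class hM) _ fs.
Definition pf_of (Y : pfield) (Ys : smooth_pfield A Y) : G :=
  @cut _ _ _ _ _ (pfield_class hM) _ Ys.
Lemma fn_ofE (f : TM -> R) (fs : smooth_fn A f) u : slit u -> fn_of fs u = f u.
Proof. exact: cutE. Qed.
Lemma pf_ofE (Y : pfield) (Ys : smooth_pfield A Y) u : slit u -> pf_of Ys u = Y u.
Proof. exact: cutE. Qed.

(** Global frames need not exist, but a cut-off multiple of a field is a combination of global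
    fields. Two cut-offs are multiplied: one lets the components of [Y] be extended by 0, the other
    is carried by the fields of the frame. *)
Lemma bump_field u : slit u -> exists f : F, f u != 0 /\
  forall Y, exists a : 'I_n -> F, exists e : 'I_n -> G,
    f *: Y = \sum_j a j *: e j /\ (Y u = 0 -> forall j, a j u = 0).
Proof.
move=> u0; set i := chart_at A u.1.
have [f [fs fu f0]] := local_bump hM u0.
have [f' [f's f'u H]] := local_vfields hM u0.
have f1s := smooth_fnM fs f's.
exists (fn_of f1s); split.
  by rewrite (fn_ofE _ u0) mulf_neq0.
move=> Y.
have [E HE] := choice (fun j : 'I_n => H (row_mx (delta_mx ord0 j) 0)).
have Es j := smooth_rhof hM (HE j).1.
have ec j v : dom B i v -> chart_comp i v.1 (rhof A (E j) v) = f' v *: delta_mx ord0 j.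
  move=> iv; rewrite /rhof (rhoE hM _ (dom_slit iv)) -(lsubmx_chart_comp hM _ iv).
  by rewrite ((HE j).2 v iv) linearZ /= row_mxKl.
pose a j (v : TM) : R := if `[< dom A i v.1 >] then f v * chart_comp i v.1
  (Y v) ord0 j else 0.
have as_ j : smooth_fn A (a j).
  move=> v v0; case: (pselect (dom A i v.1)) => iv.
    have Bv : dom B i v by [].
    have Yv := (smooth_at_mxP B _ v).1 (smooth_pfieldE hM Bv (field_in Y)) ord0 j.
    apply: (smooth_at_dom_ext hM tR Bv) (smooth_atM (fs v v0) Yv) => w [iw _].
    by rewrite /a; case: asboolP.
  apply: (smooth_at_ext hB tR (sd v0) _ (smooth_at_cst B 0 v)).
  apply: near_mono (f0 v v0 iv) => z fz; rewrite /a; case: asboolP => // _.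
  by rewrite fz mul0r.
exists (fun j => fn_of (as_ j)).
exists (fun j => pf_of (Es j)); split; last first.
  move=> Yu j; rewrite (fn_ofE _ u0) /a; case: asboolP => // _.
  by rewrite Yu chart_comp0 mxE mulr0.
apply: field_eq => v v0; rewrite evZ (fn_ofE f1s v0).
have -> : field_fun (\sum_j fn_of (as_ j) *:
    pf_of (Es j)) v = \sum_j a j v *: rhof A (E j) v.
  rewrite (big_morph (fun T : G => T v) (id1 := 0) (op1 := +%R)); last first.
  - exact: ev0.
  - by move=> T T'; exact: evD.
  by apply: eq_bigr => j _; rewrite evZ (fn_ofE _ v0) (pf_ofE _ v0).
case: (pselect (dom A i v.1)) => iv; last first.
  have fv : f v = 0.
    have := nbhs_singleton (f0 v v0 iv).
    by rewrite (atlas_coordK hB (sd v0)).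
  rewrite fv mul0r scale0r big1 // => j _.
  by rewrite /a; case: asboolP => // _; rewrite scale0r.
have Bv : dom B i v by [].
apply: (chart_comp_inj hM Bv); rewrite (chart_comp_sum hM _ _ Bv).
rewrite (chart_compZ (manifold_atlas hM) _ _ iv).
set y := chart_comp i v.1 (Y v); rewrite {1}[y]row_sum_delta scaler_sumr.
apply: eq_bigr => j _; rewrite (chart_compZ (manifold_atlas hM) _ _ iv) (ec j v Bv).
rewrite /a; case: asboolP => // _; rewrite !scalerA; congr (_ *: _).
by rewrite -/y mulrAC.
Qed.

Section Tensors.
Variable T : G -> F.
Hypothesis TD : forall Y Z, T (Y + Z) = T Y + T Z.
Hypothesis TZ : forall f Y, T (f *: Y) = f * T Y.

Lemma tensor0 Y u : slit u -> Y u = 0 -> T Y u = 0.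
Proof.
move=> u0 Yu; have [f [fu /(_ Y) [a [e [E a0]]]]] := bump_field u0.
have T0 : T 0 = 0 by have := TZ 0 0; rewrite scale0r mul0r.
have := congr1 (fun h : F => h u) (congr1 T E).
rewrite TZ evM (big_morph T TD T0).
rewrite (big_morph (fun h : F => h u) (id1 := 0) (op1 := +%R)); last first.
- exact: ev0.
- by move=> h h'; exact: evDf.
rewrite big1 => [/eqP|j _]; last by rewrite TZ evM a0 // mul0r.
by rewrite mulf_eq0 (negbTE fu) => /eqP.
Qed.

(** By [tensor0] the value at [u] depends on the value of the argument at [u] only. This turns an
    operator that is merely linear over functions, such as a covariant derivative of [H], into a
    linear form on the fibre. *)
Lemma tensor_functional u : slit u -> exists2 l : 'rV[R]_n -> R,
  (forall a v w, l (a *: v + w) = a * l v + l w) & forall Y, T Y u = l (Y u).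
Proof.
move=> u0.
have ex w : exists Y : G, Y u = w.
  have [Y Ys Yu] := pfield_at hM w u0.
  by exists (pf_of Ys); rewrite (pf_ofE _ u0).
have [Y Yu] := choice ex.
have loc Z Z' : Z u = Z' u -> T Z u = T Z' u.
  move=> ZZ; have := tensor0 (Y := Z + (-1) *: Z') u0.
  rewrite evD evZ evNf ev1 // scaleN1r ZZ subrr => /(_ erefl).
  by rewrite TD TZ evDf evM evNf ev1 // mulN1r => /eqP; rewrite subr_eq0 => /eqP.
exists (fun w => T (Y w) u) => [a v w|Z]; last by apply: loc; rewrite Yu.
have aE : (fn_of (@smooth_fn_cst R n M A a) : F) u = a.
  exact: fn_ofE.
rewrite (loc _ (fn_of (@smooth_fn_cst R n M A a) *: Y v + Y w)).
  by rewrite TD TZ evDf evM aE.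
by rewrite evD evZ aE !Yu.
Qed.

End Tensors.

(** * The curvature hypothesis transferred to fields *)

Section Curvature.
Variables (k : TM -> R) (H : TM -> 'rV[R]_n -> 'rV[R]_n -> R).
Hypothesis dimM : (3 <= n)%N.
Hypothesis hk : smooth_fn A k.
Hypothesis hk0 : homogeneous0_fn A k.
Hypothesis k_neq0 : forall u, slit u -> k u != 0.
Hypothesis hH : smooth_tensor A H.
Hypothesis hHind : indicatory H.
Hypothesis hR : forall Y1 Y2 Y3 : pfield,
  smooth_pfield A Y1 -> smooth_pfield A Y2 -> smooth_pfield A Y3 ->
  forall u, slit u -> hcurvature A nabla Y1 Y2 Y3 u =
    k u *: (metric L u (Y1 u) (Y3 u) *: Y2 u - metric L u (Y2 u) (Y3 u) *: Y1 u
            + omega A L (pform_of H) Y1 Y2 Y3 u).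

Let smooth_H (Y Z : pfield) : smooth_pfield A Y -> smooth_pfield A Z ->
  smooth_fn A (pform_of H Y Z).
Proof. by case: hH => _ _; apply. Qed.

Fact H_op_subproof : {H_op : G -> G -> F |
  forall Y Z u, slit u -> H_op Y Z u = H u (Y u) (Z u)}.
Proof.
by exists (fun Y Z => fn_of (smooth_H (field_in Y) (field_in Z))) => *; exact: fn_ofE.
Qed.
Definition H_op := sval H_op_subproof.
Lemma H_opE Y Z u : slit u -> H_op Y Z u = H u (Y u) (Z u).
Proof. exact: (svalP H_op_subproof). Qed.

Definition k_op : F := fn_of hk.
Lemma k_opE u : slit u -> k_op u = k u. Proof. exact: fn_ofE. Qed.

Lemma sqL_neq0 u : slit u -> sqL L u != 0.
Proof. by move=> u0; rewrite gt_eqF //; exact: sqL_gt0 hL u u0. Qed.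

Lemma cancel_e f : sqL_op * f = 0 -> f = 0.
Proof.
move=> f0; apply: field_eq => u u0; have := congr1 (fun h : F => h u) f0.
rewrite evM (sqL_opE u0) ev0 => /eqP.
by rewrite mulf_eq0 (negbTE (sqL_neq0 u0)) => /eqP.
Qed.

Lemma cancel_k f : k_op * f = 0 -> f = 0.
Proof.
move=> f0; apply: field_eq => u u0; have := congr1 (fun h : F => h u) f0.
rewrite evM (k_opE u0) ev0 => /eqP.
by rewrite mulf_eq0 (negbTE (k_neq0 u0)) => /eqP.
Qed.

Lemma k_hom : act_op (gamma_op eta_op) k_op = 0.
Proof.
apply: field_eq => u u0; rewrite ev0 (act_opE _ _ u0) (gamma_opE _ u0) (eta_opE u0).
by rewrite (vact_ext _ u0 k_opE); exact: hk0.
Qed.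

Lemma H_op_ind Y : H_op Y eta_op = 0.
Proof.
apply: field_eq => u u0; rewrite ev0 (H_opE _ _ u0) (eta_opE u0).
by have [_] := hHind u0 (Y u).
Qed.

(** Otherwise all rows of the identity matrix would lie in the span of two vectors, against its rank
    [n], which is at least 3. *)
Lemma outside_plane (a b : 'rV[R]_n) :
  exists w : 'rV[R]_n, forall s t : R, w <> s *: a + t *: b.
Proof.
apply: contrapT => /forallNP Nw.
have sub : (1%:M <= col_mx a b)%MS.
  apply/row_subP => j; have /existsNP [s /existsNP [t /contrapT ->]] := Nw (row j 1%:M).
  by rewrite addmx_sub // scalemx_sub // -?addsmxE ?addsmxSl ?addsmxSr.
have := mxrankS sub; rewrite mxrank1 => le_n.
have := leq_trans le_n (rank_leq_row (col_mx a b)).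
by rewrite leqNgt dimM.
Qed.

(** The field is the component orthogonal to [eta], multiplied by [e], of a field whose value at [u]
    lies outside the plane of [eta u] and [b]; were it a multiple of [b] at [u], that value would
    fall back into the plane. The dimension hypothesis enters here. *)
Lemma perp_outside u (b : 'rV[R]_n) : slit u -> exists Y : G,
  metric_op Y eta_op = 0 /\ forall t, Y u <> t *: b.
Proof.
move=> u0; have [w wab] := outside_plane u.2 b.
have [Y0 Ys Yu] := pfield_at hM w u0.
pose Y := sqL_op *: pf_of Ys + (- metric_op (pf_of Ys) eta_op) *: eta_op; exists Y; split.
  apply: field_eq => v v0; rewrite ev0 (metric_opE _ _ v0) /Y evD !evZ evNf.
  rewrite (metricDl hM hL _ _ _ v0) !(metricZl hM hL _ _ _ v0) -!(metric_opE _ _ v0).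
  by rewrite metric_op_eta mulNr mulrC subrr.
move=> t; rewrite /Y evD !evZ evNf (sqL_opE u0) (eta_opE u0) (pf_ofE _ u0) Yu => E.
have e0 := sqL_neq0 u0.
apply: (wab ((sqL L u)^-1 * metric_op (pf_of Ys) eta_op u) ((sqL L u)^-1 * t)).
rewrite -[(_ * t) *: b]scalerA -E scalerDr !scalerA mulVf // scale1r addrCA.
by rewrite -scalerDl mulrN subrr scale0r addr0.
Qed.

Lemma perp_parallel (alpha : G -> F) :
  (forall Y Z, metric_op Y eta_op = 0 -> metric_op Z eta_op = 0 -> alpha Z *: Y =
    alpha Y *: Z) ->
  forall Z, metric_op Z eta_op = 0 -> alpha Z = 0.
Proof.
move=> aP Z Z0; apply: field_eq => u u0; rewrite ev0.
have [Y [Y0 Yu]] := perp_outside (Z u) u0.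
apply/eqP; apply: contraT => aZ.
have := congr1 (fun T : G => T u) (aP Y Z Y0 Z0); rewrite !evZ => E.
case: (Yu ((alpha Z u)^-1 * alpha Y u)).
by rewrite -scalerA -E scalerA mulVf // scale1r.
Qed.

Lemma perp_cancel f : (forall Y, metric_op Y eta_op = 0 -> metric_op Y Y * f = 0) -> f = 0.
Proof.
move=> fP; apply: field_eq => u u0; rewrite ev0.
have [Y [Y0 Yu]] := perp_outside 0 u0.
have := congr1 (fun h : F => h u) (fP Y Y0); rewrite evM (metric_opE _ _ u0) ev0 => /eqP.
have Yn : Y u != 0 by apply/eqP => YE; apply: (Yu 0); rewrite scaler0.
have [_ _ _ gp] := hL; have := gp u u0 (Y u) Yn => gY.
by rewrite mulf_eq0 (gt_eqF gY) => /eqP.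
Qed.

Local Notation cv := (curv bracket_op nabla_op).
Local Notation KN := (kulkarni eta_op sqL_op metric_op).
Local Notation dS := (derS act_op beta_op eta_op nabla_op).

(** Inner derivatives must be compared on the whole slit bundle before the outer one is taken, which
    is why the fields are assumed to agree at all nonzero vectors. *)
Lemma curvatureE (V0 W0 : vfield) (Z0 : pfield) V W Z u :
  smooth_vfield A V0 -> smooth_vfield A W0 -> smooth_pfield A Z0 ->
  (forall v, slit v -> V0 v = V v) -> (forall v, slit v -> W0 v = W v) ->
  (forall v, slit v -> Z0 v = Z v) -> slit u ->
  curvature A nabla V0 W0 Z0 u = cv V W Z u.
Proof.
move=> V0s W0s Z0s VE WE ZE u0.
have covE (U0 : vfield) U : (forall v, slit v -> U0 v = U v) ->
    forall v, slit v -> cov nabla U0 Z0 v = nabla_op U Z v.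
  move=> UE v v0; rewrite (nabla_opE U Z v0) /cov UE //.
  exact: (nabla_slit_ext hM hn (U v) v0 Z0s (field_in Z) ZE).
have cov2E (U0 U1 : vfield) U U' : smooth_vfield A U1 ->
    (forall v, slit v -> U0 v = U v) -> (forall v, slit v -> U1 v = U' v) ->
    cov nabla U0 (cov nabla U1 Z0) u = nabla_op U (nabla_op U' Z) u.
  move=> U1s UE U1E; rewrite (nabla_opE U _ u0).
  have E := nabla_slit_ext hM hn (U u) u0 (smooth_cov U1s Z0s) (field_in (nabla_op U' Z))
    (covE _ _ U1E).
  exact: etrans (congr1 (fun w => nabla u w (cov nabla U1 Z0)) (UE u u0)) E.
have e1 := cov2E V0 W0 V W W0s VE WE.
have e2 := cov2E W0 V0 W V V0s WE VE.
have e3 : cov nabla (bracket B V0 W0) Z0 u = nabla_op (bracket_op V W) Z u.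
  apply: covE => // v v0; rewrite (bracket_opE V W v0) (bracket_slit_extl _ v0 VE).
  exact: bracket_slit_ext.
rewrite /curv evD evD evN -e1 -e2 -e3; exact: erefl.
Qed.

Lemma hbarE u v w : slit u -> sqL L u * hbar L u v w =
  sqL L u * metric L u v w - metric L u v u.2 * metric L u w u.2.
Proof.
move=> u0; have L0 : L u != 0.
  by apply: contra_neq (sqL_neq0 u0) => LE; rewrite /sqL LE expr0n.
have alg (l a b c : R) : l != 0 ->
  l ^+ 2 * (a - l^-1 * b * (l^-1 * c)) = l ^+ 2 * a - b * c by move=> l0; field.
rewrite (metricC hM hL v u.2 u0) (metricC hM hL w u.2 u0); exact: alg.
Qed.

Lemma hbar_linear u a v w z : slit u ->
  hbar L u z (a *: v + w) = a * hbar L u z v + hbar L u z w.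
Proof.
have alg (s h1 h2 h3 m1 m2 m3 p1 p2 p3 q : R) : s != 0 -> s * h1 = s * m1 - q * p1 ->
    s * h2 = s * m2 - q * p2 -> s * h3 = s * m3 - q * p3 ->
    m1 = a * m2 + m3 -> p1 = a * p2 + p3 -> h1 = a * h2 + h3.
  move=> s0 e1 e2 e3 m1E p1E; apply: (mulfI s0).
  have -> : s * (a * h2 + h3) = a * (s * h2) + s * h3 by ring.
  by rewrite e1 m1E p1E e2 e3; ring.
move=> u0; apply: (alg _ _ _ _ _ _ _ _ _ _ _ (sqL_neq0 u0) (hbarE _ _ u0)
  (hbarE _ _ u0) (hbarE _ _ u0) _ (metric_linear hM hL _ _ _ _ u0)).
by rewrite (metricDr hM hL _ _ _ u0) (metricZr hM hL _ _ _ u0).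
Qed.

Lemma angularE Y Z u : slit u ->
  angular eta_op sqL_op metric_op Y Z u = sqL L u * hbar L u (Y u) (Z u).
Proof.
move=> u0; rewrite (hbarE _ _ u0) /angular evDf evNf !evM (sqL_opE u0) !(metric_opE _ _ u0).
by rewrite (eta_opE u0).
Qed.

(** The forms [lX] and [lY] stand for [b X0] and [b Y0] at [u]: for [mu_form], an operator built
    from derivatives, linearity on the fibre is not visible and has to be supplied. *)
Lemma omegaE (b : pfield -> pfield -> TM -> R) (X0 Y0 Z0 : pfield) u
    (lX lY : 'rV[R]_n -> R) w : slit u ->
  (forall a v w, lX (a *: v + w) = a * lX v + lX w) ->
  (forall a v w, lY (a *: v + w) = a * lY v + lY w) ->
  (forall T, smooth_pfield A T -> b X0 T u = lX (T u)) ->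
  (forall T, smooth_pfield A T -> b Y0 T u = lY (T u)) ->
  metric L u (omega A L b X0 Y0 Z0 u) w =
  (b X0 Z0 u * hbar L u (Y0 u) w + hbar L u (X0 u) (Z0 u) * lY w)
  - (b Y0 Z0 u * hbar L u (X0 u) w + hbar L u (Y0 u) (Z0 u) * lX w).
Proof.
move=> u0 lXl lYl bX bY.
have comb (a a' c c' : R) (p p' q q' : 'rV[R]_n) :
    metric L u (a *: p + a' *: p' - (c *: q + c' *: q')) w =
    a * metric L u p w + a' * metric L u p' w
    - (c * metric L u q w + c' * metric L u q' w).
  by rewrite (metricDl hM hL _ _ _ u0) (metricNl hM hL _ _ u0)
    !(metricDl hM hL _ _ _ u0) !(metricZl hM hL _ _ _ u0).
have ph (T : pfield) : metric L u (phi A L T u) w = hbar L u (T u) w.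
  apply: (sharpE hM hL w u0 (l := fun w => hbar L u (T u) w)) => // a v v'.
  exact: hbar_linear.
have eX := sharpE hM hL w u0 lXl bX; have eY := sharpE hM hL w u0 lYl bY.
apply: etrans (comb _ _ _ _ _ _ _ _) _.
apply: (f_equal2 (fun a a' => a - a')); apply: (f_equal2 +%R).
- exact: (congr1 ( *%R (b X0 Z0 u)) (ph Y0)).
- exact: (congr1 ( *%R (hbar L u (X0 u) (Z0 u))) eY).
- exact: (congr1 ( *%R (b Y0 Z0 u)) (ph X0)).
- exact: (congr1 ( *%R (hbar L u (Y0 u) (Z0 u))) eX).
Qed.

Lemma kulkarniE b X' Y Z (W : G) u : slit u ->
  KN b X' Y Z W u = sqL L u *
  ((b X' Z u * hbar L u (Y u) (W u) + hbar L u (X' u) (Z u) * b Y W u)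
  - (b Y Z u * hbar L u (X' u) (W u) + hbar L u (Y u) (Z u) * b X' W u)).
Proof.
have ev (f1 f2 f3 f4 f5 f6 f7 f8 : F) : (f1 * f2 + f3 * f4 - f5 * f6 - f7 * f8) u =
    f1 u * f2 u + f3 u * f4 u - f5 u * f6 u - f7 u * f8 u.
  by rewrite !evDf !evNf !evM.
have alg (s b1 h1 h2 b2 b3 h3 h4 b4 : R) :
    b1 * (s * h1) + s * h2 * b2 - b3 * (s * h3) - s * h4 * b4 =
    s * ((b1 * h1 + h2 * b2) - (b3 * h3 + h4 * b4)) by ring.
move=> u0; apply: etrans (ev _ _ _ _ _ _ _ _) _; rewrite !(angularE _ _ u0).
exact: alg.
Qed.

Lemma hcurvE X' Y Z (W : G) : sqL_op * metric_op (cv (beta_op X') (beta_op Y) Z) W =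
  k_op * (sqL_op * (metric_op X' Z * metric_op Y W - metric_op Y Z * metric_op X' W) +
    KN H_op X' Y Z W).
Proof.
apply: field_eq => u u0; have [_ Hl _] := hH.
have bE (T : G) v : slit v -> betaf A nabla T v =
  beta_op T v by move=> v0; rewrite (beta_opE T v0).
have E := curvatureE (smooth_bt (field_in X')) (smooth_bt (field_in Y)) (field_in Z)
  (bE X') (bE Y) (fun v _ => erefl) u0.
have := hR (field_in X') (field_in Y) (field_in Z) u0.
rewrite /hcurvature => /(etrans (esym E)) {}E.
have comb (a b c : R) (p q o w : 'rV[R]_n) : metric L u (c *: (a *: p - b *: q + o)) w =
    c * (a * metric L u p w - b * metric L u q w + metric L u o w).
  by rewrite (metricZl hM hL _ _ _ u0) !(metricDl hM hL _ _ _ u0)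
    (metricNl hM hL _ _ u0) !(metricZl hM hL _ _ _ u0).
have gE : metric_op (cv (beta_op X') (beta_op Y) Z) W u = k u *
    (metric L u (X' u) (Z u) * metric L u (Y u) (W u)
    - metric L u (Y u) (Z u) * metric L u (X' u) (W u)
    + metric L u (omega A L (pform_of H) X' Y Z u) (W u)).
  rewrite (metric_opE _ _ u0); apply: etrans (congr1 (fun v => metric L u v (W u)) E) _.
  exact: comb.
have oE := omegaE (b := pform_of H) (X0 := X') (Y0 := Y) Z (W u) u0
  (Hl u u0 ^~ (X' u)) (Hl u u0 ^~ (Y u)) (fun _ _ => erefl) (fun _ _ => erefl).
have ev (h f f1 f2 f3 f4 f5 : F) : (h * (f * (f1 * f2 - f3 * f4) + f5)) u =
    h u * (f u * (f1 u * f2 u - f3 u * f4 u) + f5 u).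
  by rewrite evM evDf evM evDf evNf !evM.
apply: etrans (evM _ _ _) _; rewrite gE oE.
apply: esym; apply: etrans (ev _ _ _ _ _ _ _) _.
rewrite (kulkarniE _ _ _ _ _ u0) (sqL_opE u0)
  (k_opE u0) !(metric_opE _ _ u0) !(H_opE _ _ u0).
have alg (s c a b o : R) : c * (s * (a - b) + s * o) = s * (c * (a - b + o)) by ring.
exact: alg.
Qed.

Lemma vcurvE X' Y Z (W : G) : 2 * k_op * sqL_op * sqL_op * sqL_op * metric_op (cv
  (gamma_op X') (gamma_op Y) Z) W =
  2 * k_op * sqL_op * KN H_op X' Y Z W + KN (dS (dS H_op)) X' Y Z W.
Proof.
exact: (vcurv_kulkarni actDl actZl actD actM brC brD brZ jacobi br_act rhoD rhoZ gamD
  gamZ btD btZ rho_gamma_op rho_beta_op rho_bracket_gamma_op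
    (fun _ _ => erefl) bracket_gamma_op vflat_eta_op cancel2 hessian
  act_eta_e metric_op_inj nabDl nabZl nabD nabZ nab_bt_eta regularity nabg nabQ
  (fun _ _ => erefl) torsT_sym (fun _ _ => erefl) (fun _ _ => erefl)
  cancel_e cancel_k k_hom H_op_ind perp_parallel perp_cancel hcurvE).
Qed.

(* b, an operator on all fields, restricts to b' on fields vanishing off the slit
   bundle. *)
Definition restricts_to (b : pfield -> pfield -> TM -> R) (b' : G -> G -> F) :=
  forall (X0 Y0 : pfield) (X' Y : G) u, smooth_pfield A X0 -> smooth_pfield A Y0 ->
  (forall v, slit v -> X0 v = X' v) -> (forall v, slit v -> Y0 v = Y v) ->
  slit u -> b X0 Y0 u = b' X' Y u.

Local Notation spray := (betaf A nabla (@eta R n M)).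

Lemma smooth_spray : smooth_vfield A spray.
Proof. exact: smooth_bt (smooth_eta hM). Qed.

Lemma sprayE u : slit u -> spray u = beta_op eta_op u.
Proof. by move=> u0; rewrite (beta_opE _ u0) (eta_opE u0). Qed.

Lemma cov_sprayE (X0 : pfield) (X' : G) u : smooth_pfield A X0 ->
  (forall v, slit v -> X0 v = X' v) -> slit u -> cov nabla spray X0 u =
    nabla_op (beta_op eta_op) X' u.
Proof.
move=> X0s XE u0; rewrite (nabla_opE _ _ u0) -(sprayE u0).
exact: (nabla_slit_ext hM hn _ u0 X0s (field_in X') XE).
Qed.

Lemma cov2_restricts b b' : restricts_to b b' ->
  restricts_to (cov2 A nabla spray b) (dS b').
Proof.
move=> bb X0 Y0 X' Y u X0s Y0s XE YE u0.
have e1 : vact A u (spray u) (b X0 Y0) = act_op (beta_op eta_op) (b' X' Y) u.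
  by rewrite (act_opE _ _ u0) (sprayE u0); apply: (vact_ext _ u0) => v v0; exact: bb.
have cs := smooth_cov smooth_spray.
have e2 : b (cov nabla spray X0) Y0 u = b' (nabla_op (beta_op eta_op) X') Y u.
  by apply: (bb _ _ _ _ _ (cs _ X0s) Y0s _ YE u0) => v v0; exact: (cov_sprayE X0s XE v0).
have e3 : b X0 (cov nabla spray Y0) u = b' X' (nabla_op (beta_op eta_op) Y) u.
  by apply: (bb _ _ _ _ _ X0s (cs _ Y0s) XE _ u0) => v v0; exact: (cov_sprayE Y0s YE v0).
by rewrite /cov2 /derS !evDf !evNf e1 e2 e3.
Qed.

Lemma H_restricts : restricts_to (pform_of H) H_op.
Proof.
by move=> X0 Y0 X' Y u _ _ XE YE u0; rewrite (H_opE _ _ u0) /pform_of XE // YE.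
Qed.

Lemma H0l u w : slit u -> H u 0 w = 0.
Proof.
have [Hl _ _] := hH; move=> u0; have := Hl u u0 1 0 0 w; rewrite scaler0 addr0 mul1r.
by move/eqP; rewrite -subr_eq0 opprD addNKr oppr_eq0 => /eqP.
Qed.

Lemma H0r u w : slit u -> H u w 0 = 0.
Proof.
have [_ Hl _] := hH; move=> u0; have := Hl u u0 1 w 0 0; rewrite scaler0 addr0 mul1r.
by move/eqP; rewrite -subr_eq0 opprD addNKr oppr_eq0 => /eqP.
Qed.

(** The spray annihilates [eta]. This removes the term of [cov3] that differentiates the first slot,
    so [hcov2] at [eta], [eta] is the derivative along the spray taken twice. *)
Lemma hcov_eta0 (X0 Y0 : pfield) u : smooth_pfield A X0 -> smooth_pfield A Y0 ->
  slit u -> hcov A nabla (pform_of H) (cov nabla spray (@eta R n M)) X0 Y0 u = 0.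
Proof.
move=> X0s Y0s u0.
have E : betaf A nabla (cov nabla spray (@eta R n M)) u = 0.
  rewrite {1}/betaf (_ : cov nabla spray (@eta R n M) u = 0) ?beta0 //.
  exact: (beta_spec hM hr _ u0).1.
rewrite /hcov /cov2 /pform_of /cov E.
rewrite (nabla0l hn u0 X0s) (nabla0l hn u0 Y0s) (H0l _ u0) (H0r _ u0) !subr0.
exact: dact0.
Qed.

Lemma hcov2_restricts :
  restricts_to (hcov2 A nabla (pform_of H) (@eta R n M) (@eta R n M)) (dS (dS H_op)).
Proof.
move=> X0 Y0 X' Y u X0s Y0s XE YE u0.
have := cov2_restricts (cov2_restricts H_restricts) X0s Y0s XE YE u0 => <-.
rewrite /hcov2 /cov3 (hcov_eta0 X0s Y0s u0) subr0; exact: erefl.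
Qed.

Section SecondArgument.
Variable b : G -> G -> F.
Hypothesis bD : forall X' Y Z, b X' (Y + Z) = b X' Y + b X' Z.
Hypothesis bZ : forall X' f Y, b X' (f *: Y) = f * b X' Y.

Lemma dSD X' Y Z : dS b X' (Y + Z) = dS b X' Y + dS b X' Z.
Proof. by rewrite /derS nabD !bD actD; ring. Qed.

Lemma dSZ X' f Y : dS b X' (f *: Y) = f * dS b X' Y.
Proof. by rewrite /derS nabZ bD !bZ actM; ring. Qed.

End SecondArgument.

Lemma H_opD X' Y Z : H_op X' (Y + Z) = H_op X' Y + H_op X' Z.
Proof.
apply: field_eq => u u0; have [_ Hl _] := hH.
rewrite evDf !(H_opE _ _ u0) evD; have := Hl u u0 1 (X' u) (Y u) (Z u).
by rewrite scale1r mul1r.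
Qed.

Lemma H_opZ X' f Y : H_op X' (f *: Y) = f * H_op X' Y.
Proof.
apply: field_eq => u u0; have [_ Hl _] := hH.
rewrite evM !(H_opE _ _ u0) evZ; have := Hl u u0 (f u) (X' u) (Y u) 0.
by rewrite addr0 (H0r _ u0) addr0.
Qed.

(** This supplies the linear form that [omegaE] requires; the part coming from the second derivative
    of [H] is obtained from [tensor_functional]. *)
Lemma mu_functional (X0 : pfield) (X' : G) u : smooth_pfield A X0 ->
  (forall v, slit v -> X0 v = X' v) -> slit u ->
  exists l : 'rV[R]_n -> R, [/\
    forall a v w, l (a *: v + w) = a * l v + l w,
    forall Y0 : pfield, smooth_pfield A Y0 -> mu_form A nabla L k H X0 Y0 u = l (Y0 u)
  & forall Y, l (Y u) = H_op X' Y u + dS (dS H_op) X' Y u / (2 * k u * sqL L u)].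
Proof.
move=> X0s XE u0; have [_ Hl _] := hH.
have [l2 l2l l2E] := tensor_functional (dSD (dSD H_opD) X')
  (dSZ (dSD H_opD) (dSZ H_opD H_opZ) X') u0.
exists (fun w => H u (X' u) w + l2 w / (2 * k u * sqL L u)); split.
- move=> a v w; rewrite (Hl u u0) l2l; ring.
- move=> Y0 Y0s.
  have YE v : slit v -> Y0 v = pf_of Y0s v by move=> v0; rewrite (pf_ofE Y0s v0).
  have e1 := hcov2_restricts X0s Y0s XE YE u0.
  rewrite /mu_form e1 l2E (YE u u0) /pform_of (XE u u0) (YE u u0); exact: erefl.
- by move=> Y; rewrite (H_opE _ _ u0) l2E.
Qed.

Theorem S4_like (X0 Y0 Z0 : pfield) u : smooth_pfield A X0 -> smooth_pfield A Y0 ->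
  smooth_pfield A Z0 -> slit u ->
  vcurvature A nabla X0 Y0 Z0 u =
  (L u ^+ 2)^-1 *: omega A L (mu_form A nabla L k H) X0 Y0 Z0 u.
Proof.
move=> X0s Y0s Z0s u0; apply: (metric_eq hM hL u0) => w.
pose X' := pf_of X0s; pose Y := pf_of Y0s; pose Z := pf_of Z0s.
have [W0 W0s Wu] := pfield_at hM w u0; pose W := pf_of W0s.
have pE (T0 : pfield) (T0s : smooth_pfield A T0) v : slit v -> T0 v = pf_of T0s v.
  by move=> v0; rewrite (pf_ofE T0s v0).
have [lX [lXl muX lXE]] := mu_functional X0s (pE _ X0s) u0.
have [lY [lYl muY lYE]] := mu_functional Y0s (pE _ Y0s) u0.
have oE := omegaE (b := mu_form A nabla L k H) (X0 := X0) (Y0 := Y0) Z0 w u0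
  lXl lYl muX muY.
have gE0 (T0 : pfield) (T0s : smooth_pfield A T0) v : slit v ->
    gammaf A T0 v = gamma_op (pf_of T0s) v.
  by move=> v0; rewrite (gamma_opE _ v0) /gammaf (pE T0 T0s v v0).
have cE : vcurvature A nabla X0 Y0 Z0 u = cv (gamma_op X') (gamma_op Y) Z u.
  exact: (curvatureE (smooth_gammaf hM X0s) (smooth_gammaf hM Y0s) Z0s
    (gE0 _ X0s) (gE0 _ Y0s) (pE _ Z0s) u0).
have wE : w = W u by rewrite (pf_ofE W0s u0) Wu.
have vE : metric L u (vcurvature A nabla X0 Y0 Z0 u) w =
  metric_op (cv (gamma_op X') (gamma_op Y) Z) W u.
  by rewrite (metric_opE _ _ u0) cE wE.
apply: etrans vE _; apply: etrans (esym (metricZl hM hL _ _ _ u0)).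
rewrite oE (muX _ Z0s) (muY _ Z0s) (pE _ X0s u u0) (pE _ Y0s u u0) (pE _ Z0s u u0) wE.
rewrite !lXE !lYE.
have := congr1 (fun f : F => f u) (vcurvE X' Y Z W).
have ev (f c e q p r : F) :
    (f * c * e * e * e * q) u = f u * c u * e u * e u * e u * q u /\
    (f * c * e * p + r) u = f u * c u * e u * p u + r u.
  by rewrite !evM evDf !evM.
move=> E; have {}E := etrans (esym (ev 2 k_op sqL_op _ 0 0).1) (etrans E
  (ev 2 k_op sqL_op 0 _ _).2).
move: E; rewrite !(kulkarniE _ _ _ _ _ u0) (sqL_opE u0) (k_opE u0) (fn_natE _ u0).
(* Of the three factors [e] on the left, one cancels the factor inside [kulkarni], one becomes the
   outer [e^-1], and one enters the denominator [2 * c * e] of mu. *)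
have alg (e c q a b d f h1 h2 h3 h4 p1 p2 p3 p4 : R) : e != 0 -> c != 0 ->
    2 * c * e * e * e * q = 2 * c * e * (e * ((h1 * a + b * h2) - (h3 * d + f * h4)))
      + e * ((p1 * a + b * p2) - (p3 * d + f * p4)) ->
    q = e^-1 * (((h1 + p1 / (2 * c * e)) * a + b * (h2 + p2 / (2 * c * e)))
      - ((h3 + p3 / (2 * c * e)) * d + f * (h4 + p4 / (2 * c * e)))).
  move=> e0 c0 E; have ce0 : 2 * c * e * e * e != 0.
    by rewrite !mulf_neq0 // pnatr_eq0.
  by apply: (mulfI ce0); rewrite E; field; rewrite e0 c0.
exact: (alg _ _ _ _ _ _ _ _ _ _ _ _ _ _ _ (sqL_neq0 u0) (k_neq0 u0)).
Qed.

End Curvature.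
End Instance.

Theorem corollary3p5 (R : realType) (n : nat) (M : topologicalType)
    (A : atlas R n M) (L : TM R n M -> R)
    (nabla : TM R n M -> 'rV[R]_(n + n) -> (TM R n M -> 'rV[R]_n) -> 'rV[R]_n)
    (k : TM R n M -> R) (H : TM R n M -> 'rV[R]_n -> 'rV[R]_n -> R)
    (dimM : (3 <= n)%N)
    (hM : smooth_manifold A)
    (hL : finsler_function A L)
    (hnabla : cartan_connection A nabla L)
    (hk : smooth_fn A k)
    (hk0 : homogeneous0_fn A k)
    (k_neq0 : forall u, slit u -> k u != 0)
    (hH : smooth_tensor A H)
    (hHsym : symmetric_tensor H)
    (hHind : indicatory H)
    (hH0 : homogeneous0 A nabla (pform_of H))
    (hR : forall X Y Z : TM R n M -> 'rV[R]_n,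
      smooth_pfield A X -> smooth_pfield A Y -> smooth_pfield A Z ->
      forall u, slit u ->
        hcurvature A nabla X Y Z u =
        k u *: (metric L u (X u) (Z u) *: Y u - metric L u (Y u) (Z u) *: X u
                + omega A L (pform_of H) X Y Z u)) :
  forall X Y Z : TM R n M -> 'rV[R]_n,
    smooth_pfield A X -> smooth_pfield A Y -> smooth_pfield A Z ->
    forall u, slit u ->
      vcurvature A nabla X Y Z u =
      (L u ^+ 2)^-1 *: omega A L (mu_form A nabla L k H) X Y Z u.
Proof.
move=> X Y Z Xs Ys Zs u u0.
exact: (S4_like hM hL hnabla dimM hk hk0 k_neq0 hH hHind hR Xs Ys Zs u0).
Qed.
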